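(* The coefficients $a_{2n}$ satisfy the asymptotic formula $$a_{2n}=\left(1+O\left(\frac{\log\log n}{\log n}\right)\right)\frac{\pi^{1/4}}{2^{2n-\frac52}(2n)!}\left(\frac{2n}{\log(2n)}\right)^{7/4}\exp\left[2n\left(\log\left(\frac{2n}{\pi}\right)-W\left(\frac{2n}{\pi}\right)-\frac{1}{W\left(\frac{2n}{\pi}\right)}\right)\right]$$ as $n\to\infty$.
   Context: The Riemann xi function is the entire function $\xi(s)=\frac12 s(s-1)\pi^{-s/2}\Gamma(s/2)\zeta(s)$. The numbers $a_{2n}$ are its Taylor coefficients around $s=\frac12$: $$\xi(s)=\sum_{n=0}^\infty a_{2n}\left(s-\frac12\right)^{2n}$$ (only even powers appear since $\xi(1-s)=\xi(s)$). $W:[0,\infty)\to[0,\infty)$ is the Lambert $W$-function, i.e. the unique increasing function satisfying $W(xe^x)=x$ for all $x\ge0$. *)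

(* Defs.v *)
From Stdlib Require Import Reals Factorial.
From Coquelicot Require Import Coquelicot.

Open Scope R_scope.

Definition cexp (z : C) : C :=
  (exp (Re z) * cos (Im z), exp (Re z) * sin (Im z)).

(** [rcpow x z] is x^z with the real logarithm of the base; it is only used for
    [0 < x] (Stdlib's [ln] is 0 elsewhere). *)
Definition rcpow (x : R) (z : C) : C := cexp (z * RtoC (ln x))%C.

(** [ex_derive] at type [C -> C] is complex differentiability. *)
Definition holomorphic_on (D : C -> Prop) (f : C -> C) : Prop :=
  forall z : C, D z -> ex_derive f z.

Definition entire (f : C -> C) : Prop := holomorphic_on (fun _ => True) f.

Definition nonpos_integer (z : C) : Prop := exists k : nat, z = RtoC (- INR k).

(** The predicates below determine their argument uniquely on the stated domain
    (identity theorem); values at the poles are left unconstrained. *)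

Definition is_Gamma (Gamma : C -> C) : Prop :=
  holomorphic_on (fun z => ~ nonpos_integer z) Gamma /\
  forall z : C, 0 < Re z ->
    is_RInt_gen (V := C_R_NormedModule)
      (fun t : R => (rcpow t (z - 1) * RtoC (exp (- t)))%C)
      (at_right 0) (Rbar_locally p_infty) (Gamma z).

Definition is_zeta (zeta : C -> C) : Prop :=
  holomorphic_on (fun s => s <> RtoC 1) zeta /\
  forall s : C, 1 < Re s ->
    is_series (fun k : nat => rcpow (INR (S k)) (- s)%C) (zeta s).

(** The formula is imposed wherever each of its factors is defined; at the
    remaining points (s = 1 and s = 0, -2, -4, ...) the singularities are
    removable and the value of xi is forced by [entire]. *)
Definition is_xi (Gamma zeta xi : C -> C) : Prop :=
  entire xi /\
  forall s : C, s <> RtoC 1 -> ~ nonpos_integer (s / 2)%C ->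
    xi s = (1 / 2 * s * (s - 1) * rcpow PI (- s / 2)
            * Gamma (s / 2) * zeta s)%C.

(** [a k] is the k-th Taylor coefficient at [c] of the entire function [f]. *)
Definition is_taylor_coeffs (f : C -> C) (c : C) (a : nat -> C) : Prop :=
  forall s : C, is_pseries a (s - c)%C (f s).

Definition is_LambertW (W : R -> R) : Prop :=
  (forall x, 0 <= x -> 0 <= W x) /\
  (forall x y, 0 <= x -> x < y -> W x < W y) /\
  (forall x, 0 <= x -> W (x * exp x) = x).

Definition big_O (u v : nat -> R) : Prop :=
  exists K : R, eventually (fun n => Rabs (u n) <= K * Rabs (v n)).

(* Main.v *)
Require Import Defs.
From Stdlib Require Import Reals Factorial Lra Lia Psatz.
From Coquelicot Require Import Coquelicot.
Open Scope R_scope.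
Set Bullet Behavior "Strict Subproofs".

(** Write psi(x) for the sum of exp(-pi n^2 x) over n >= 1, and
    E(y) = exp(y/4) psi(exp y).

    Why the formula holds.  For s = 1/2 + z with z > 1/2 the integral of Gamma and
    the series of zeta combine into pi^(-s/2) Gamma(s/2) zeta(s), the integral
    of exp(z y/2) E(y) over the line ([mellin_psi]).  The functional equation
    of theta folds the negative half-line onto the positive one at the price
    of the elementary term 1/(z^2 - 1/4) ([mellin_split]), which the factor
    s(s-1)/2 turns into the constant 1/2.  Expanding 2 cosh(z y/2) in powers of
    z ([cosh_expansion]) exhibits xi(1/2 + z), for z > 1/2, as a power series in z
    whose coefficients are explicit in the moments M_j, the integrals of
    y^j E(y) over y > 0.  Two power series that converge everywhere and agree
    on a half-line have the same coefficients ([entire_identity]), hence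
    ([xi_taylor], [xi_coeff_even])
      a_{2n} = 2^(-2n)/(2n)! * (4 * 2n (2n-1) M_{2n-2} - M_{2n}/4).

    The moments are evaluated by Laplace's method.  Up to a negligible factor,
    y^(2n-j) E(y) is y^(2n-j) exp(y/4 - pi exp y).  The exponent
    2n log y - pi exp y is maximal at w = W(2n/pi), where pi exp w = 2n/w; call
    this number lam.  Its second derivative there is -lam (1 + 1/w), so the
    integral is w^(2n-j) exp(w/4 - lam) sqrt(2 pi/lam) up to a relative error O(1/w)
    ([moment_bounds]).  Because lam is exponentially large in w, every other
    source of error is far smaller than 1/w, and so is the
    contribution of M_{2n} to a_{2n}.  The resulting main term is the stated one
    with (2n/w)^(7/4) in place of (2n/log(2n))^(7/4); since
    log(2n) = w + log w + log pi, the exchange costs a relative error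
    O(log w/w) = O(loglog n/log n) ([coefficient_ratio_bound],
    [ln_ratio_bound]).

    The functional equation of theta is obtained by Polya's elementary route:
    averaging cos^(2m) over the points pi j/l gives a Poisson summation
    formula with finite sums ([finite_poisson_identity]), and both sides converge
    to theta values when l/sqrt m tends to a constant.  The unknown factor, the
    limit of the central binomial weight, is found by evaluating at x = 1.

    All functions integrated over an unbounded interval are nonnegative there,
    so improper integrals are handled as limits of integrals over [-k, k] or
    [0, k], and monotonicity in k replaces dominated convergence. *)

(** * A finite Poisson summation formula *)

Fixpoint sum1 (a : nat -> R) (N : nat) : R :=
  match N with O => 0 | S n => sum1 a n + a (S n) end.

Lemma sum1_ext (a b : nat -> R) N :
  (forall r, (1 <= r <= N)%nat -> a r = b r) -> sum1 a N = sum1 b N.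
Proof.
  induction N as [|N IH]; intros H; simpl; [reflexivity|].
  rewrite IH by (intros; apply H; lia). rewrite (H (S N)) by lia. reflexivity.
Qed.

Lemma sum1_lin (c d : R) (a b : nat -> R) N :
  sum1 (fun r => c * a r + d * b r) N = c * sum1 a N + d * sum1 b N.
Proof. induction N as [|N IH]; simpl; [ring|rewrite IH; ring]. Qed.

Lemma sum1_scal (c : R) (a : nat -> R) N :
  sum1 (fun r => c * a r) N = c * sum1 a N.
Proof. induction N as [|N IH]; simpl; [ring|rewrite IH; ring]. Qed.

Lemma sum1_one N : sum1 (fun _ => 1) N = INR N.
Proof. induction N as [|N IH]; [reflexivity|]. rewrite S_INR, <- IH. reflexivity. Qed.

Lemma sum1_switch (a : nat -> nat -> R) N M :
  sum1 (fun j => sum1 (fun r => a j r) N) M = sum1 (fun r => sum1 (fun j => a j r) M) N.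
Proof.
  induction M as [|M IH]; simpl.
  - induction N as [|N IHN]; simpl; [reflexivity|rewrite <- IHN; ring].
  - rewrite IH.
    transitivity (1 * sum1 (fun r => sum1 (fun j => a j r) M) N
                  + 1 * sum1 (fun r => a (S M) r) N); [ring|].
    rewrite <- sum1_lin. apply sum1_ext; intros; ring.
Qed.

Lemma sum1_add (a : nat -> R) N M :
  sum1 a (N + M) = sum1 a N + sum1 (fun r => a (N + r)%nat) M.
Proof.
  induction M as [|M IH]; simpl.
  - rewrite Nat.add_0_r; ring.
  - rewrite <- plus_n_Sm; simpl. rewrite IH. ring.
Qed.

Lemma sum1_sum_n (a : nat -> R) N :
  sum_n (fun n => a (S n)) N = sum1 a (S N).
Proof.
  induction N as [|N IH].
  - rewrite sum_O; simpl; ring.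
  - rewrite sum_Sn, IH. reflexivity.
Qed.

(** The quotient of the binomial coefficient (2m choose m+r) by the central one
    (2m choose m); as a product it vanishes by itself for r > m. *)
Fixpoint binomial_ratio (m r : nat) : R :=
  match r with
  | O => 1
  | S i => binomial_ratio m i * ((INR m - INR i) / (INR m + INR i + 1))
  end.

(** The central binomial coefficient (2m choose m) divided by 4^m. *)
Fixpoint central_weight (m : nat) : R :=
  match m with
  | O => 1
  | S i => central_weight i * ((2 * INR i + 1) / (2 * INR i + 2))
  end.

Lemma binomial_ratio_out m r : (m < r)%nat -> binomial_ratio m r = 0.
Proof.
  induction r as [|r IH]; intros H; [lia|]. simpl.
  destruct (Nat.eq_dec m r) as [->|Hn].
  - unfold Rminus; rewrite Rplus_opp_r. unfold Rdiv; ring.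
  - rewrite IH by lia. ring.
Qed.

Lemma binomial_ratio_succ_l m i :
  binomial_ratio (S m) (S i) =
  binomial_ratio m i * ((INR m + 1) ^ 2 / ((INR m + INR i + 1) * (INR m + INR i + 2))).
Proof.
  assert (Hm := pos_INR m).
  induction i as [|i IH].
  - cbn [binomial_ratio]. rewrite S_INR. simpl INR. field; lra.
  - assert (Hi := pos_INR i).
    change (binomial_ratio (S m) (S (S i))) with
      (binomial_ratio (S m) (S i) * ((INR (S m) - INR (S i)) / (INR (S m) + INR (S i) + 1))).
    rewrite IH. cbn [binomial_ratio]. rewrite !S_INR. field; lra.
Qed.

(** Pascal's rule applied twice, dividing by 4 at each step of m. *)
Lemma pascal_ratio m i :
  central_weight (S m) * binomial_ratio (S m) (S i) =
  central_weight m * (binomial_ratio m i + 2 * binomial_ratio m (S i) + binomial_ratio m (S (S i))) / 4.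
Proof.
  assert (Hm := pos_INR m). assert (Hi := pos_INR i).
  rewrite binomial_ratio_succ_l. cbn [central_weight binomial_ratio]. rewrite !S_INR. field; lra.
Qed.

(** Summation by parts for the product formula of cosines; the sum starts
    at r = 1, hence the boundary terms. *)
Lemma sum1_cos_shift (b : nat -> R) x N :
  sum1 (fun r => b r * (cos (2 * INR (S r) * x) + cos (2 * INR (pred r) * x))) N
  = sum1 (fun r => (b (pred r) + b (S r)) * cos (2 * INR r * x)) N
    + b N * cos (2 * INR (S N) * x) - b O * cos (2 * x)
    + b 1%nat - b (S N) * cos (2 * INR N * x).
Proof.
  induction N as [|N IH].
  - simpl. replace (2 * 0 * x) with 0 by ring. rewrite cos_0.
    replace (2 * 1 * x) with (2 * x) by ring. ring.
  - cbn [sum1]. rewrite IH. cbn [pred]. ring.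
Qed.

(** The Fourier expansion of cos^(2m).  Any truncation N >= m is allowed, since
    the coefficients vanish beyond m; a multiple of the cycle length will
    be chosen below. *)
Lemma cos_even_power m : forall N x, (m <= N)%nat ->
  cos x ^ (2 * m)
  = central_weight m * (1 + 2 * sum1 (fun r => binomial_ratio m r * cos (2 * INR r * x)) N).
Proof.
  induction m as [|m IH]; intros N x HN.
  - rewrite (sum1_ext _ (fun r => 0 * 1) N).
    + rewrite sum1_scal. simpl; ring.
    + intros r Hr. rewrite binomial_ratio_out by lia. ring.
  - replace (2 * S m)%nat with (2 + 2 * m)%nat by lia.
    rewrite pow_add, (IH N x) by lia.
    replace (cos x ^ 2) with ((1 + cos (2 * x)) / 2)
      by (rewrite cos_2a_cos; field).
    set (b := binomial_ratio m).
    assert (Hp : 2 * cos (2 * x) * sum1 (fun r => b r * cos (2 * INR r * x)) N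
      = sum1 (fun r => b r * (cos (2 * INR (S r) * x) + cos (2 * INR (pred r) * x))) N).
    { rewrite <- sum1_scal. apply sum1_ext. intros r Hr.
      destruct r as [|r]; [lia|]. cbn [pred].
      replace (2 * INR (S (S r)) * x) with (2 * INR (S r) * x + 2 * x)
        by (rewrite (S_INR (S r)); ring).
      replace (2 * INR r * x) with (2 * INR (S r) * x - 2 * x)
        by (rewrite S_INR; ring).
      rewrite cos_plus, cos_minus. ring. }
    rewrite sum1_cos_shift in Hp.
    assert (HbN : b N * cos (2 * INR (S N) * x) = 0)
      by (unfold b; rewrite binomial_ratio_out by lia; ring).
    assert (HbN' : b (S N) * cos (2 * INR N * x) = 0)
      by (unfold b; rewrite binomial_ratio_out by lia; ring).
    rewrite HbN, HbN' in Hp.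
    assert (Hs : central_weight (S m) * sum1 (fun r => binomial_ratio (S m) r * cos (2 * INR r * x)) N
       = central_weight m / 4 * (2 * sum1 (fun r => b r * cos (2 * INR r * x)) N
           + 1 * sum1 (fun r => (b (pred r) + b (S r)) * cos (2 * INR r * x)) N)).
    { rewrite <- sum1_lin, <- !sum1_scal. apply sum1_ext. intros r Hr.
      destruct r as [|r]; [lia|]. cbn [pred]. rewrite <- Rmult_assoc, pascal_ratio.
      unfold b. field. }
    set (S0 := sum1 (fun r => binomial_ratio (S m) r * cos (2 * INR r * x)) N) in *.
    replace (central_weight (S m) * (1 + 2 * S0)) with (central_weight (S m) + 2 * (central_weight (S m) * S0))
      by ring.
    rewrite Hs.
    assert (Hb0 : b O = 1) by reflexivity.
    assert (Hb1 : b 1%nat = INR m / (INR m + 1)).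
    { unfold b; simpl. field. assert (H := pos_INR m); lra. }
    rewrite Hb0, Hb1 in Hp.
    set (S1 := sum1 (fun r => b r * cos (2 * INR r * x)) N) in *.
    set (S2 := sum1 (fun r => (b (pred r) + b (S r)) * cos (2 * INR r * x)) N) in *.
    replace S2 with (2 * cos (2 * x) * S1 + cos (2 * x) - INR m / (INR m + 1)) by lra.
    cbn [central_weight]. assert (H := pos_INR m). field. lra.
Qed.

(** The Dirichlet kernel, multiplied by sin y to avoid a quotient. *)
Lemma dirichlet_kernel y p :
  sin y * (1 + 2 * sum1 (fun j => cos (2 * INR j * y)) p) = sin ((2 * INR p + 1) * y).
Proof.
  induction p as [|p IH].
  - simpl. replace ((2 * 0 + 1) * y) with y by ring. ring.
  - cbn [sum1].
    replace (sin y * (1 + 2 * (sum1 (fun j => cos (2 * INR j * y)) p + cos (2 * INR (S p) * y))))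
      with (sin y * (1 + 2 * sum1 (fun j => cos (2 * INR j * y)) p)
            + 2 * (cos (2 * INR (S p) * y) * sin y)) by ring.
    rewrite IH.
    replace ((2 * INR p + 1) * y) with (2 * INR (S p) * y - y) by (rewrite S_INR; ring).
    replace ((2 * INR (S p) + 1) * y) with (2 * INR (S p) * y + y) by ring.
    rewrite sin_plus, sin_minus. ring.
Qed.

Lemma sin_INR_PI k : sin (INR k * PI) = 0.
Proof.
  induction k as [|k IH].
  - simpl. rewrite Rmult_0_l. apply sin_0.
  - rewrite S_INR, Rmult_plus_distr_r, Rmult_1_l, neg_sin, IH. ring.
Qed.

Lemma cos_2INR_PI k : cos (2 * INR k * PI) = 1.
Proof.
  replace (2 * INR k * PI) with (2 * (INR k * PI)) by ring.
  rewrite cos_2a_sin, sin_INR_PI. ring.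
Qed.

Lemma sin_shift_neq0 k x : 0 < x < PI -> sin (x + INR k * PI) <> 0.
Proof.
  intros Hx. induction k as [|k IH].
  - simpl. rewrite Rmult_0_l, Rplus_0_r. assert (H := sin_gt_0 x). lra.
  - rewrite S_INR. replace (x + (INR k + 1) * PI) with (x + INR k * PI + PI) by ring.
    rewrite neg_sin. lra.
Qed.

(** This lemma and the next form the roots-of-unity filter for the odd
    cycle length l = 2p+1: the cosine sum over residues is l on multiples of l
    and 0 elsewhere.  An odd l makes the residues -p, ..., p symmetric, with all
    angles strictly inside (-pi/2, pi/2). *)
Lemma cos_sum_dvd p k :
  1 + 2 * sum1 (fun j => cos (2 * INR (k * (2 * p + 1)) * (PI * INR j / INR (2 * p + 1)))) p
  = INR (2 * p + 1).
Proof.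
  assert (Hl : 0 < INR (2 * p + 1)) by (apply lt_0_INR; lia).
  rewrite (sum1_ext _ (fun j => 1 * 1) p).
  - rewrite sum1_scal, sum1_one, plus_INR, mult_INR. simpl. ring.
  - intros j _. rewrite Rmult_1_l, <- (cos_2INR_PI (k * j)). f_equal.
    rewrite !(mult_INR k). field. lra.
Qed.

Lemma cos_sum_ndvd p k i : (1 <= i <= 2 * p)%nat ->
  1 + 2 * sum1 (fun j => cos (2 * INR (k * (2 * p + 1) + i) * (PI * INR j / INR (2 * p + 1)))) p
  = 0.
Proof.
  intros Hi. assert (Hl : 0 < INR (2 * p + 1)) by (apply lt_0_INR; lia).
  set (y := PI * INR i / INR (2 * p + 1) + INR k * PI).
  rewrite (sum1_ext _ (fun j => cos (2 * INR j * y)) p).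
  2:{ intros j _. f_equal. unfold y. rewrite plus_INR, mult_INR. field. lra. }
  assert (Hpi := PI_RGT_0).
  assert (Hs : sin y <> 0).
  { apply sin_shift_neq0. assert (0 < INR i) by (apply lt_0_INR; lia).
    assert (INR i < INR (2 * p + 1)) by (apply lt_INR; lia).
    split.
    - apply Rdiv_lt_0_compat; [apply Rmult_lt_0_compat; assumption|assumption].
    - apply Rmult_lt_reg_r with (INR (2 * p + 1)); [assumption|].
      unfold Rdiv. rewrite Rmult_assoc, Rinv_l by lra. nra. }
  apply Rmult_eq_reg_l with (sin y); [|assumption].
  rewrite dirichlet_kernel, Rmult_0_r.
  replace (2 * INR p + 1) with (INR (2 * p + 1)) by (rewrite plus_INR, mult_INR; simpl; ring).
  replace (INR (2 * p + 1) * y) with (INR (i + k * (2 * p + 1)) * PI).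
  - apply sin_INR_PI.
  - unfold y. rewrite plus_INR, mult_INR. field. lra.
Qed.

(** Summing the Fourier expansion of cos^(2m) over the points pi j/l keeps
    only the frequencies divisible by l. *)
Lemma finite_poisson_identity m p :
  1 + 2 * sum1 (fun j => cos (PI * INR j / INR (2 * p + 1)) ^ (2 * m)) p
  = central_weight m * INR (2 * p + 1)
    * (1 + 2 * sum1 (fun k => binomial_ratio m (k * (2 * p + 1))) m).
Proof.
  set (l := (2 * p + 1)%nat). set (x := fun j => PI * INR j / INR l).
  set (D := fun r => 1 + 2 * sum1 (fun j => cos (2 * INR r * x j)) p).
  assert (HD1 : forall k, D (k * l)%nat = INR l) by (intro k; apply cos_sum_dvd).
  assert (HD0 : forall k i, (1 <= i <= 2 * p)%nat -> D (k * l + i)%nat = 0)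
    by (intros k i Hi; apply cos_sum_ndvd; assumption).
  (* Over K full periods the filter keeps one term per period. *)
  assert (HDf : forall K, sum1 (fun r => binomial_ratio m r * D r) (K * l)
     = INR l * sum1 (fun k => binomial_ratio m (k * l)) K).
  { induction K as [|K IH]; [simpl; ring|].
    replace (S K * l)%nat with (K * l + (2 * p + 1))%nat by (unfold l; lia).
    rewrite sum1_add, IH. replace (2 * p + 1)%nat with (S (2 * p)) at 1 by lia.
    cbn [sum1]. rewrite (sum1_ext _ (fun r => 0 * 1) (2 * p)).
    - rewrite sum1_scal. replace (K * l + S (2 * p))%nat with (S K * l)%nat by (unfold l; lia).
      rewrite HD1. cbn [sum1]. ring.
    - intros r Hr. rewrite HD0 by lia. ring. }
  (* The truncation m * l is a multiple of l beyond m. *)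
  assert (Hm : (m <= m * l)%nat) by (unfold l; nia).
  rewrite (sum1_ext _ (fun j => central_weight m * 1 + (2 * central_weight m)
            * sum1 (fun r => binomial_ratio m r * cos (2 * INR r * x j)) (m * l)) p).
  2:{ intros j _. rewrite (cos_even_power m (m * l)) by assumption. unfold x; ring. }
  rewrite sum1_lin, sum1_switch.
  rewrite (sum1_ext (fun r => sum1 (fun j => binomial_ratio m r * cos (2 * INR r * x j)) p)
            (fun r => / 2 * (binomial_ratio m r * D r) + (- / 2) * binomial_ratio m r)).
  2:{ intros r _. rewrite sum1_scal. unfold D. field. }
  rewrite sum1_lin, HDf.
  assert (H0 := cos_even_power m (m * l) 0 Hm).
  rewrite cos_0, pow1 in H0.
  rewrite (sum1_ext _ (fun r => binomial_ratio m r) (m * l)) in H0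
    by (intros; rewrite Rmult_0_r, cos_0; ring).
  rewrite <- (Rmult_1_r (INR l)) in *.
  rewrite sum1_one.
  assert (Hl : INR l = 2 * INR p + 1) by (unfold l; rewrite plus_INR, mult_INR; simpl; ring).
  rewrite Hl.
  set (A := sum1 (fun r => binomial_ratio m r) (m * l)) in *.
  set (B := sum1 (fun k => binomial_ratio m (k * l)) m) in *.
  nra.
Qed.

(** * Pointwise bounds for the two sides *)

Lemma exp_le_compat x y : x <= y -> exp x <= exp y.
Proof. intros [H| ->]; [left; apply exp_increasing, H|right; reflexivity]. Qed.

Lemma nonneg_of_nonneg_derive (f f' : R -> R) :
  (forall x, is_derive f x (f' x)) -> f 0 = 0 ->
  (forall x, 0 <= x -> 0 <= f' x) -> forall x, 0 <= x -> 0 <= f x.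
Proof.
  intros Hd H0 Hp x Hx.
  destruct (MVT_gen f 0 x f') as [c [Hc Heq]].
  - intros; apply Hd.
  - intros; apply derivable_continuous_pt. eexists. apply is_derive_Reals, Hd.
  - rewrite Rmin_left, Rmax_right in Hc by lra.
    assert (0 <= f' c) by (apply Hp; lra). rewrite H0 in Heq. nra.
Qed.

Lemma exp_ge_quadratic x : 0 <= x -> 1 + x + x ^ 2 / 2 <= exp x.
Proof.
  intros Hx. cut (0 <= exp x - (1 + x + x ^ 2 / 2)); [lra|].
  revert x Hx. apply nonneg_of_nonneg_derive with (f' := fun x => exp x - (1 + x)).
  - intros x. auto_derive; [trivial|field].
  - rewrite exp_0; field.
  - intros x _. assert (H := exp_ineq1_le x). lra.
Qed.

Lemma exp_le_quadratic_opp x : 0 <= x -> exp (- x) <= 1 - x + x ^ 2 / 2.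
Proof.
  intros Hx. cut (0 <= 1 - x + x ^ 2 / 2 - exp (- x)); [lra|].
  revert x Hx. apply nonneg_of_nonneg_derive with (f' := fun x => exp (- x) - (1 - x)).
  - intros x. auto_derive; [trivial|field].
  - rewrite Ropp_0, exp_0; field.
  - intros x _. assert (H := exp_ineq1_le (- x)). lra.
Qed.

Lemma exp_ge_cubic x : 1 + x + x ^ 2 / 2 + x ^ 3 / 6 <= exp x.
Proof.
  destruct (Rle_dec 0 x) as [Hx|Hx].
  - cut (0 <= exp x - (1 + x + x ^ 2 / 2 + x ^ 3 / 6)); [lra|].
    revert x Hx. apply nonneg_of_nonneg_derive with (f' := fun x => exp x - (1 + x + x ^ 2 / 2)).
    + intros x. auto_derive; [trivial|field].
    + rewrite exp_0; field.
    + intros x H. assert (H' := exp_ge_quadratic x H). lra.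
  - cut (forall y, 0 <= y -> 0 <= exp (- y) - (1 - y + y ^ 2 / 2 - y ^ 3 / 6)).
    { intros H. specialize (H (- x)). rewrite Ropp_involutive in H.
      assert (0 <= - x) by lra. specialize (H H0). nra. }
    apply nonneg_of_nonneg_derive with (f' := fun y => 1 - y + y ^ 2 / 2 - exp (- y)).
    + intros y. auto_derive; [trivial|field].
    + rewrite Ropp_0, exp_0; field.
    + intros y H. assert (H' := exp_le_quadratic_opp y H). lra.
Qed.

(** Equivalent to (1 - u) exp(u + u^2) >= 1, which follows from the quadratic
    lower bound of the exponential. *)
Lemma one_minus_ge_exp u : 0 <= u <= / 2 -> exp (- u - u ^ 2) <= 1 - u.
Proof.
  intros Hu. replace (- u - u ^ 2) with (- (u + u ^ 2)) by ring.
  rewrite exp_Ropp. assert (H := exp_ge_quadratic (u + u ^ 2) ltac:(nra)).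
  assert (0 < 1 - u) by lra. assert (He := exp_pos (u + u ^ 2)).
  apply Rmult_le_reg_r with (exp (u + u ^ 2)); [assumption|].
  rewrite Rinv_l by lra.
  apply Rle_trans with ((1 - u) * (1 + (u + u ^ 2) + (u + u ^ 2) ^ 2 / 2)).
  - assert (0 <= u ^ 2 * (1 - u - u ^ 2 - u ^ 3)).
    { apply Rmult_le_pos; [nra|]. assert (u ^ 2 <= / 4) by nra.
      assert (u ^ 3 <= / 8) by nra. lra. }
    lra.
  - apply Rmult_le_compat_l; lra.
Qed.

(** Compare the Taylor polynomial 1 - x^2/2 + x^4/24 of the cosine with the
    cubic lower bound of exp(-x^2/2); the difference is x^4 (4 - x^2)/48. *)
Lemma cos_le_gauss x : 0 <= x <= 2 -> x <= PI / 2 -> cos x <= exp (- (x ^ 2 / 2)).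
Proof.
  intros Hx Hp. assert (H := pre_cos_bound x 0 ltac:(lra) ltac:(lra)).
  destruct H as [_ H]. unfold cos_approx, cos_term in H. simpl in H.
  assert (H' := exp_ge_cubic (- (x ^ 2 / 2))).
  assert (0 <= x ^ 4 * (4 - x ^ 2)) by (apply Rmult_le_pos; nra).
  eapply Rle_trans; [exact H|]. eapply Rle_trans; [|exact H']. nra.
Qed.

Lemma cos_ge_quadratic x : 0 <= x <= 2 -> 1 - x ^ 2 / 2 <= cos x.
Proof.
  intros Hx. assert (H := pre_cos_bound x 0 ltac:(lra) ltac:(lra)).
  destruct H as [H _]. unfold cos_approx, cos_term in H. simpl in H. lra.
Qed.

Lemma exp_pow_INR x n : exp x ^ n = exp (INR n * x).
Proof.
  induction n as [|n IH].
  - simpl. rewrite Rmult_0_l, exp_0. reflexivity.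
  - rewrite S_INR. simpl. rewrite IH, <- exp_plus. f_equal; ring.
Qed.

Lemma cos_even_power_upper x m : 0 <= x <= PI / 2 ->
  cos x ^ (2 * m) <= exp (- (INR m * x ^ 2)).
Proof.
  intros Hx. assert (HP := PI_4).
  replace (exp (- (INR m * x ^ 2))) with (exp (- (x ^ 2 / 2)) ^ (2 * m)).
  - apply pow_incr. split; [apply cos_ge_0; lra|]. apply cos_le_gauss; lra.
  - rewrite exp_pow_INR, mult_INR. f_equal. simpl. field.
Qed.

Lemma cos_even_power_lower x m : 0 <= x <= 1 ->
  exp (- (INR m * x ^ 2) - INR m * x ^ 4 / 2) <= cos x ^ (2 * m).
Proof.
  intros Hx.
  replace (exp (- (INR m * x ^ 2) - INR m * x ^ 4 / 2))
    with (exp (- (x ^ 2 / 2) - (x ^ 2 / 2) ^ 2) ^ (2 * m)).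
  - apply pow_incr. split; [left; apply exp_pos|].
    eapply Rle_trans; [apply one_minus_ge_exp; nra|]. apply cos_ge_quadratic; lra.
  - rewrite exp_pow_INR, mult_INR. f_equal. simpl. field.
Qed.

Lemma binomial_ratio_nonneg m r : 0 <= binomial_ratio m r.
Proof.
  destruct (Nat.lt_ge_cases m r) as [H|H]; [rewrite binomial_ratio_out by assumption; lra|].
  induction r as [|r IH]; simpl; [lra|].
  apply Rmult_le_pos; [apply IH; lia|].
  assert (INR r <= INR m) by (apply le_INR; lia).
  assert (0 <= INR r) by apply pos_INR.
  apply Rdiv_le_0_compat; lra.
Qed.

(** Each factor is 1 - (2i+1)/(m+i+1), and the sum of 2i+1 for i < r is r^2.
    The parameter s bounds the denominators: s of order sqrt m gives the sharp
    Gaussian, s = m a bound uniform in r. *)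
Lemma binomial_ratio_upper m r s : (r <= s <= m)%nat -> (1 <= m)%nat ->
  binomial_ratio m r <= exp (- (INR r ^ 2 / (INR m + INR s))).
Proof.
  intros Hr Hm. assert (Hs := pos_INR s).
  assert (1 <= INR m) by (apply (le_INR 1); lia).
  induction r as [|r IH].
  - simpl. replace (- _) with 0 by (field; lra). rewrite exp_0; lra.
  - simpl binomial_ratio.
    assert (Hr' : INR r + 1 <= INR s) by (rewrite <- S_INR; apply le_INR; lia).
    assert (H2 : INR s <= INR m) by (apply le_INR; lia).
    assert (H3 := pos_INR r).
    replace (exp (- (INR (S r) ^ 2 / (INR m + INR s)))) with
      (exp (- (INR r ^ 2 / (INR m + INR s))) * exp (- ((2 * INR r + 1) / (INR m + INR s)))).
    2:{ rewrite <- exp_plus, S_INR. f_equal. field. lra. }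
    apply Rmult_le_compat.
    + apply binomial_ratio_nonneg.
    + apply Rdiv_le_0_compat; lra.
    + apply IH; lia.
    + eapply Rle_trans; [|apply exp_ineq1_le].
      apply Rle_trans with (1 - (2 * INR r + 1) / (INR m + INR r + 1)).
      * right; field; lra.
      * apply Rplus_le_compat_l, Ropp_le_contravar.
        unfold Rdiv. apply Rmult_le_compat_l; [lra|]. apply Rinv_le_contravar; lra.
Qed.

(** The matching lower bound: 1 - u >= exp(-u - u^2) costs a cubic error
    r s^2/m^2, which tends to 0 for r and s of order sqrt m. *)
Lemma binomial_ratio_lower m s r : (r <= s)%nat -> (4 * s <= m)%nat -> (1 <= m)%nat ->
  exp (- (INR r ^ 2 / INR m) - INR r * (2 * INR s / INR m) ^ 2) <= binomial_ratio m r.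
Proof.
  intros Hr Hs Hm. assert (1 <= INR m) by (apply (le_INR 1); lia).
  assert (Hs4 : 4 * INR s <= INR m)
    by (replace 4 with (INR 4) by (simpl; ring); rewrite <- mult_INR; apply le_INR; lia).
  induction r as [|r IH].
  - simpl. replace (- _ - _) with 0 by (field; lra). rewrite exp_0; lra.
  - simpl binomial_ratio.
    assert (Hr' : INR r + 1 <= INR s) by (rewrite <- S_INR; apply le_INR; lia).
    assert (H3 := pos_INR r).
    set (u := (2 * INR r + 1) / (INR m + INR r + 1)).
    assert (Hu0 : 0 <= u) by (apply Rdiv_le_0_compat; lra).
    assert (Hu1 : u <= (2 * INR r + 1) / INR m).
    { unfold u, Rdiv. apply Rmult_le_compat_l; [lra|]. apply Rinv_le_contravar; lra. }
    assert (Hu2 : u <= 2 * INR s / INR m).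
    { eapply Rle_trans; [exact Hu1|]. unfold Rdiv. apply Rmult_le_compat_r; [|lra].
      left; apply Rinv_0_lt_compat; lra. }
    assert (Hu3 : 2 * INR s / INR m <= / 2).
    { apply Rmult_le_reg_r with (INR m); [lra|]. unfold Rdiv.
      rewrite Rmult_assoc, Rinv_l by lra. lra. }
    replace ((INR m - INR r) / (INR m + INR r + 1)) with (1 - u) by (unfold u; field; lra).
    replace (exp (- (INR (S r) ^ 2 / INR m) - INR (S r) * (2 * INR s / INR m) ^ 2)) with
      (exp (- (INR r ^ 2 / INR m) - INR r * (2 * INR s / INR m) ^ 2)
       * exp (- ((2 * INR r + 1) / INR m) - (2 * INR s / INR m) ^ 2)).
    2:{ rewrite <- exp_plus, S_INR. f_equal. field. lra. }
    apply Rmult_le_compat; try (left; apply exp_pos).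
    + apply IH; lia.
    + eapply Rle_trans; [|apply one_minus_ge_exp; lra].
      apply exp_le_compat. assert (u ^ 2 <= (2 * INR s / INR m) ^ 2) by (apply pow_incr; lra). lra.
Qed.

Lemma sum1_abs_diff (f M : nat -> R) J N : (J <= N)%nat ->
  (forall j, (1 <= j <= N)%nat -> Rabs (f j) <= M j) ->
  Rabs (sum1 f N - sum1 f J) <= sum1 M N - sum1 M J.
Proof.
  intros HJ. induction HJ as [|N HJ IH]; intros H.
  - unfold Rminus; rewrite !Rplus_opp_r, Rabs_R0. lra.
  - simpl. specialize (IH (fun j Hj => H j ltac:(lia))). specialize (H (S N) ltac:(lia)).
    replace (sum1 f N + f (S N) - sum1 f J) with ((sum1 f N - sum1 f J) + f (S N)) by ring.
    eapply Rle_trans; [apply Rabs_triang|]. lra.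
Qed.

Lemma sum1_nonneg (a : nat -> R) N : (forall r, 0 <= a r) -> 0 <= sum1 a N.
Proof. intros H. induction N as [|N IH]; simpl; [lra|]. specialize (H (S N)). lra. Qed.

Lemma is_lim_seq_sum1 (a : nat -> R) l :
  is_series (fun n => a (S n)) l -> is_lim_seq (sum1 a) l.
Proof.
  intros H. apply is_lim_seq_incr_1.
  apply is_lim_seq_ext with (2 := H). intros n. apply sum1_sum_n.
Qed.

(** Tannery's theorem, that is, dominated convergence for sums whose length
    grows with the parameter. *)
Lemma tannery (f : nat -> nat -> R) (g M : nat -> R) (N : nat -> nat) :
  (forall j, is_lim_seq (fun m => f m j) (g j)) ->
  eventually (fun m => forall j, (1 <= j <= N m)%nat -> Rabs (f m j) <= M j) ->
  ex_series (fun n => M (S n)) ->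
  (forall K, eventually (fun m => (K <= N m)%nat)) ->
  ex_series (fun n => g (S n)) ->
  is_lim_seq (fun m => sum1 (f m) (N m)) (Series (fun n => g (S n))).
Proof.
  intros Hlim [m0 Hdom] [SM HM] HN Hg.
  apply is_lim_seq_sum1 in HM.
  assert (Hgl := Series_correct _ Hg). apply is_lim_seq_sum1 in Hgl.
  set (G := Series (fun n => g (S n))) in *.
  apply is_lim_seq_spec. intros eps.
  apply is_lim_seq_spec in HM. apply is_lim_seq_spec in Hgl.
  assert (He : 0 < eps / 8) by (assert (H := cond_pos eps); lra).
  destruct (HM (mkposreal _ He)) as [J1 HJ1].
  destruct (Hgl (mkposreal _ He)) as [J2 HJ2]. simpl in *.
  set (J := (J1 + J2)%nat).
  assert (HfJ : is_lim_seq (fun m => sum1 (f m) J) (sum1 g J)).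
  { clear -Hlim. induction J as [|J IH]; simpl; [apply is_lim_seq_const|].
    apply is_lim_seq_plus'; [exact IH|apply Hlim]. }
  apply is_lim_seq_spec in HfJ. destruct (HfJ (mkposreal _ He)) as [m1 Hm1].
  destruct (HN J) as [m2 Hm2]. simpl in *.
  exists (m0 + m1 + m2)%nat. intros m Hm.
  specialize (Hm1 m ltac:(lia)). specialize (Hm2 m ltac:(lia)).
  assert (Ht := sum1_abs_diff (f m) M J (N m) Hm2 (Hdom m ltac:(lia))).
  assert (A1 := HJ1 J ltac:(unfold J; lia)).
  assert (A2 := HJ1 (N m) ltac:(unfold J in Hm2; lia)).
  assert (A3 := HJ2 J ltac:(unfold J; lia)).
  apply Rabs_def2 in A1, A2, A3, Hm1. apply Rabs_le_between in Ht.
  assert (H := cond_pos eps).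
  apply Rabs_def1; lra.
Qed.

(** * The functional equation of theta *)

(** The Jacobi theta value at x is 1 + 2 psi x. *)
Definition psi (x : R) : R := Series (fun n => exp (- (PI * INR (S n) ^ 2 * x))).

Lemma ex_series_exp_opp c : 0 < c -> ex_series (fun n => exp (- (c * INR (S n)))).
Proof.
  intros Hc. apply ex_series_ext with (fun n => scal (exp (- c)) (exp (- c) ^ n)).
  - intros n. rewrite exp_pow_INR. unfold scal; simpl; unfold mult; simpl.
    rewrite <- exp_plus. f_equal. destruct n; simpl; ring.
  - apply (ex_series_scal_l (V := R_NormedModule)). apply ex_series_geom.
    rewrite Rabs_pos_eq by (left; apply exp_pos).
    rewrite <- exp_0. apply exp_increasing. lra.
Qed.

Lemma INR_S_sq n : INR (S n) <= INR (S n) ^ 2.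
Proof. assert (1 <= INR (S n)) by (apply (le_INR 1); lia). nra. Qed.

Lemma ex_series_psi x : 0 < x -> ex_series (fun n => exp (- (PI * INR (S n) ^ 2 * x))).
Proof.
  intros Hx. assert (HP := PI_RGT_0).
  apply (ex_series_le (V := R_CompleteNormedModule)) with (b := (fun n => exp (- (PI * x * INR (S n))))).
  - intros n. unfold norm; simpl; unfold abs; simpl.
    rewrite Rabs_pos_eq by (left; apply exp_pos). apply exp_le_compat.
    change (match n with O => 1 | S _ => INR n + 1 end) with (INR (S n)).
    assert (H := INR_S_sq n). assert (0 < PI * x) by (apply Rmult_lt_0_compat; lra).
    apply Ropp_le_contravar. nra.
  - apply ex_series_exp_opp. apply Rmult_lt_0_compat; lra.
Qed.

Lemma psi_nonneg x : 0 < x -> 0 <= psi x.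
Proof.
  intros Hx. unfold psi. rewrite <- (Rmult_0_l (Series (fun n => exp (- (PI * INR (S n) ^ 2 * x))))).
  rewrite <- Series_scal_l. apply Series_le.
  - intros n. assert (H := exp_pos (- (PI * INR (S n) ^ 2 * x))). lra.
  - apply ex_series_psi, Hx.
Qed.

Lemma is_lim_seq_exp (u : nat -> R) (l : R) :
  is_lim_seq u l -> is_lim_seq (fun n => exp (u n)) (exp l).
Proof.
  intros H. apply is_lim_seq_continuous; [|exact H].
  apply derivable_continuous_pt, derivable_pt_exp.
Qed.

Lemma eventually_INR_ge A : eventually (fun n => A <= INR n).
Proof.
  destruct (nfloor_ex (Rmax 0 A) (Rmax_l _ _)) as [n0 [_ Hn0]].
  exists (S n0). intros n Hn. apply le_INR in Hn. rewrite S_INR in Hn.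
  assert (H := Rmax_r 0 A). lra.
Qed.

Lemma is_lim_seq_inv_sqrt : is_lim_seq (fun m => / sqrt (INR m)) 0.
Proof.
  apply is_lim_seq_spec. intros eps. assert (He := cond_pos eps).
  destruct (eventually_INR_ge (1 + / eps ^ 2)) as [n0 Hn0].
  exists n0. intros n Hn. specialize (Hn0 n Hn).
  assert (Hi : 0 < / eps ^ 2) by (apply Rinv_0_lt_compat; nra).
  assert (Hs : / eps < sqrt (INR n)).
  { rewrite <- (sqrt_pow2 (/ eps)) by (left; apply Rinv_0_lt_compat; lra).
    apply sqrt_lt_1; rewrite ?pow_inv; lra. }
  assert (Hi' : 0 < / eps) by (apply Rinv_0_lt_compat; lra).
  rewrite Rminus_0_r, Rabs_pos_eq by (left; apply Rinv_0_lt_compat; lra).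
  rewrite <- (Rinv_inv eps). apply Rinv_lt_contravar; [nra|assumption].
Qed.

(** Take 2p+1 with p the integer part of kappa sqrt m/2. *)
Lemma odd_lengths (kappa : R) : 0 < kappa ->
  exists p : nat -> nat,
    is_lim_seq (fun m => INR (2 * p m + 1) / sqrt (INR m)) kappa /\
    (forall K, eventually (fun m => (K <= p m)%nat)).
Proof.
  intros Hk.
  assert (Hx : forall m, 0 <= sqrt (INR m) * kappa / 2).
  { intros m. assert (H := sqrt_pos (INR m)). nra. }
  exists (fun m => proj1_sig (nfloor_ex _ (Hx m))). split.
  - assert (Hi := is_lim_seq_inv_sqrt).
    apply is_lim_seq_le_le_loc with (fun m => kappa - / sqrt (INR m))
      (fun m => kappa + / sqrt (INR m)).
    + exists 1%nat. intros m Hm. destruct (nfloor_ex _ (Hx m)) as [q Hq]; simpl proj1_sig.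
      assert (Hs : 0 < sqrt (INR m)) by (apply sqrt_lt_R0, (lt_INR 0); lia).
      rewrite plus_INR, mult_INR. simpl INR.
      set (x := sqrt (INR m)) in *.
      split.
      * apply Rle_div_r; [assumption|].
        replace ((kappa - / x) * x) with (kappa * x - 1) by (field; lra). lra.
      * apply Rle_div_l; [assumption|].
        replace ((kappa + / x) * x) with (kappa * x + 1) by (field; lra). lra.
    + apply is_lim_seq_ext with (fun m => kappa + (-1) * / sqrt (INR m)); [intros; ring|].
      replace (Finite kappa) with (Finite (kappa + (-1) * 0)) by (f_equal; ring).
      apply is_lim_seq_plus'; [apply is_lim_seq_const|].
      apply is_lim_seq_mult'; [apply is_lim_seq_const|exact Hi].
    + replace (Finite kappa) with (Finite (kappa + 0)) by (f_equal; ring).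
      apply is_lim_seq_plus'; [apply is_lim_seq_const|exact Hi].
  - intros K. destruct (eventually_INR_ge ((2 * (INR K + 1) / kappa) ^ 2)) as [n0 Hn0].
    exists n0. intros m Hm. specialize (Hn0 m Hm).
    destruct (nfloor_ex _ (Hx m)) as [q Hq]; simpl proj1_sig.
    assert (HK := pos_INR K).
    assert (Hp : 0 <= 2 * (INR K + 1) / kappa) by (apply Rdiv_le_0_compat; lra).
    apply sqrt_le_1_alt in Hn0. rewrite sqrt_pow2 in Hn0 by assumption.
    apply INR_le. apply Rmult_le_compat_r with (r := kappa) in Hn0; [|lra].
    unfold Rdiv in Hn0. rewrite Rmult_assoc, Rinv_l in Hn0 by lra. lra.
Qed.

Lemma eventually_and (P Q : nat -> Prop) :
  eventually P -> eventually Q -> eventually (fun n => P n /\ Q n).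
Proof.
  intros [n1 H1] [n2 H2]. exists (n1 + n2)%nat. intros n Hn.
  split; [apply H1|apply H2]; lia.
Qed.

Lemma eventually_imp (P Q : nat -> Prop) :
  (forall n, P n -> Q n) -> eventually P -> eventually Q.
Proof. intros H [n0 H0]. exists n0. auto. Qed.

Lemma is_lim_seq_eventually (u : nat -> R) (l a b : R) :
  is_lim_seq u l -> a < l < b -> eventually (fun n => a < u n < b).
Proof.
  intros H Hab. apply is_lim_seq_spec in H.
  assert (He : 0 < Rmin (l - a) (b - l)) by (apply Rmin_pos; lra).
  destruct (H (mkposreal _ He)) as [n0 Hn]. exists n0. intros n Hn'.
  specialize (Hn n Hn'). simpl in Hn. apply Rabs_def2 in Hn.
  assert (H1 := Rmin_l (l - a) (b - l)). assert (H2 := Rmin_r (l - a) (b - l)). lra.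
Qed.

Ltac lim_seq :=
  repeat first
    [ eassumption
    | apply is_lim_seq_const
    | apply is_lim_seq_exp
    | apply is_lim_seq_minus'
    | apply is_lim_seq_plus'
    | apply is_lim_seq_mult' ].

(** With r = sqrt m/l and s = 1/sqrt m, the angle is x = pi j r s, and m s^2 = 1;
    so m x^2 tends to (pi j/kappa)^2 while m x^4 tends to 0. *)
Lemma finite_poisson_cos_limit (kappa : R) (p : nat -> nat) : 0 < kappa ->
  is_lim_seq (fun m => INR (2 * p m + 1) / sqrt (INR m)) kappa ->
  (forall K, eventually (fun m => (K <= p m)%nat)) ->
  is_lim_seq (fun m => sum1 (fun j => cos (PI * INR j / INR (2 * p m + 1)) ^ (2 * m)) (p m))
    (psi (PI / kappa ^ 2)).
Proof.
  intros Hk Hlim Hp. assert (HPI := PI_RGT_0).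
  set (r := fun m => / (INR (2 * p m + 1) / sqrt (INR m))).
  set (s := fun m => / sqrt (INR m)).
  assert (Hr : is_lim_seq r (/ kappa)).
  { change (Finite (/ kappa)) with (Rbar_inv kappa). apply is_lim_seq_inv; [exact Hlim|].
    intros H; inversion H; lra. }
  assert (Hs : is_lim_seq s 0) by apply is_lim_seq_inv_sqrt.
  assert (Hx : forall m j, (1 <= m)%nat ->
     PI * INR j / INR (2 * p m + 1) = PI * INR j * (r m * s m) /\ INR m * s m ^ 2 = 1).
  { intros m j Hm. assert (Hsm : 0 < sqrt (INR m)) by (apply sqrt_lt_R0, (lt_INR 0); lia).
    assert (Hl : 0 < INR (2 * p m + 1)) by (apply (lt_INR 0); lia).
    split; unfold r, s.
    - field; lra.
    - rewrite pow_inv, pow2_sqrt by apply pos_INR. field.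
      assert (0 < INR m) by (apply (lt_INR 0); lia). lra. }
  assert (Hx2 : forall m j, (1 <= m)%nat ->
     INR m * (PI * INR j / INR (2 * p m + 1)) ^ 2 = (PI * INR j) ^ 2 * (r m * r m)).
  { intros m j Hm. destruct (Hx m j Hm) as [-> H].
    transitivity ((PI * INR j) ^ 2 * (r m * r m) * (INR m * s m ^ 2)); [ring|rewrite H; ring]. }
  assert (Hx4 : forall m j, (1 <= m)%nat ->
     INR m * (PI * INR j / INR (2 * p m + 1)) ^ 4
     = (PI * INR j) ^ 4 * ((r m * r m) * (r m * r m) * (s m * s m))).
  { intros m j Hm. destruct (Hx m j Hm) as [-> H].
    transitivity ((PI * INR j) ^ 4 * ((r m * r m) * (r m * r m) * (s m * s m))
                    * (INR m * s m ^ 2)); [ring|rewrite H; ring]. }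
  assert (Hrange : forall m j, (j <= p m)%nat -> 0 <= PI * INR j / INR (2 * p m + 1) <= PI / 2).
  { intros m j Hj. assert (H0 := pos_INR j). apply le_INR in Hj.
    assert (Hl : 0 < INR (2 * p m + 1)) by (apply (lt_INR 0); lia).
    split; [apply Rdiv_le_0_compat; nra|].
    apply Rmult_le_reg_r with (INR (2 * p m + 1)); [assumption|].
    unfold Rdiv at 1. rewrite Rmult_assoc, Rinv_l, plus_INR, mult_INR by lra. simpl INR. nra. }
  (* Eventually l/sqrt m <= 2 kappa, which gives a geometric domination in j. *)
  set (c := PI ^ 2 / (4 * kappa ^ 2)).
  assert (Hc : 0 < c) by (apply Rdiv_lt_0_compat; nra).
  unfold psi.
  apply (tannery _ (fun j => exp (- (PI * INR j ^ 2 * (PI / kappa ^ 2))))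
           (fun j => exp (- (c * INR j)))).
  - intros j. set (A := (PI * INR j) ^ 2). set (B := (PI * INR j) ^ 4).
    assert (HA : - (PI * INR j ^ 2 * (PI / kappa ^ 2)) = - 1 * (A * (/ kappa * / kappa)))
      by (unfold A; field; lra).
    rewrite HA.
    apply is_lim_seq_le_le_loc with
      (fun m => exp (- 1 * (A * (r m * r m))
                 - / 2 * (B * ((r m * r m) * (r m * r m) * (s m * s m)))))
      (fun m => exp (- 1 * (A * (r m * r m)))).
    + assert (Hsmall : is_lim_seq (fun m => PI * INR j * (r m * s m)) (PI * INR j * (/ kappa * 0)))
        by lim_seq.
      apply is_lim_seq_eventually with (a := -1) (b := 1) in Hsmall; [|lra].
      destruct (eventually_and _ _ Hsmall (Hp j)) as [n1 H1].
      exists (S n1). intros m Hm. destruct (H1 m ltac:(lia)) as [H2 H3].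
      assert (Hm1 : (1 <= m)%nat) by lia.
      specialize (Hrange m j H3). destruct (Hx m j Hm1) as [H4 _].
      split.
      * eapply Rle_trans; [|apply cos_even_power_lower; lra].
        right. f_equal. rewrite Hx2, Hx4 by assumption. unfold A, B. field.
      * eapply Rle_trans; [apply cos_even_power_upper; lra|].
        right. f_equal. rewrite Hx2 by assumption. unfold A. ring.
    + replace (-1 * (A * (/ kappa * / kappa))) with
       (-1 * (A * (/ kappa * / kappa)) - / 2 * (B * ((/ kappa * / kappa) * (/ kappa * / kappa) * (0 * 0))))
       by ring. lim_seq.
    + lim_seq.
  - apply is_lim_seq_eventually with (a := / (2 * kappa)) (b := / kappa + 1) in Hr.
    2:{ split; [|lra]. apply Rinv_lt_contravar; nra. }
    destruct Hr as [n0 Hn0]. exists (S n0). intros m Hm j Hj.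
    specialize (Hn0 m ltac:(lia)).
    assert (Hrg := Hrange m j ltac:(lia)).
    rewrite Rabs_pos_eq by (apply pow_le, cos_ge_0; lra).
    eapply Rle_trans; [apply cos_even_power_upper; lra|].
    apply exp_le_compat, Ropp_le_contravar. rewrite Hx2 by lia.
    destruct j as [|j]; [lia|]. assert (Hj2 := INR_S_sq j).
    assert (Hk2 : 0 < / (2 * kappa)) by (apply Rinv_0_lt_compat; lra).
    unfold c. replace (PI ^ 2 / (4 * kappa ^ 2) * INR (S j))
      with ((PI ^ 2 * INR (S j)) * (/ (2 * kappa) * / (2 * kappa))) by (field; lra).
    assert (Hjp := pos_INR (S j)).
    apply Rmult_le_compat; try nra.
  - apply ex_series_exp_opp, Hc.
  - exact Hp.
  - apply ex_series_psi. apply Rdiv_lt_0_compat; nra.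
Qed.

(** The ratio at distance k l tends to exp(-k^2 kappa^2), because
    (k l)^2/m tends to (k kappa)^2. *)
Lemma finite_poisson_binomial_limit (kappa : R) (p : nat -> nat) : 0 < kappa ->
  is_lim_seq (fun m => INR (2 * p m + 1) / sqrt (INR m)) kappa ->
  is_lim_seq (fun m => sum1 (fun k => binomial_ratio m (k * (2 * p m + 1))) m)
    (psi (kappa ^ 2 / PI)).
Proof.
  intros Hk Hlim. assert (HPI := PI_RGT_0).
  set (t := fun m => INR (2 * p m + 1) / sqrt (INR m)) in *.
  set (s := fun m => / sqrt (INR m)).
  assert (Hs : is_lim_seq s 0) by apply is_lim_seq_inv_sqrt.
  assert (HL : forall m, (1 <= m)%nat ->
     INR (2 * p m + 1) = t m * / s m /\ INR m = / (s m * s m) /\ 0 < s m).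
  { intros m Hm. assert (Hsm : 0 < sqrt (INR m)) by (apply sqrt_lt_R0, (lt_INR 0); lia).
    split; [|split]; unfold t, s.
    - field; lra.
    - rewrite <- Rinv_mult, sqrt_sqrt, Rinv_inv by apply pos_INR. reflexivity.
    - apply Rinv_0_lt_compat, Hsm. }
  (* Eventually l/sqrt m >= kappa/2, which gives a geometric domination in k. *)
  set (c := kappa ^ 2 / 8).
  assert (Hc : 0 < c) by (unfold c; nra).
  unfold psi.
  apply (tannery _ (fun k => exp (- (PI * INR k ^ 2 * (kappa ^ 2 / PI))))
           (fun k => exp (- (c * INR k)))).
  - intros k.
    assert (HA : - (PI * INR k ^ 2 * (kappa ^ 2 / PI)) = - 1 * (INR k ^ 2 * (kappa * kappa)))
      by (field; lra).
    rewrite HA.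
    set (K := INR k).
    apply is_lim_seq_le_le_loc with
      (fun m => exp (- 1 * (K ^ 2 * (t m * t m))
                 - 4 * K ^ 3 * (t m * t m * t m * s m)))
      (fun m => exp (- 1 * (K ^ 2 * (t m * t m) * / (1 + K * (t m * s m))))).
    + assert (Hsmall : is_lim_seq (fun m => K * (t m * s m)) (K * (kappa * 0)))
        by lim_seq.
      apply is_lim_seq_eventually with (a := -1) (b := / 4) in Hsmall; [|lra].
      destruct Hsmall as [n1 H1].
      exists (S n1). intros m Hm. specialize (H1 m ltac:(lia)).
      assert (Hm1 : (1 <= m)%nat) by lia. destruct (HL m Hm1) as [H2 [H3 H4]].
      assert (H5 : INR (k * (2 * p m + 1)) = K * (t m * / s m))
        by (rewrite mult_INR, H2; reflexivity).
      assert (Hle : (4 * (k * (2 * p m + 1)) <= m)%nat).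
      { apply INR_le. rewrite mult_INR, H5. simpl (INR 4).
        rewrite H3. apply Rmult_le_reg_r with (s m * s m); [nra|].
        rewrite Rinv_l by nra.
        replace ((1 + 1 + 1 + 1) * (K * (t m * / s m)) * (s m * s m))
          with (4 * (K * (t m * s m))) by (field; lra). lra. }
      split.
      * eapply Rle_trans; [|apply (binomial_ratio_lower m (k * (2 * p m + 1))); lia].
        right. f_equal. rewrite H5, H3. field. lra.
      * eapply Rle_trans; [apply (binomial_ratio_upper m _ (k * (2 * p m + 1))); lia|].
        right. f_equal. rewrite H5, H3. field.
        assert (Ht : 0 <= K * (t m * s m)).
        { replace (K * (t m * s m)) with (K * (t m * / s m) * (s m * s m)) by (field; lra).
          rewrite <- H5. apply Rmult_le_pos; [apply pos_INR|nra]. }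
        repeat split; nra.
    + replace (-1 * (K ^ 2 * (kappa * kappa))) with
       (-1 * (K ^ 2 * (kappa * kappa)) - 4 * K ^ 3 * (kappa * kappa * kappa * 0))
       by ring. lim_seq.
    + replace (-1 * (K ^ 2 * (kappa * kappa))) with
       (-1 * (K ^ 2 * (kappa * kappa) * / (1 + K * (kappa * 0)))) by field.
      lim_seq.
      change (Finite (/ (1 + K * (kappa * 0)))) with (Rbar_inv (1 + K * (kappa * 0))).
      apply is_lim_seq_inv; [lim_seq|]. intros H; inversion H; lra.
  - apply is_lim_seq_eventually with (a := kappa / 2) (b := kappa + 1) in Hlim; [|lra].
    destruct Hlim as [n0 Hn0]. exists (S n0). intros m Hm k Hk1.
    specialize (Hn0 m ltac:(lia)).
    rewrite Rabs_pos_eq by apply binomial_ratio_nonneg.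
    destruct (Nat.lt_ge_cases m (k * (2 * p m + 1))) as [Hgt|Hle].
    { rewrite binomial_ratio_out by assumption. left; apply exp_pos. }
    eapply Rle_trans; [apply (binomial_ratio_upper m _ m); lia|].
    apply exp_le_compat, Ropp_le_contravar.
    destruct (HL m ltac:(lia)) as [H2 [H3 H4]].
    rewrite mult_INR, H2, H3.
    replace ((INR k * (t m * / s m)) ^ 2 / (/ (s m * s m) + / (s m * s m)))
      with (INR k ^ 2 * (t m * t m) / 2) by (field; lra).
    destruct k as [|k]; [lia|]. assert (Hk2 := INR_S_sq k).
    assert (Hkp := pos_INR (S k)). unfold c.
    assert (kappa / 2 * (kappa / 2) <= t m * t m) by nra.
    assert (INR (S k) * (kappa / 2 * (kappa / 2)) <= INR (S k) ^ 2 * (t m * t m))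
      by (apply Rmult_le_compat; nra).
    lra.
  - apply ex_series_exp_opp, Hc.
  - intros K. exists K. auto.
  - apply ex_series_psi. apply Rdiv_lt_0_compat; nra.
Qed.

(** The sequence does not involve alpha; this is what yields the
    functional equation, and at alpha = 1 the Wallis constant 1/sqrt pi. *)
Lemma central_weight_limit alpha : 0 < alpha ->
  is_lim_seq (fun m => central_weight m * sqrt (INR m))
    ((1 + 2 * psi alpha) / (1 + 2 * psi (/ alpha)) / sqrt (PI / alpha)).
Proof.
  intros Ha. assert (HPI := PI_RGT_0).
  assert (Hpa : 0 < PI / alpha) by (apply Rdiv_lt_0_compat; lra).
  set (kappa := sqrt (PI / alpha)).
  assert (Hk : 0 < kappa) by (apply sqrt_lt_R0, Hpa).
  assert (Hk2 : kappa ^ 2 = PI / alpha) by (apply pow2_sqrt; lra).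
  destruct (odd_lengths kappa Hk) as [p [Hp1 Hp2]].
  assert (HLl := finite_poisson_cos_limit kappa p Hk Hp1 Hp2).
  assert (HRr := finite_poisson_binomial_limit kappa p Hk Hp1).
  replace (PI / kappa ^ 2) with alpha in HLl by (rewrite Hk2; field; lra).
  replace (kappa ^ 2 / PI) with (/ alpha) in HRr by (rewrite Hk2; field; lra).
  set (Lf := fun m => sum1 _ (p m)) in HLl. set (Rf := fun m => sum1 _ m) in HRr.
  set (t := fun m => INR (2 * p m + 1) / sqrt (INR m)) in *.
  assert (Hpos : 0 <= psi (/ alpha)) by (apply psi_nonneg, Rinv_0_lt_compat, Ha).
  apply is_lim_seq_ext_loc with
    (fun m => (1 + 2 * Lf m) * / (1 + 2 * Rf m) * / t m).
  - exists 1%nat. intros m Hm. unfold Lf. rewrite finite_poisson_identity. fold (Rf m).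
    assert (Hsm : 0 < sqrt (INR m)) by (apply sqrt_lt_R0, (lt_INR 0); lia).
    assert (Hl : 0 < INR (2 * p m + 1)) by (apply (lt_INR 0); lia).
    assert (HR0 : 0 <= Rf m).
    { apply sum1_nonneg. intros; apply binomial_ratio_nonneg. }
    unfold t. field. repeat split; lra.
  - unfold Rdiv at 1 2. apply is_lim_seq_mult'; [apply is_lim_seq_mult'|].
    + lim_seq.
    + change (Finite (/ (1 + 2 * psi (/ alpha)))) with (Rbar_inv (1 + 2 * psi (/ alpha))).
      apply is_lim_seq_inv; [lim_seq|]. intros H; inversion H; lra.
    + change (Finite (/ kappa)) with (Rbar_inv kappa).
      apply is_lim_seq_inv; [exact Hp1|]. intros H; inversion H; lra.
Qed.

(** Compare the values of one limit computed with alpha = x and alpha = 1. *)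
Theorem theta_functional_equation x : 0 < x ->
  1 + 2 * psi x = sqrt (/ x) * (1 + 2 * psi (/ x)).
Proof.
  intros Hx. assert (HPI := PI_RGT_0).
  assert (H := is_lim_seq_unique _ _ (central_weight_limit x Hx)).
  rewrite (is_lim_seq_unique _ _ (central_weight_limit 1 Rlt_0_1)) in H.
  rewrite Rinv_1 in H. injection H as H.
  assert (H1 : 0 <= psi 1) by (apply psi_nonneg; lra).
  assert (Hix : 0 < / x) by (apply Rinv_0_lt_compat, Hx).
  assert (H2 : 0 <= psi (/ x)) by (apply psi_nonneg, Hix).
  replace (PI / 1) with PI in H by field.
  replace (sqrt (PI / x)) with (sqrt PI * sqrt (/ x)) in H by (rewrite <- sqrt_mult by lra; reflexivity).
  assert (Hs1 : 0 < sqrt PI) by (apply sqrt_lt_R0, HPI).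
  assert (Hs2 : 0 < sqrt (/ x)) by (apply sqrt_lt_R0, Hix).
  apply Rmult_eq_reg_r with (/ (sqrt PI * sqrt (/ x) * (1 + 2 * psi (/ x)))).
  2:{ apply Rinv_neq_0_compat. repeat apply Rmult_integral_contrapositive_currified; lra. }
  transitivity ((1 + 2 * psi x) / (1 + 2 * psi (/ x)) / (sqrt PI * sqrt (/ x))).
  { field. lra. }
  rewrite <- H. field. lra.
Qed.

(** * Series of functions and monotone convergence *)

Lemma series_tail_bound (a M : nat -> R) N :
  (forall n, Rabs (a n) <= M n) -> ex_series M ->
  Rabs (Series a - sum_n a N) <= Series M - sum_n M N.
Proof.
  intros H HM.
  assert (Habs : ex_series (fun n => Rabs (a n))).
  { apply (ex_series_le (V := R_CompleteNormedModule)) with (b := M); [|exact HM].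
    intros n. unfold norm; simpl; unfold abs; simpl. rewrite Rabs_Rabsolu. apply H. }
  assert (Ha : ex_series a) by (apply ex_series_Rabs, Habs).
  rewrite (Series_incr_n a (S N)) by (try lia; exact Ha).
  rewrite (Series_incr_n M (S N)) by (try lia; exact HM).
  cbn [pred]. rewrite !sum_n_Reals.
  replace (sum_f_R0 a N + Series (fun k => a (S N + k)%nat) - sum_f_R0 a N)
    with (Series (fun k => a (S N + k)%nat)) by ring.
  replace (sum_f_R0 M N + Series (fun k => M (S N + k)%nat) - sum_f_R0 M N)
    with (Series (fun k => M (S N + k)%nat)) by ring.
  eapply Rle_trans; [apply Series_Rabs|apply Series_le].
  - apply (ex_series_incr_n (fun n => Rabs (a n)) (S N)), Habs.
  - intros n. split; [apply Rabs_pos|apply H].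
  - apply (ex_series_incr_n M (S N)), HM.
Qed.

Lemma series_remainder_small (M : nat -> R) (eps : posreal) : ex_series M ->
  exists N0, forall N, (N0 <= N)%nat -> Series M - sum_n M N < eps.
Proof.
  intros HM. assert (H := Series_correct _ HM).
  assert (H' : is_lim_seq (sum_n M) (Series M)) by exact H.
  apply is_lim_seq_spec in H'. destruct (H' eps) as [N0 HN0].
  exists N0. intros N HN. specialize (HN0 N HN). apply Rabs_def2 in HN0. lra.
Qed.

Lemma ex_RInt_sum_n (f : nat -> R -> R) a b N :
  (forall n, ex_RInt (f n) a b) ->
  is_RInt (fun x => sum_n (fun n => f n x) N) a b (sum_n (fun n => RInt (f n) a b) N).
Proof.
  intros H. induction N as [|N IH].
  - rewrite sum_O. apply is_RInt_ext with (f 0%nat).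
    + intros x _. rewrite sum_O. reflexivity.
    + apply (RInt_correct (V := R_CompleteNormedModule)), H.
  - rewrite sum_Sn.
    apply is_RInt_ext with (fun x => plus (sum_n (fun n => f n x) N) (f (S N) x)).
    + intros x _. rewrite sum_Sn. reflexivity.
    + apply (is_RInt_plus (V := R_NormedModule)); [exact IH|].
      apply (RInt_correct (V := R_CompleteNormedModule)), H.
Qed.

(** Termwise integration under a Weierstrass bound.  The uniform limit theorem
    for integrals wants uniform convergence on all of R, so the argument is first
    clipped to [a, b]. *)
Lemma RInt_series (f : nat -> R -> R) (M : nat -> R) a b : a <= b ->
  (forall n, ex_RInt (f n) a b) ->
  (forall n x, a <= x <= b -> Rabs (f n x) <= M n) -> ex_series M ->
  is_series (fun n => RInt (f n) a b) (RInt (fun x => Series (fun n => f n x)) a b).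
Proof.
  intros Hab Hf HM HS.
  set (clip := fun x => Rmax a (Rmin b x)).
  assert (Hclip : forall x, a <= clip x <= b).
  { intros x. unfold clip. split; [apply Rmax_l|].
    apply Rmax_lub; [assumption|apply Rmin_l]. }
  assert (Hid : forall x, Rmin a b < x < Rmax a b -> clip x = x).
  { intros x Hx. rewrite Rmin_left, Rmax_right in Hx by assumption.
    unfold clip. rewrite Rmin_right, Rmax_right; lra. }
  destruct (filterlim_RInt (V := R_CompleteNormedModule)
     (fun N x => sum_n (fun n => f n (clip x)) N) a b eventually eventually_filter
     (fun x => Series (fun n => f n (clip x))) (sum_n (fun n => RInt (f n) a b)))
    as [If [H1 H2]].
  - intros N. apply is_RInt_ext with (fun x => sum_n (fun n => f n x) N).
    + intros x Hx. rewrite Hid by assumption. reflexivity.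
    + apply ex_RInt_sum_n, Hf.
  - apply (filterlim_locally (U := fct_UniformSpace R R_CompleteNormedModule)).
    intros eps. destruct (series_remainder_small M eps HS) as [N0 HN0].
    exists N0. intros N HN t.
    unfold ball; simpl; unfold AbsRing_ball, abs, minus, plus, opp; simpl.
    change (Rabs (sum_n (fun n => f n (clip t)) N - Series (fun n => f n (clip t))) < eps).
    rewrite Rabs_minus_sym.
    eapply Rle_lt_trans; [apply series_tail_bound with (M := M)|apply HN0, HN].
    + intros n. apply HM, Hclip.
    + exact HS.
  - apply (is_RInt_ext _ (fun x => Series (fun n => f n x))) in H2.
    + apply (is_RInt_unique (V := R_CompleteNormedModule)) in H2. rewrite H2. exact H1.
    + intros x Hx. rewrite Hid by assumption. reflexivity.
Qed.

Lemma psi_decreasing x y : 0 < x <= y -> psi y <= psi x.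
Proof.
  intros H. apply Series_le; [|apply ex_series_psi; lra].
  intros n. split; [left; apply exp_pos|]. apply exp_le_compat, Ropp_le_contravar.
  apply Rmult_le_compat_l; [|lra]. assert (HP := PI_RGT_0).
  apply Rmult_le_pos; [lra|apply pow2_ge_0].
Qed.

Lemma psi_continuous x : 0 < x -> continuous psi x.
Proof.
  intros Hx. apply continuity_pt_filterlim.
  assert (HP := PI_RGT_0).
  assert (Hr : 0 < x / 2) by lra.
  apply (CVU_continuity (fun N y => sum_n (fun n => exp (- (PI * INR (S n) ^ 2 * y))) N)
           psi x (mkposreal _ Hr)).
  - intros eps Heps.
    assert (HS : ex_series (fun n => exp (- (PI * INR (S n) ^ 2 * (x / 2))))) by (apply ex_series_psi; lra).
    destruct (series_remainder_small _ (mkposreal _ Heps) HS) as [N0 HN0].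
    exists N0. intros n y Hn Hy. unfold Boule in Hy; simpl in Hy. apply Rabs_def2 in Hy.
    eapply Rle_lt_trans; [|apply (HN0 n Hn)].
    apply series_tail_bound; [|exact HS].
    intros k. rewrite Rabs_pos_eq by (left; apply exp_pos).
    apply exp_le_compat, Ropp_le_contravar. apply Rmult_le_compat_l; [|lra].
    apply Rmult_le_pos; [lra|apply pow2_ge_0].
  - intros N y _. apply continuity_pt_filterlim.
    apply (continuous_ext (fun y => sum_n (fun n => exp (- (PI * INR (S n) ^ 2 * y))) N));
      [reflexivity|].
    induction N as [|N IH].
    + apply continuous_ext with (fun y => exp (- (PI * INR 1 ^ 2 * y))).
      * intros t. rewrite sum_O. reflexivity.
      * apply (ex_derive_continuous (V := R_NormedModule)). auto_derive; trivial.
    + apply continuous_ext with (fun y => plus (sum_n (fun n => exp (- (PI * INR (S n) ^ 2 * y))) N)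
          (exp (- (PI * INR (S (S N)) ^ 2 * y)))).
      * intros t. rewrite sum_Sn. reflexivity.
      * apply (continuous_plus (V := R_NormedModule)); [exact IH|].
        apply (ex_derive_continuous (V := R_NormedModule)). auto_derive; trivial.
  - unfold Boule. simpl. rewrite Rminus_diag, Rabs_R0. exact Hr.
Qed.

(** The Mellin integrand of psi in the variable y = log x, normalized so that
    the functional equation becomes the near-symmetry [theta_density_opp]. *)
Definition theta_density (y : R) : R := exp (y / 4) * psi (exp y).

Lemma theta_density_continuous y : continuous theta_density y.
Proof.
  apply (continuous_mult (K := R_AbsRing)).
  - apply (ex_derive_continuous (V := R_NormedModule)). auto_derive; trivial.
  - apply (continuous_comp exp psi).
    + apply (ex_derive_continuous (V := R_NormedModule)). auto_derive; trivial.
    + apply psi_continuous, exp_pos.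
Qed.

Lemma theta_density_nonneg y : 0 <= theta_density y.
Proof. apply Rmult_le_pos; [left; apply exp_pos|apply psi_nonneg, exp_pos]. Qed.

Lemma theta_density_opp y : theta_density (- y) = theta_density y + (exp (y / 4) - exp (- (y / 4))) / 2.
Proof.
  unfold theta_density. assert (H := theta_functional_equation (exp y) (exp_pos y)).
  rewrite <- exp_Ropp in H.
  assert (Hs : sqrt (exp (- y)) = exp (- (y / 4)) * exp (- (y / 4))).
  { rewrite <- (sqrt_square (exp (- (y / 4)) * exp (- (y / 4)))).
    - f_equal. rewrite <- !exp_plus. f_equal. field.
    - left. apply Rmult_lt_0_compat; apply exp_pos. }
  rewrite Hs in H. replace (- y / 4) with (- (y / 4)) by field.
  set (a := exp (- (y / 4))) in *. set (b := exp (y / 4)).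
  assert (Hab : b * a = 1) by (unfold a, b; rewrite <- exp_plus, Rplus_opp_r; apply exp_0).
  set (P := psi (exp y)) in *. set (Q := psi (exp (- y))) in *.
  assert (H2 : b * (1 + 2 * P) = (b * a) * a * (1 + 2 * Q)) by (rewrite H; ring).
  rewrite Hab in H2. lra.
Qed.

Lemma is_lim_seq_sum_n (u : nat -> nat -> R) (I : nat -> R) N :
  (forall n, is_lim_seq (u n) (I n)) ->
  is_lim_seq (fun k => sum_n (fun n => u n k) N) (sum_n I N).
Proof.
  intros HI. induction N as [|N IH].
  - rewrite sum_O. apply is_lim_seq_ext with (u 0%nat); [|apply HI].
    intros k. rewrite sum_O. reflexivity.
  - rewrite sum_Sn. apply is_lim_seq_ext with (fun k => sum_n (fun n => u n k) N + u (S N) k).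
    + intros k. rewrite sum_Sn. reflexivity.
    + apply is_lim_seq_plus'; [exact IH|apply HI].
Qed.

Lemma partial_le_series (a : nat -> R) l N :
  (forall n, 0 <= a n) -> is_series a l -> sum_n a N <= l.
Proof.
  intros Ha H. assert (H' : is_lim_seq (sum_n a) l) by exact H.
  apply (is_lim_seq_incr_compare _ _ H').
  intros n. rewrite sum_Sn. unfold plus; simpl. specialize (Ha (S n)). lra.
Qed.

Lemma term_le_sum_n (a : nat -> R) N : (forall n, 0 <= a n) -> a N <= sum_n a N.
Proof.
  intros Ha. destruct N as [|N]; [rewrite sum_O; lra|].
  rewrite sum_Sn. unfold plus; simpl.
  assert (0 <= sum_n a N); [|lra].
  induction N as [|N IH]; [rewrite sum_O; apply Ha|].
  rewrite sum_Sn. unfold plus; simpl. specialize (Ha (S N)). lra.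
Qed.

(** Tonelli for a series of improper integrals: u n k stands for the integral
    of the n-th term over the k-th interval. *)
Lemma monotone_convergence_series (u : nat -> nat -> R) (I S' : nat -> R) l :
  (forall n k, 0 <= u n k) -> (forall n k, u n k <= u n (S k)) ->
  (forall n, is_lim_seq (u n) (I n)) ->
  (forall k, is_series (fun n => u n k) (S' k)) ->
  is_series I l -> is_lim_seq S' l.
Proof.
  intros Hpos Hinc HI HS Hl.
  assert (HuI : forall n k, u n k <= I n).
  { intros n k. apply (is_lim_seq_incr_compare (u n) (I n)); auto. }
  assert (Hup : forall k, S' k <= l).
  { intros k. rewrite <- (is_series_unique _ _ (HS k)), <- (is_series_unique _ _ Hl).
    apply Series_le; [auto|exists l; exact Hl]. }
  apply is_lim_seq_spec. intros eps.
  assert (He : 0 < eps / 2) by (assert (H := cond_pos eps); lra).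
  assert (Hl' : is_lim_seq (sum_n I) l) by exact Hl.
  apply is_lim_seq_spec in Hl'. destruct (Hl' (mkposreal _ He)) as [N HN].
  specialize (HN N (Nat.le_refl N)). simpl in HN.
  assert (Hfin : is_lim_seq (fun k => sum_n (fun n => u n k) N) (sum_n I N)).
  { apply is_lim_seq_sum_n, HI. }
  apply is_lim_seq_spec in Hfin. destruct (Hfin (mkposreal _ He)) as [k0 Hk0].
  exists k0. intros k Hk. specialize (Hk0 k Hk). simpl in Hk0.
  apply Rabs_def2 in Hk0, HN. specialize (Hup k).
  assert (Hlow : sum_n (fun n => u n k) N <= S' k).
  { apply (partial_le_series (fun n => u n k)); auto. }
  apply Rabs_def1; lra.
Qed.

(** The converse exchange: convergence of the total forces convergence of
    each term, which is how the moments are seen to be finite. *)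
Lemma monotone_convergence_termwise (u : nat -> nat -> R) (S' : nat -> R) (l : R) :
  (forall n k, 0 <= u n k) -> (forall n k, u n k <= u n (S k)) ->
  (forall k, is_series (fun n => u n k) (S' k)) ->
  is_lim_seq S' l ->
  (forall n, ex_finite_lim_seq (u n)) /\ is_series (fun n => real (Lim_seq (u n))) l.
Proof.
  intros Hpos Hinc HS Hl.
  assert (HSinc : forall k, S' k <= S' (S k)).
  { intros k. rewrite <- (is_series_unique _ _ (HS k)), <- (is_series_unique _ _ (HS (S k))).
    apply Series_le; [auto|exists (S' (S k)); apply HS]. }
  assert (HSl : forall k, S' k <= l) by (apply is_lim_seq_incr_compare; assumption).
  assert (Hfin : forall n, ex_finite_lim_seq (u n)).
  { intros n. apply ex_finite_lim_seq_incr with l; [apply Hinc|].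
    intros k. eapply Rle_trans; [|apply HSl].
    eapply Rle_trans; [apply (term_le_sum_n (fun n => u n k))|apply partial_le_series]; auto. }
  split; [exact Hfin|].
  set (I := fun n => real (Lim_seq (u n))).
  assert (HI : forall n, is_lim_seq (u n) (I n)) by (intros n; apply Lim_seq_correct', Hfin).
  assert (HI0 : forall n, 0 <= I n).
  { intros n. apply Rle_trans with (u n O); [apply Hpos|].
    apply (is_lim_seq_incr_compare (u n) (I n)); auto. }
  assert (Hbound : forall N, sum_n I N <= l).
  { intros N.
    assert (Hf := is_lim_seq_sum_n u I N HI).
    apply (is_lim_seq_le _ _ _ _ (fun k => Rle_trans _ _ _
       (partial_le_series (fun n => u n k) (S' k) N (fun n => Hpos n k) (HS k)) (HSl k)) Hf
       (is_lim_seq_const l)). }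
  assert (Hex : ex_finite_lim_seq (sum_n I)).
  { apply ex_finite_lim_seq_incr with l; [|exact Hbound].
    intros n. rewrite sum_Sn. unfold plus; simpl. specialize (HI0 (S n)). lra. }
  destruct Hex as [l' Hl'].
  assert (H := monotone_convergence_series u I S' l' Hpos Hinc HI HS Hl').
  apply is_lim_seq_unique in H. rewrite (is_lim_seq_unique _ _ Hl) in H.
  injection H as H. subst l'. exact Hl'.
Qed.

Lemma ex_RInt_cont (f : R -> R) a b : (forall x, continuous f x) -> ex_RInt f a b.
Proof. intros H. apply (ex_RInt_continuous (V := R_CompleteNormedModule)). auto. Qed.

(** * The Mellin transform of psi and its moments *)

Lemma RInt_mono_interval (f : R -> R) a b c d :
  (forall x, continuous f x) ->
  (forall x, a <= x <= d -> 0 <= f x) -> a <= b -> b <= c -> c <= d ->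
  RInt f b c <= RInt f a d.
Proof.
  intros Hc Hp Hab Hbc Hcd.
  assert (Hex : forall x y, ex_RInt f x y) by (intros; apply ex_RInt_cont, Hc).
  rewrite <- (RInt_Chasles f a b d), <- (RInt_Chasles f b c d) by apply Hex.
  unfold plus; simpl.
  assert (0 <= RInt f a b) by (apply RInt_ge_0; try apply Hex; intros; try apply Hp; lra).
  assert (0 <= RInt f c d) by (apply RInt_ge_0; try apply Hex; intros; try apply Hp; lra).
  lra.
Qed.

Lemma is_lim_seq_exp_opp A : 0 < A -> is_lim_seq (fun k => exp (- (A * INR k))) 0.
Proof.
  intros HA. apply is_lim_seq_incr_1.
  apply (ex_series_lim_0 (fun n => exp (- (A * INR (S n))))), ex_series_exp_opp, HA.
Qed.

Ltac cont_auto := apply (ex_derive_continuous (V := R_NormedModule)); auto_derive; trivial.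

(** The n-th term of psi has Mellin transform
    pi^(-sigma) n^(-2 sigma) Gamma(sigma); g and zr stand for the values of Gamma
    at sigma and of zeta at 2 sigma. *)
Lemma mellin_psi (sigma g zr : R) : 0 < sigma ->
  (forall c, 0 < c ->
     is_lim_seq (fun k => RInt (fun y => exp (sigma * y - c * exp y)) (- INR k) (INR k))
       (g * exp (- sigma * ln c))) ->
  is_series (fun n => exp (- (2 * sigma) * ln (INR (S n)))) zr ->
  is_lim_seq (fun k => RInt (fun y => exp (sigma * y) * psi (exp y)) (- INR k) (INR k))
    (exp (- sigma * ln PI) * g * zr).
Proof.
  intros Hsigma Hg Hz. assert (HP := PI_RGT_0).
  set (f := fun n y => exp (sigma * y - PI * INR (S n) ^ 2 * exp y)).
  assert (Hfc : forall n y, continuous (f n) y) by (intros; unfold f; cont_auto).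
  assert (Hcn : forall n, 0 < PI * INR (S n) ^ 2).
  { intros n. apply Rmult_lt_0_compat; [exact HP|]. apply pow_lt, (lt_INR 0); lia. }
  apply (monotone_convergence_series (fun n k => RInt (f n) (- INR k) (INR k))
          (fun n => g * exp (- sigma * ln (PI * INR (S n) ^ 2)))).
  - intros n k. assert (Hk := pos_INR k). apply RInt_ge_0; [lra|apply ex_RInt_cont, Hfc|].
    intros; left; apply exp_pos.
  - intros n k. assert (Hk := pos_INR k).
    apply RInt_mono_interval; try (rewrite ?S_INR; lra); [apply Hfc|].
    intros; left; apply exp_pos.
  - intros n. apply Hg, Hcn.
  - intros k. assert (Hk := pos_INR k).
    replace (RInt (fun y => exp (sigma * y) * psi (exp y)) (- INR k) (INR k))
      with (RInt (fun y => Series (fun n => f n y)) (- INR k) (INR k)).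
    2:{ apply RInt_ext. intros y _. unfold psi, f. rewrite <- Series_scal_l.
        apply Series_ext. intros n. rewrite <- exp_plus. reflexivity. }
    apply RInt_series with
      (M := fun n => exp (sigma * INR k) * exp (- (PI * INR (S n) ^ 2 * exp (- INR k)))).
    + lra.
    + intros n. apply ex_RInt_cont, Hfc.
    + intros n y Hy. unfold f. rewrite Rabs_pos_eq by (left; apply exp_pos).
      rewrite <- exp_plus. apply exp_le_compat. specialize (Hcn n).
      assert (exp (- INR k) <= exp y) by (apply exp_le_compat; lra).
      assert (sigma * y <= sigma * INR k) by (apply Rmult_le_compat_l; lra).
      assert (PI * INR (S n) ^ 2 * exp (- INR k) <= PI * INR (S n) ^ 2 * exp y)
        by (apply Rmult_le_compat_l; lra).
      lra.
    + apply (ex_series_scal_l (V := R_NormedModule)). apply ex_series_psi, exp_pos.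
  - apply is_series_ext with
      (fun n => scal (exp (- sigma * ln PI) * g) (exp (- (2 * sigma) * ln (INR (S n))))).
    + intros n. assert (Hn : 0 < INR (S n)) by (apply (lt_INR 0); lia).
      replace (ln (PI * INR (S n) ^ 2)) with (ln PI + 2 * ln (INR (S n))).
      * replace (- sigma * (ln PI + 2 * ln (INR (S n)))) with
          (- sigma * ln PI + - (2 * sigma) * ln (INR (S n))) by ring.
        rewrite exp_plus. unfold scal; simpl; unfold mult; simpl. ring.
      * replace (INR (S n) ^ 2) with (INR (S n) * INR (S n)) by ring.
        rewrite !ln_mult by nra. ring.
    + apply (is_series_scal_l (V := R_NormedModule)), Hz.
Qed.

(** The integral, over the half-line, of the asymmetric part of
    [theta_density]. *)
Lemma boundary_term_limit z : / 2 < z ->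
  is_lim_seq (fun k => RInt (fun y => exp (- (z * y / 2)) * ((exp (y / 4) - exp (- (y / 4))) / 2))
                        0 (INR k)) (/ (z ^ 2 - / 4)).
Proof.
  intros Hz. set (A := z / 2 - / 4). set (B := z / 2 + / 4).
  assert (HA : 0 < A) by (unfold A; lra). assert (HB : 0 < B) by (unfold B; lra).
  set (F := fun y => / 2 * (exp (- (B * y)) / B - exp (- (A * y)) / A)).
  apply is_lim_seq_ext with (fun k => F (INR k) - F 0).
  - intros k. symmetry. apply is_RInt_unique.
    apply (is_RInt_derive (V := R_CompleteNormedModule) F).
    + intros y _. unfold F. auto_derive; [lra|].
      replace (exp (- (z * y / 2)) * ((exp (y / 4) - exp (- (y / 4))) / 2))
        with (/ 2 * (exp (- (z * y / 2)) * exp (y / 4) - exp (- (z * y / 2)) * exp (- (y / 4))))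
        by field.
      rewrite <- !exp_plus.
      replace (- (z * y / 2) + y / 4) with (- (A * y)) by (unfold A; field).
      replace (- (z * y / 2) + - (y / 4)) with (- (B * y)) by (unfold B; field).
      field. lra.
    + intros y _. cont_auto.
  - replace (/ (z ^ 2 - / 4)) with (/ 2 * (0 * / B - 0 * / A) - F 0).
    + unfold F, Rdiv. assert (H1 := is_lim_seq_exp_opp A HA). assert (H2 := is_lim_seq_exp_opp B HB).
      lim_seq.
    + unfold F. rewrite !Rmult_0_r, Ropp_0, exp_0. unfold A, B. field.
      repeat split; nra.
Qed.

Definition cosh_moment z k := RInt (fun y => (exp (z * y / 2) + exp (- (z * y / 2))) * theta_density y) 0 (INR k).

(** Fold the negative half-line by y -> -y and use [theta_density_opp]. *)
Lemma mellin_split z (J : R) : / 2 < z ->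
  is_lim_seq (fun k => RInt (fun y => exp ((z / 2 + / 4) * y) * psi (exp y)) (- INR k) (INR k)) J ->
  is_lim_seq (cosh_moment z) (J - / (z ^ 2 - / 4)).
Proof.
  intros Hz HJ.
  apply is_lim_seq_ext with (2 := is_lim_seq_minus' _ _ _ _ HJ (boundary_term_limit z Hz)).
  intros k. unfold cosh_moment.
  set (f1 := fun y => exp (z * y / 2) * theta_density y).
  set (f2 := fun y => exp (- (z * y / 2)) * theta_density y).
  set (f3 := fun y => exp (- (z * y / 2)) * ((exp (y / 4) - exp (- (y / 4))) / 2)).
  assert (C1 : forall y, continuous f1 y).
  { intros y. apply (continuous_mult (K := R_AbsRing)); [cont_auto|apply theta_density_continuous]. }
  assert (C2 : forall y, continuous f2 y).
  { intros y. apply (continuous_mult (K := R_AbsRing)); [cont_auto|apply theta_density_continuous]. }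
  assert (C3 : forall y, continuous f3 y) by (intros y; unfold f3; cont_auto).
  assert (E1 : RInt (fun y => exp ((z / 2 + / 4) * y) * psi (exp y)) (- INR k) (INR k)
             = RInt f1 (- INR k) (INR k)).
  { apply RInt_ext. intros y _. unfold f1, theta_density. rewrite <- Rmult_assoc, <- exp_plus.
    f_equal. f_equal. field. }
  rewrite E1, <- (RInt_Chasles f1 (- INR k) 0 (INR k)) by (apply ex_RInt_cont, C1).
  assert (E2 : RInt f1 (- INR k) 0 = RInt f2 0 (INR k) + RInt f3 0 (INR k)).
  { rewrite <- (RInt_plus (V := R_CompleteNormedModule)) by (apply ex_RInt_cont; assumption).
    assert (H := RInt_comp_lin f1 (-1) 0 0 (INR k) (ex_RInt_cont _ _ _ C1)).
    replace (-1 * 0 + 0) with 0 in H by ring.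
    replace (-1 * INR k + 0) with (- INR k) in H by ring.
    rewrite <- (opp_RInt_swap f1), <- H by (apply ex_RInt_cont, C1).
    rewrite <- (RInt_opp (V := R_CompleteNormedModule)).
    - apply RInt_ext. intros y _. unfold f1, f2, f3, opp, plus, scal; simpl; unfold mult; simpl.
      replace (-1 * y + 0) with (- y) by ring.
      rewrite theta_density_opp. replace (z * - y / 2) with (- (z * y / 2)) by field. ring.
    - apply ex_RInt_cont. intros y. apply (continuous_scal_r (V := R_NormedModule)).
      apply (continuous_comp (fun y => -1 * y + 0) f1); [cont_auto|apply C1]. }
  rewrite E2. unfold plus; simpl.
  rewrite (RInt_ext (fun y => (exp (z * y / 2) + exp (- (z * y / 2))) * theta_density y)
      (fun y => plus (f1 y) (f2 y))).
  - rewrite (RInt_plus (V := R_CompleteNormedModule)) by (apply ex_RInt_cont; assumption).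
    unfold plus; simpl. unfold f3. ring.
  - intros y _. unfold f1, f2, plus; simpl. ring.
Qed.

(** Even part of the exponential series. *)
Lemma is_series_cosh x :
  is_series (fun n => 2 * (x ^ (2 * n) / INR (fact (2 * n)))) (exp x + exp (- x)).
Proof.
  assert (Hex : forall f : nat -> nat, (forall n, (n <= f n)%nat) ->
    forall t, ex_pseries (fun n => / INR (fact (f n))) t).
  { intros f Hf t. apply ex_pseries_R.
    apply (ex_series_le (V := R_CompleteNormedModule)) with (b := fun n => Rabs t ^ n * / INR (fact n)).
    - intros n. unfold norm; simpl; unfold abs; simpl.
      rewrite Rabs_mult, <- RPow_abs, Rmult_comm.
      assert (H1 := INR_fact_lt_0 (f n)). assert (H2 := INR_fact_lt_0 n).
      apply Rmult_le_compat_l; [apply pow_le, Rabs_pos|].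
      rewrite Rabs_pos_eq by (left; apply Rinv_0_lt_compat; assumption).
      apply Rinv_le_contravar; [assumption|]. apply le_INR, fact_le, Hf.
    - exists (exp (Rabs t)). assert (H := is_exp_Reals (Rabs t)).
      apply is_pseries_R in H. eapply is_series_ext; [|exact H]. intros n; simpl; ring. }
  set (Ev := fun n => / INR (fact (2 * n))). set (Od := fun n => / INR (fact (2 * n + 1))).
  assert (He : ex_pseries Ev (x ^ 2)) by (apply (Hex (fun n => 2 * n)%nat); intros; lia).
  assert (Ho : ex_pseries Od (x ^ 2)) by (apply (Hex (fun n => 2 * n + 1)%nat); intros; lia).
  assert (H1 : exp x = PSeries Ev (x ^ 2) + x * PSeries Od (x ^ 2)).
  { transitivity (PSeries (fun n => / INR (fact n)) x).
    - symmetry. apply is_pseries_unique, is_exp_Reals.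
    - apply (PSeries_odd_even (fun n => / INR (fact n)) x He Ho). }
  assert (H2 : exp (- x) = PSeries Ev (x ^ 2) + - x * PSeries Od (x ^ 2)).
  { replace (x ^ 2) with ((- x) ^ 2) in * by ring.
    transitivity (PSeries (fun n => / INR (fact n)) (- x)).
    - symmetry. apply is_pseries_unique, is_exp_Reals.
    - apply (PSeries_odd_even (fun n => / INR (fact n)) (- x) He Ho). }
  replace (exp x + exp (- x)) with (scal 2 (PSeries Ev (x ^ 2)))
    by (rewrite H1, H2; unfold scal; simpl; unfold mult; simpl; ring).
  apply is_series_ext with (fun n => scal 2 (Ev n * (x ^ 2) ^ n)).
  - intros n. change (2 * (Ev n * (x ^ 2) ^ n) = 2 * (x ^ (2 * n) / INR (fact (2 * n)))).
    unfold Ev. rewrite <- pow_mult. unfold Rdiv. ring.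
  - apply (is_series_scal_l (V := R_NormedModule)).
    apply PSeries_correct, is_pseries_R in He. exact He.
Qed.

Definition moment (j : nat) : R :=
  real (Lim_seq (fun k => RInt (fun y => y ^ j * theta_density y) 0 (INR k))).

Lemma pow_theta_density_continuous j y : continuous (fun y => y ^ j * theta_density y) y.
Proof.
  apply (continuous_mult (K := R_AbsRing)); [cont_auto|apply theta_density_continuous].
Qed.

(** All terms are nonnegative, so the exchange of sum and improper integral
    needs only that the total converges. *)
Lemma cosh_expansion z (l : R) : 0 < z -> is_lim_seq (cosh_moment z) l ->
  (forall n, is_lim_seq (fun k => RInt (fun y => y ^ (2 * n) * theta_density y) 0 (INR k))
               (moment (2 * n))) /\
  is_series (fun n => 2 * ((z / 2) ^ (2 * n) / INR (fact (2 * n))) * moment (2 * n)) l.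
Proof.
  intros Hz Hl.
  set (c := fun n => 2 * ((z / 2) ^ (2 * n) / INR (fact (2 * n)))).
  assert (Hc : forall n, 0 < c n).
  { intros n. unfold c. assert (H := INR_fact_lt_0 (2 * n)).
    apply Rmult_lt_0_compat; [lra|]. apply Rdiv_lt_0_compat; [|exact H]. apply pow_lt; lra. }
  set (v := fun n k => RInt (fun y => y ^ (2 * n) * theta_density y) 0 (INR k)).
  set (f := fun n y => scal (c n) (y ^ (2 * n) * theta_density y)).
  assert (Hv : forall n k, RInt (f n) 0 (INR k) = c n * v n k).
  { intros n k. unfold f. rewrite (RInt_scal (V := R_CompleteNormedModule)).
    - reflexivity.
    - apply ex_RInt_cont, pow_theta_density_continuous. }
  assert (Hfc : forall n y, continuous (f n) y).
  { intros n y. apply (continuous_scal_r (V := R_NormedModule)), pow_theta_density_continuous. }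
  assert (Hf0 : forall n y, 0 <= f n y).
  { intros n y. apply Rmult_le_pos; [left; apply Hc|].
    apply Rmult_le_pos; [rewrite pow_mult; apply pow_le, pow2_ge_0|apply theta_density_nonneg]. }
  destruct (monotone_convergence_termwise (fun n k => RInt (f n) 0 (INR k)) (cosh_moment z) l)
    as [Hfin Hser].
  - intros n k. apply RInt_ge_0; [apply pos_INR|apply ex_RInt_cont, Hfc|auto].
  - intros n k. assert (Hk := pos_INR k).
    apply RInt_mono_interval; try (rewrite ?S_INR; lra); auto; lra.
  - intros k. assert (Hk := pos_INR k).
    replace (cosh_moment z k) with (RInt (fun y => Series (fun n => f n y)) 0 (INR k)).
    2:{ apply RInt_ext. intros y _.
        rewrite <- (is_series_unique _ _ (is_series_cosh (z * y / 2))), <- Series_scal_r.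
        apply Series_ext. intros n. unfold f, c, scal; simpl; unfold mult; simpl.
        replace (z * y / 2) with (z / 2 * y) by field.
        change (n + (n + 0))%nat with (2 * n)%nat.
        rewrite Rpow_mult_distr. unfold Rdiv. ring. }
    apply RInt_series with
      (M := fun n => 2 * ((z * INR k / 2) ^ (2 * n) / INR (fact (2 * n))) * (exp (INR k / 4) * psi 1)).
    + exact Hk.
    + intros n. apply ex_RInt_cont, Hfc.
    + intros n y Hy. rewrite Rabs_pos_eq by apply Hf0.
      unfold f, c, scal; simpl; unfold mult; simpl.
      change (n + (n + 0))%nat with (2 * n)%nat.
      replace (z * INR k / 2) with (z / 2 * INR k) by field.
      rewrite Rpow_mult_distr.
      replace (2 * ((z / 2) ^ (2 * n) * INR k ^ (2 * n) / INR (fact (2 * n))) * (exp (INR k / 4) * psi 1))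
        with (2 * ((z / 2) ^ (2 * n) / INR (fact (2 * n))) * (INR k ^ (2 * n) * (exp (INR k / 4) * psi 1)))
        by (unfold Rdiv; ring).
      apply Rmult_le_compat_l; [left; apply Hc|].
      apply Rmult_le_compat; [apply pow_le; lra|apply theta_density_nonneg|apply pow_incr; lra|].
      apply Rmult_le_compat; [left; apply exp_pos|apply psi_nonneg, exp_pos| |].
      * apply exp_le_compat; lra.
      * apply psi_decreasing. assert (H := exp_ineq1_le y). lra.
    + apply ex_series_ext with (fun n => scal (exp (INR k / 4) * psi 1)
          (2 * ((z * INR k / 2) ^ (2 * n) / INR (fact (2 * n))))).
      * intros n. unfold scal; simpl; unfold mult; simpl. ring.
      * apply (ex_series_scal_l (V := R_NormedModule)). eexists. apply is_series_cosh.
  - exact Hl.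
  - assert (Hlim : forall n, is_lim_seq (v n) (moment (2 * n))).
    { intros n. apply Lim_seq_correct'. destruct (Hfin n) as [b Hb].
      exists (/ c n * b).
      apply is_lim_seq_ext with (fun k => / c n * RInt (f n) 0 (INR k)).
      - intros k. rewrite Hv. specialize (Hc n). field. lra.
      - lim_seq. }
    split; [exact Hlim|].
    eapply is_series_ext; [|exact Hser]. intros n. simpl.
    assert (H : is_lim_seq (fun k => RInt (f n) 0 (INR k)) (c n * moment (2 * n))).
    { apply is_lim_seq_ext with (fun k => c n * v n k); [intros; symmetry; apply Hv|].
      specialize (Hlim n). lim_seq. }
    rewrite (is_lim_seq_unique _ _ H). reflexivity.
Qed.

(** * Gaussian and exponential integrals *)

Definition gauss_int (x : R) : R := RInt (fun t => exp (- t ^ 2)) 0 x.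
(** Auxiliary integral whose derivative cancels that of the square of
    [gauss_int]. *)
Definition gauss_rest (x : R) : R :=
  RInt (fun t => exp (- (x ^ 2 * (1 + t ^ 2))) / (1 + t ^ 2)) 0 1.

Lemma one_plus_sq_pos t : 0 < 1 + t ^ 2.
Proof. assert (H := pow2_ge_0 t). lra. Qed.

Lemma continuity_2d_pt_of_continuous (f : R -> R -> R) x y :
  continuous (fun z : R * R => f (fst z) (snd z)) (x, y) -> continuity_2d_pt f x y.
Proof.
  intros H. apply continuity_2d_pt_filterlim. exact H.
Qed.

(** The left-hand side has derivative 0 by differentiation under the
    integral sign, and at 0 it is arctan 1. *)
Lemma gauss_identity x : 0 <= x -> gauss_int x ^ 2 + gauss_rest x = PI / 4.
Proof.
  set (h := fun x t => exp (- (x ^ 2 * (1 + t ^ 2))) / (1 + t ^ 2)).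
  set (h' := fun x t => - (2 * x * exp (- (x ^ 2 * (1 + t ^ 2))))).
  assert (Hh : forall x t : R, is_derive (fun u => h u t) x (h' x t)).
  { intros u t. assert (H := one_plus_sq_pos t). unfold h, h'. auto_derive; [trivial|].
    replace (u * (u * 1) * (1 + t * (t * 1))) with (u ^ 2 * (1 + t ^ 2)) by ring.
    field. lra. }
  assert (Hc : forall x t, continuous (fun z : R * R => h' (fst z) (snd z)) (x, t)).
  { intros u t. unfold h'.
    apply (continuous_opp (V := R_NormedModule)).
    apply (continuous_mult (K := R_AbsRing) (fun z : R * R => 2 * fst z)).
    - apply (continuous_mult (K := R_AbsRing) (fun _ : R * R => 2)); [apply continuous_const|apply continuous_fst].
    - apply (continuous_comp (fun z : R * R => - (fst z ^ 2 * (1 + snd z ^ 2))) exp); [|cont_auto].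
      apply (continuous_opp (V := R_NormedModule)).
      apply (continuous_mult (K := R_AbsRing) (fun z : R * R => fst z ^ 2) (fun z => 1 + snd z ^ 2)).
      + apply (continuous_comp (fun z : R * R => fst z) (fun a => a ^ 2)); [apply continuous_fst|cont_auto].
      + apply (continuous_comp (fun z : R * R => snd z) (fun a => 1 + a ^ 2)); [apply continuous_snd|cont_auto]. }
  assert (Hrest : forall x, is_derive gauss_rest x (RInt (fun t => h' x t) 0 1)).
  { intros u. unfold gauss_rest.
    rewrite (RInt_ext (fun t => h' u t) (fun t => Derive (fun v => h v t) u)).
    2:{ intros t _. symmetry. apply is_derive_unique, Hh. }
    apply (is_derive_RInt_param h 0 1 u).
    - apply filter_forall. intros v t _. eexists; apply Hh.
    - intros t _. apply continuity_2d_pt_ext with (f := h').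
      + intros a b. symmetry. apply is_derive_unique, Hh.
      + apply continuity_2d_pt_of_continuous, Hc.
    - apply filter_forall. intros v. apply ex_RInt_cont. intros t. unfold h.
      assert (H := one_plus_sq_pos t). apply (ex_derive_continuous (V := R_NormedModule)). auto_derive. lra. }
  assert (Hint : forall x, is_derive gauss_int x (exp (- x ^ 2))).
  { intros u. apply (is_derive_RInt (V := R_NormedModule) (fun t => exp (- t ^ 2)) gauss_int 0).
    - apply filter_forall. intros v. apply (RInt_correct (V := R_CompleteNormedModule)), ex_RInt_cont.
      intros t; cont_auto.
    - cont_auto. }
  assert (Hscale : forall x, RInt (fun t => h' x t) 0 1 = - (2 * exp (- x ^ 2) * gauss_int x)).
  { intros u. unfold gauss_int.
    assert (H := RInt_comp_lin (fun t => exp (- t ^ 2)) u 0 0 1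
       (ex_RInt_cont (fun t => exp (- t ^ 2)) _ _ ltac:(intros; cont_auto))).
    replace (u * 0 + 0) with 0 in H by ring. replace (u * 1 + 0) with u in H by ring.
    rewrite <- H.
    transitivity (scal (- (2 * exp (- u ^ 2))) (RInt (fun y => scal u (exp (- (u * y + 0) ^ 2))) 0 1));
      [|unfold scal; simpl; unfold mult; simpl; ring].
    rewrite <- (RInt_scal (V := R_CompleteNormedModule) _ _ _ (- (2 * exp (- u ^ 2)))).
    - apply RInt_ext. intros t _. unfold h', scal; simpl; unfold mult; simpl.
      replace (- (u * (u * 1) * (1 + t * (t * 1)))) with (- (u * (u * 1)) + - ((u * t + 0) * ((u * t + 0) * 1)))
        by ring.
      rewrite exp_plus. ring.
    - apply ex_RInt_cont. intros t. apply (continuous_scal_r (V := R_NormedModule)). cont_auto. }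
  assert (H0 : gauss_int 0 ^ 2 + gauss_rest 0 = PI / 4).
  { assert (G0 : gauss_int 0 = 0) by (unfold gauss_int; rewrite RInt_point; reflexivity).
    rewrite G0. replace (gauss_rest 0) with (PI / 4); [ring|].
    symmetry. unfold gauss_rest. apply is_RInt_unique.
    apply (is_RInt_ext (fun t => / (1 + t ^ 2))).
    - intros t _. replace (- (0 ^ 2 * (1 + t ^ 2))) with 0 by ring. rewrite exp_0.
      symmetry. apply Rmult_1_l.
    - rewrite <- atan_1. replace (atan 1) with (minus (atan 1) (atan 0))
        by (rewrite atan_0; unfold minus, plus, opp; simpl; ring).
      apply (is_RInt_derive (V := R_CompleteNormedModule) atan).
      + intros t _. apply is_derive_Reals.
        apply derivable_pt_lim_atan.
      + intros t _. assert (H := one_plus_sq_pos t). apply (ex_derive_continuous (V := R_NormedModule)). auto_derive. lra. }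
  intros Hx.
  assert (Hd : forall x, is_derive (fun x => gauss_int x ^ 2 + gauss_rest x - PI / 4) x 0).
  { intros u.
    assert (Hi : ex_derive gauss_int u) by (eexists; apply Hint).
    assert (Hr : ex_derive gauss_rest u) by (eexists; apply Hrest).
    auto_derive; [auto|].
    replace (Derive (fun x => gauss_int x) u) with (exp (- u ^ 2))
      by (symmetry; apply is_derive_unique, Hint).
    replace (Derive (fun x => gauss_rest x) u) with (- (2 * exp (- u ^ 2) * gauss_int u))
      by (rewrite <- Hscale; symmetry; apply is_derive_unique, Hrest).
    ring. }
  assert (H1 : 0 <= gauss_int x ^ 2 + gauss_rest x - PI / 4).
  { apply (nonneg_of_nonneg_derive (fun x => gauss_int x ^ 2 + gauss_rest x - PI / 4) (fun _ => 0));
      [exact Hd|lra|intros; lra|exact Hx]. }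
  assert (H2 : 0 <= - (gauss_int x ^ 2 + gauss_rest x - PI / 4)).
  { apply (nonneg_of_nonneg_derive (fun x => - (gauss_int x ^ 2 + gauss_rest x - PI / 4)) (fun _ => 0));
      [|lra|intros; lra|exact Hx].
    intros u. assert (H := is_derive_opp _ _ _ (Hd u)).
    unfold opp in H; simpl in H. rewrite Ropp_0 in H. exact H. }
  lra.
Qed.

Lemma gauss_rest_bounds x : 0 < x -> 0 <= gauss_rest x <= / x ^ 2.
Proof.
  intros Hx.
  assert (Hcont : ex_RInt (fun t => exp (- (x ^ 2 * (1 + t ^ 2))) / (1 + t ^ 2)) 0 1).
  { apply ex_RInt_cont. intros t. assert (H := one_plus_sq_pos t).
    apply (ex_derive_continuous (V := R_NormedModule)). auto_derive. lra. }
  split.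
  - apply RInt_ge_0; [lra|exact Hcont|]. intros t _.
    apply Rdiv_le_0_compat; [left; apply exp_pos|apply one_plus_sq_pos].
  - replace (/ x ^ 2) with (RInt (fun _ => / x ^ 2) 0 1).
    2:{ rewrite RInt_const. unfold scal; simpl; unfold mult; simpl. ring. }
    apply RInt_le; [lra|exact Hcont|apply ex_RInt_const|].
    intros t _. assert (H := one_plus_sq_pos t). assert (Ht := pow2_ge_0 t).
    assert (Hx2 : 0 < x ^ 2) by nra.
    apply Rle_div_l; [exact H|].
    rewrite exp_Ropp. apply Rle_trans with (/ x ^ 2).
    + apply Rinv_le_contravar; [exact Hx2|].
      assert (He := exp_ineq1_le (x ^ 2 * (1 + t ^ 2))). nra.
    + assert (Hi : 0 < / x ^ 2) by (apply Rinv_0_lt_compat, Hx2). nra.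
Qed.

(** Both bounds are read off [gauss_identity]; the lower one is crude in its
    tail 1/x, which is enough since x is exponentially large in w below. *)
Lemma gauss_int_bounds x : 0 < x ->
  gauss_int x <= sqrt PI / 2 /\ (2 <= x -> sqrt PI / 2 - / x <= gauss_int x).
Proof.
  intros Hx. assert (H := gauss_identity x ltac:(lra)).
  assert (Hr := gauss_rest_bounds x Hx).
  assert (HP := PI_RGT_0). assert (Hsp : 0 < sqrt PI) by (apply sqrt_lt_R0, HP).
  assert (Hs2 : sqrt PI * sqrt PI = PI) by (apply sqrt_sqrt; lra).
  assert (Hg : 0 <= gauss_int x).
  { apply RInt_ge_0; [lra|apply ex_RInt_cont; intros; cont_auto|]. intros; left; apply exp_pos. }
  split.
  - apply Rnot_lt_le. intros Hc.
    assert (Hc2 : (sqrt PI / 2) ^ 2 < gauss_int x ^ 2) by nra. nra.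
  - intros Hx2. apply Rnot_lt_le. intros Hc.
    assert (Hi : 0 < / x) by (apply Rinv_0_lt_compat, Hx).
    assert (Hi2 : / x <= / 2) by (apply Rinv_le_contravar; lra).
    assert (Hsp1 : 1 <= sqrt PI) by (rewrite <- sqrt_1; apply sqrt_le_1_alt; assert (H' := PI2_1); lra).
    rewrite <- pow_inv in Hr.
    assert (Hc2 : gauss_int x ^ 2 < (sqrt PI / 2 - / x) ^ 2) by nra.
    nra.
Qed.

Lemma gauss_scaled a p q : 0 < a ->
  RInt (fun v => exp (- (a * v ^ 2))) p q
  = / sqrt a * (gauss_int (sqrt a * q) - gauss_int (sqrt a * p)).
Proof.
  intros Ha. assert (Hs : 0 < sqrt a) by (apply sqrt_lt_R0, Ha).
  assert (Hex : forall b c, ex_RInt (fun t => exp (- t ^ 2)) b c)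
    by (intros; apply ex_RInt_cont; intros; cont_auto).
  assert (H := RInt_comp_lin (fun t => exp (- t ^ 2)) (sqrt a) 0 p q (Hex _ _)).
  rewrite !Rplus_0_r in H.
  assert (HC : gauss_int (sqrt a * q) - gauss_int (sqrt a * p)
               = RInt (fun t => exp (- t ^ 2)) (sqrt a * p) (sqrt a * q)).
  { unfold gauss_int.
    rewrite <- (RInt_Chasles (fun t => exp (- t ^ 2)) 0 (sqrt a * p) (sqrt a * q)) by apply Hex.
    apply Rplus_minus_l. }
  rewrite HC.
  change (RInt (fun v => exp (- (a * v ^ 2))) p q
     = / sqrt a * RInt (fun t => exp (- t ^ 2)) (sqrt a * p) (sqrt a * q)).
  rewrite <- H.
  rewrite (RInt_scal (V := R_CompleteNormedModule)).
  - unfold scal; simpl; unfold mult; simpl. rewrite <- Rmult_assoc, Rinv_l, Rmult_1_l by lra.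
    apply RInt_ext. intros v _. f_equal. f_equal.
    replace ((sqrt a * v + 0) * ((sqrt a * v + 0) * 1)) with ((sqrt a * sqrt a) * (v * (v * 1))) by ring.
    rewrite sqrt_sqrt by lra. reflexivity.
  - apply ex_RInt_cont. intros; cont_auto.
Qed.

Lemma gauss_int_odd x : gauss_int (- x) = - gauss_int x.
Proof.
  assert (Hex : forall b c, ex_RInt (fun t => exp (- t ^ 2)) b c)
    by (intros; apply ex_RInt_cont; intros; cont_auto).
  assert (H := RInt_comp_lin (fun t => exp (- t ^ 2)) (-1) 0 0 x (Hex _ _)).
  unfold gauss_int.
  replace (-1 * 0 + 0) with 0 in H by ring. replace (-1 * x + 0) with (- x) in H by ring.
  rewrite <- H. rewrite <- (RInt_opp (V := R_CompleteNormedModule)) by apply Hex.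
  apply RInt_ext. intros t _. unfold scal, opp; simpl; unfold mult; simpl.
  replace (- ((-1 * t + 0) * ((-1 * t + 0) * 1))) with (- (t * (t * 1))) by ring. ring.
Qed.

Lemma gauss_int_abs_le x : - (sqrt PI / 2) <= gauss_int x <= sqrt PI / 2.
Proof.
  assert (HP := PI_RGT_0). assert (Hsp : 0 < sqrt PI) by (apply sqrt_lt_R0, HP).
  assert (Hnn : forall y, 0 <= y -> 0 <= gauss_int y <= sqrt PI / 2).
  { intros y [Hy|<-].
    - split; [|apply gauss_int_bounds, Hy].
      apply RInt_ge_0; [lra|apply ex_RInt_cont; intros; cont_auto|]. intros; left; apply exp_pos.
    - assert (G0 : gauss_int 0 = 0) by (unfold gauss_int; rewrite RInt_point; reflexivity).
      lra. }
  destruct (Rle_dec 0 x) as [Hx|Hx].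
  - specialize (Hnn x Hx). lra.
  - specialize (Hnn (- x) ltac:(lra)). rewrite gauss_int_odd in Hnn. lra.
Qed.

(** The value over the whole line bounds the integral over every interval. *)
Lemma gauss_upper a p q : 0 < a ->
  RInt (fun v => exp (- (a * v ^ 2))) p q <= sqrt PI / sqrt a.
Proof.
  intros Ha. rewrite gauss_scaled by assumption.
  assert (Hs : 0 < / sqrt a) by (apply Rinv_0_lt_compat, sqrt_lt_R0, Ha).
  assert (H1 := gauss_int_abs_le (sqrt a * q)). assert (H2 := gauss_int_abs_le (sqrt a * p)).
  unfold Rdiv. rewrite Rmult_comm. apply Rmult_le_compat_r; lra.
Qed.

Lemma gauss_lower a p : 0 < a -> 0 < p -> 2 <= sqrt a * p ->
  sqrt PI / sqrt a - 2 / (a * p) <= RInt (fun v => exp (- (a * v ^ 2))) (- p) p.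
Proof.
  intros Ha Hp H2. rewrite gauss_scaled by assumption.
  assert (Hs : 0 < sqrt a) by (apply sqrt_lt_R0, Ha).
  replace (sqrt a * - p) with (- (sqrt a * p)) by ring. rewrite gauss_int_odd.
  destruct (gauss_int_bounds (sqrt a * p)) as [_ H]; [nra|]. specialize (H H2).
  replace (2 / (a * p)) with (/ sqrt a * (2 * / (sqrt a * p))).
  - replace (sqrt PI / sqrt a) with (/ sqrt a * sqrt PI) by (field; lra).
    rewrite <- Rmult_minus_distr_l. apply Rmult_le_compat_l; [|lra].
    left; apply Rinv_0_lt_compat, Hs.
  - replace a with (sqrt a * sqrt a) at 3 by (apply sqrt_sqrt; lra). field. lra.
Qed.

Lemma exp_abs_upper mu p q : 0 < mu -> p <= q ->
  RInt (fun v => exp (- (mu * Rabs v))) p q <= 2 / mu.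
Proof.
  intros Hm Hpq.
  assert (Hex : forall b c, ex_RInt (fun v => exp (- (mu * Rabs v))) b c).
  { intros. apply ex_RInt_cont. intros v.
    apply (continuous_comp (fun v => Rabs v) (fun u => exp (- (mu * u)))); [|cont_auto].
    apply continuous_Rabs. }
  set (X := Rmax (Rabs p) (Rabs q)).
  assert (Hp := Rmax_l (Rabs p) (Rabs q)). assert (Hq := Rmax_r (Rabs p) (Rabs q)). fold X in Hp, Hq.
  assert (Hp' := Rabs_maj2 p). assert (Hq' := Rle_abs q). assert (H0 := Rabs_pos p).
  apply Rle_trans with (RInt (fun v => exp (- (mu * Rabs v))) (- X) X).
  { apply RInt_mono_interval; try lra.
    - intros v. apply (continuous_comp (fun v => Rabs v) (fun u => exp (- (mu * u)))); [|cont_auto].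
      apply continuous_Rabs.
    - intros; left; apply exp_pos. }
  rewrite <- (RInt_Chasles _ (- X) 0 X) by apply Hex.
  assert (HR : RInt (fun v => exp (- (mu * Rabs v))) 0 X = (1 - exp (- (mu * X))) / mu).
  { apply is_RInt_unique.
    apply (is_RInt_ext (fun v => exp (- (mu * v)))).
    - intros v Hv. rewrite Rmin_left in Hv by lra. rewrite Rabs_pos_eq by lra. reflexivity.
    - replace ((1 - exp (- (mu * X))) / mu) with
        (minus ((fun v => - exp (- (mu * v)) / mu) X) ((fun v => - exp (- (mu * v)) / mu) 0)).
      + apply (is_RInt_derive (V := R_CompleteNormedModule) (fun v => - exp (- (mu * v)) / mu)).
        * intros v _. auto_derive; [trivial|]. field; lra.
        * intros v _. cont_auto.
      + unfold minus, plus, opp; simpl. rewrite Rmult_0_r, Ropp_0, exp_0. field. lra. }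
  assert (HL : RInt (fun v => exp (- (mu * Rabs v))) (- X) 0 = (1 - exp (- (mu * X))) / mu).
  { rewrite <- HR.
    assert (H := RInt_comp_lin (fun v => exp (- (mu * Rabs v))) (-1) 0 0 X (Hex _ _)).
    replace (-1 * 0 + 0) with 0 in H by ring. replace (-1 * X + 0) with (- X) in H by ring.
    rewrite <- (opp_RInt_swap), <- H by apply Hex.
    rewrite <- (RInt_opp (V := R_CompleteNormedModule)).
    - apply RInt_ext. intros v _. unfold opp, scal; simpl; unfold mult; simpl.
      replace (-1 * v + 0) with (- v) by ring. rewrite Rabs_Ropp. ring.
    - apply ex_RInt_cont. intros v. apply (continuous_scal_r (V := R_NormedModule)).
      apply (continuous_comp (fun v => Rabs (-1 * v + 0)) (fun u => exp (- (mu * u)))); [|cont_auto].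
      apply (continuous_comp (fun v => -1 * v + 0) Rabs); [cont_auto|apply continuous_Rabs]. }
  rewrite HL, HR. unfold plus; simpl.
  assert (He := exp_pos (- (mu * X))).
  replace (2 / mu) with (/ mu * 2) by (field; lra).
  replace ((1 - exp (- (mu * X))) / mu + (1 - exp (- (mu * X))) / mu)
    with (/ mu * (2 - 2 * exp (- (mu * X)))) by (field; lra).
  apply Rmult_le_compat_l; [left; apply Rinv_0_lt_compat, Hm|lra].
Qed.

(** * Laplace's method for the moments *)

Lemma psi_lower x : 0 < x -> exp (- (PI * x)) <= psi x.
Proof.
  intros Hx. assert (H := Series_correct _ (ex_series_psi x Hx)). fold (psi x) in H.
  apply (partial_le_series _ _ 0) in H.
  - rewrite sum_O in H. simpl INR in H. replace (PI * 1 ^ 2 * x) with (PI * x) in H by ring. exact H.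
  - intros; left; apply exp_pos.
Qed.

(** Since (n+1)^2 >= 1 + 3n, psi x is dominated by the geometric series
    of ratio q = exp(-3 pi x), and q <= 1/(1+y).  The factor 1/y, rather than a
    constant, lowers the power of the integrand by one, so that the terms n >= 2 of
    psi contribute only a relative 1/w. *)
Lemma psi_upper x y : 0 < y <= x -> psi x <= exp (- (PI * x)) * (1 + / y).
Proof.
  intros Hxy. assert (HP : 1 < PI) by (assert (H := PI2_1); lra).
  set (q := exp (- (3 * PI * x))).
  assert (Hq0 : 0 < q) by apply exp_pos.
  assert (Hy1 : 0 < / y) by (apply Rinv_0_lt_compat; lra).
  assert (Hq : q <= / (1 + y)).
  { unfold q. rewrite exp_Ropp. apply Rinv_le_contravar; [lra|].
    eapply Rle_trans; [|apply exp_ineq1_le]. nra. }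
  assert (Hq1 : q < 1).
  { eapply Rle_lt_trans; [exact Hq|]. rewrite <- Rinv_1. apply Rinv_lt_contravar; lra. }
  apply Rle_trans with (exp (- (PI * x)) * / (1 - q)).
  - rewrite <- Series_geom by (rewrite Rabs_pos_eq; lra).
    rewrite <- Series_scal_l. apply Series_le.
    + intros n. split; [left; apply exp_pos|].
      unfold q. rewrite exp_pow_INR, <- exp_plus. apply exp_le_compat.
      assert (1 + 3 * INR n <= INR (S n) ^ 2).
      { rewrite S_INR. destruct n as [|n]; [simpl; lra|].
        assert (1 <= INR (S n)) by (apply (le_INR 1); lia). nra. }
      assert (0 < PI * x) by nra. nra.
    + apply (ex_series_scal_l (V := R_NormedModule)). apply ex_series_geom.
      rewrite Rabs_pos_eq; lra.
  - apply Rmult_le_compat_l; [left; apply exp_pos|].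
    replace (1 + / y) with (/ (1 - / (1 + y))) by (field; lra).
    apply Rinv_le_contravar; [|lra].
    assert (/ (1 + y) < / 1) by (apply Rinv_lt_contravar; lra). rewrite Rinv_1 in *. lra.
Qed.

(** The function exp v - 1 - v governs the decay around the peak.  It is compared
    with v^2/2 for |v| <= 1/w, and bounded below by a multiple of |v| outside
    ([exp_remainder_lower_far]). *)
Lemma exp_remainder_lower_near v w : 1 <= w -> Rabs v <= / w ->
  v ^ 2 / 2 * (1 - / w) <= exp v - 1 - v.
Proof.
  intros Hw Hv. apply Rabs_le_between in Hv. assert (H := exp_ge_cubic v).
  assert (0 < / w) by (apply Rinv_0_lt_compat; lra).
  assert (0 <= v ^ 2 * (v / 6 + / w / 2)) by (apply Rmult_le_pos; nra). nra.
Qed.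

Lemma exp_remainder_lower_far v w : 1 <= w -> / w <= Rabs v ->
  Rabs v * / (6 * w) <= exp v - 1 - v.
Proof.
  intros Hw Hv. assert (H := exp_ge_cubic v).
  assert (Hiw : 0 < / w) by (apply Rinv_0_lt_compat; lra).
  replace (/ (6 * w)) with (/ w / 6) by (field; lra).
  destruct (Rle_dec 0 v) as [H0|H0].
  - rewrite Rabs_pos_eq in * by assumption. assert (H3 := pow_le v 3 H0). nra.
  - rewrite Rabs_left in * by lra. destruct (Rle_dec (-2) v) as [H2|H2].
    + assert (0 <= v ^ 2 * (2 + v)) by (apply Rmult_le_pos; nra). nra.
    + assert (He := exp_pos v).
      assert (/ w <= 1) by (rewrite <- Rinv_1; apply Rinv_le_contravar; lra). nra.
Qed.

Lemma exp_remainder_upper v : Rabs v <= / 2 ->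
  exp v - 1 - v <= v ^ 2 / 2 * (1 + Rabs v).
Proof.
  intros Hv. destruct (Rle_dec 0 v) as [H0|H0].
  - rewrite Rabs_pos_eq in * by assumption.
    assert (H := exp_ge_cubic (- v)).
    assert (Hd : 0 < 1 + - v + (- v) ^ 2 / 2 + (- v) ^ 3 / 6) by nra.
    assert (He := exp_pos v).
    assert (Hm : exp v * exp (- v) = 1) by (rewrite <- exp_plus, Rplus_opp_r; apply exp_0).
    apply Rmult_le_reg_r with (1 + - v + (- v) ^ 2 / 2 + (- v) ^ 3 / 6); [exact Hd|].
    assert (exp v * (1 + - v + (- v) ^ 2 / 2 + (- v) ^ 3 / 6) <= 1) by nra.
    assert (0 <= v ^ 3 * (/ 3 - 5 / 12 * v + v ^ 2 / 6 - v ^ 3 / 12)).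
    { apply Rmult_le_pos; [apply pow_le, H0|].
      nra. }
    nra.
  - rewrite Rabs_left in * by lra. assert (H := exp_le_quadratic_opp (- v) ltac:(lra)).
    rewrite Ropp_involutive in H. nra.
Qed.

Lemma one_plus_ge_exp t : Rabs t <= / 2 -> exp (t - t ^ 2) <= 1 + t.
Proof.
  intros Ht. destruct (Rle_dec 0 t) as [H0|H0].
  - rewrite Rabs_pos_eq in Ht by assumption.
    replace (t - t ^ 2) with (- - (t - t ^ 2)) by ring. rewrite exp_Ropp.
    assert (H := exp_ineq1_le (- (t - t ^ 2))).
    assert (Hd : 0 < 1 + - (t - t ^ 2)) by nra.
    apply Rle_trans with (/ (1 + - (t - t ^ 2))); [apply Rinv_le_contravar; lra|].
    apply Rmult_le_reg_r with (1 + - (t - t ^ 2)); [exact Hd|].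
    rewrite Rinv_l by lra. assert (0 <= t ^ 3) by (apply pow_le; lra). nra.
  - rewrite Rabs_left in Ht by lra. assert (H := one_minus_ge_exp (- t) ltac:(lra)).
    replace (- - t - (- t) ^ 2) with (t - t ^ 2) in H by ring. lra.
Qed.

(** The contribution of the first term of psi to y^M E(y). *)
Definition laplace_integrand (M : nat) (y : R) : R := y ^ M * exp (y / 4 - PI * exp y).

(** The value of the integrand at the saddle point w. *)
Definition peak (M : nat) (w : R) : R := w ^ M * exp (w / 4 - PI * exp w).

(** With y = w + v, the bound y <= w exp(v/w) and the saddle-point equation
    M + j = w lam cancel the linear term of the exponent up to
    (1/4 - j/w) v, leaving -lam (exp v - 1 - v).  A Gaussian dominates near the
    peak and a two-sided exponential far from it; their sum dominates
    everywhere, so that no splitting of the integral is needed. *)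
Lemma laplace_pointwise_upper w M (j : R) y : 4 <= w -> 0 <= j <= 4 -> 0 <= y ->
  INR M + j = w * (PI * exp w) ->
  laplace_integrand M y <= peak M w *
    (exp (/ w) * exp (- (PI * exp w * (1 - / w) / 2 * (y - w) ^ 2))
     + exp (- ((PI * exp w / (6 * w) - 1) * Rabs (y - w)))).
Proof.
  intros Hw Hj Hy HM. set (lam := PI * exp w) in *. set (v := y - w).
  assert (Hlam : 0 < lam) by (apply Rmult_lt_0_compat; [apply PI_RGT_0|apply exp_pos]).
  assert (Hiw : 0 < / w) by (apply Rinv_0_lt_compat; lra).
  set (c := / 4 - j / w).
  assert (Hjw : 0 <= j / w <= 1).
  { split; [apply Rdiv_le_0_compat; lra|]. apply Rle_div_l; lra. }
  assert (Hc : -1 <= c <= 1) by (unfold c; lra).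
  assert (Hcv : c * v <= Rabs v).
  { assert (H1 := Rle_abs v). assert (H2 := Rabs_maj2 v). nra. }
  assert (Hmain : laplace_integrand M y <= peak M w * exp (c * v - lam * (exp v - 1 - v))).
  { unfold laplace_integrand, peak. fold lam.
    apply Rle_trans with ((w * exp (v / w)) ^ M * exp (y / 4 - PI * exp y)).
    - apply Rmult_le_compat_r; [left; apply exp_pos|]. apply pow_incr. split; [exact Hy|].
      assert (H := exp_ineq1_le (v / w)).
      replace y with (w * (1 + v / w)) by (unfold v; field; lra).
      apply Rmult_le_compat_l; lra.
    - right. rewrite Rpow_mult_distr, exp_pow_INR, !Rmult_assoc, <- !exp_plus.
      f_equal. f_equal.
      replace y with (w + v) by (unfold v; ring). rewrite (exp_plus w v).
      replace (INR M) with (w * lam - j) by lra. unfold c.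
      unfold lam. field. lra. }
  eapply Rle_trans; [exact Hmain|].
  apply Rmult_le_compat_l.
  { apply Rmult_le_pos; [apply pow_le; lra|left; apply exp_pos]. }
  destruct (Rle_dec (Rabs v) (/ w)) as [Hn|Hn].
  - assert (H := exp_remainder_lower_near v w ltac:(lra) Hn).
    apply Rle_trans with (exp (/ w) * exp (- (lam * (1 - / w) / 2 * v ^ 2))).
    + rewrite <- exp_plus. apply exp_le_compat.
      assert (lam * (v ^ 2 / 2 * (1 - / w)) <= lam * (exp v - 1 - v))
        by (apply Rmult_le_compat_l; lra). lra.
    + assert (H' := exp_pos (- ((lam / (6 * w) - 1) * Rabs v))). lra.
  - assert (H := exp_remainder_lower_far v w ltac:(lra) ltac:(lra)).
    apply Rle_trans with (exp (- ((lam / (6 * w) - 1) * Rabs v))).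
    + apply exp_le_compat.
      assert (lam * (Rabs v * / (6 * w)) <= lam * (exp v - 1 - v))
        by (apply Rmult_le_compat_l; lra).
      replace (- ((lam / (6 * w) - 1) * Rabs v)) with (Rabs v - lam * (Rabs v * / (6 * w)))
        by (field; lra). lra.
    + assert (H' := exp_pos (- (lam * (1 - / w) / 2 * v ^ 2))).
      assert (H'' := exp_pos (/ w)). nra.
Qed.

(** With t = (y - w)/w, 1 + t >= exp(t - t^2); the quadratic loss
    in the exponent is lam v^2/w, a relative change O(1/w) of the Gaussian
    exponent lam v^2/2. *)
Lemma laplace_pointwise_lower w M (j : R) y : 4 <= w -> 0 <= j <= 3 -> Rabs (y - w) <= / w ->
  INR M + j = w * (PI * exp w) ->
  peak M w * (exp (- / w) * exp (- (PI * exp w * (1 + 4 / w) / 2 * (y - w) ^ 2))) <= laplace_integrand M y.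
Proof.
  intros Hw Hj Hy HM. set (lam := PI * exp w) in *. set (v := y - w) in *.
  assert (Hlam : 0 < lam) by (apply Rmult_lt_0_compat; [apply PI_RGT_0|apply exp_pos]).
  assert (Hiw : 0 < / w) by (apply Rinv_0_lt_compat; lra).
  assert (Hiw4 : / w <= / 4) by (apply Rinv_le_contravar; lra).
  assert (Hav := Rabs_pos v).
  assert (Habs : v ^ 2 = Rabs v ^ 2) by (symmetry; apply pow2_abs).
  set (t := v / w).
  assert (Ht : Rabs t <= / 2).
  { unfold t, Rdiv. rewrite Rabs_mult, (Rabs_pos_eq (/ w)) by lra. nra. }
  assert (H1 := one_plus_ge_exp t Ht).
  assert (H2 := exp_remainder_upper v ltac:(lra)).
  unfold laplace_integrand, peak. fold lam.
  assert (Hyw : y = w * (1 + t)) by (unfold t, v; field; lra).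
  apply Rle_trans with ((w * exp (t - t ^ 2)) ^ M * exp (y / 4 - PI * exp y)).
  - rewrite Rpow_mult_distr, exp_pow_INR, !Rmult_assoc, <- !exp_plus.
    apply Rmult_le_compat_l; [apply pow_le; lra|]. apply exp_le_compat.
    replace (PI * exp y) with (lam * exp v).
    2:{ unfold lam. rewrite Rmult_assoc, <- exp_plus. do 2 f_equal. unfold v; ring. }
    replace (INR M) with (w * lam - j) by lra.
    replace ((w * lam - j) * (t - t ^ 2)) with (lam * v - lam * v ^ 2 * / w - j * t + j * t ^ 2)
      by (unfold t; field; lra).
    replace (y / 4) with (w / 4 + v / 4) by (unfold v; field).
    assert (Hjt : j * t <= 3 / 4 * / w).
    { assert (Htw : t <= / 4 * / w).
      { unfold t, Rdiv. apply Rmult_le_compat_r; [lra|]. assert (H := Rle_abs v). lra. }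
      destruct (Rle_dec 0 t); nra. }
    assert (Hjt2 : 0 <= j * t ^ 2) by (apply Rmult_le_pos; [lra|apply pow2_ge_0]).
    assert (Hv4 : - (/ 4 * / w) <= v / 4) by (assert (H := Rabs_maj2 v); lra).
    assert (Hl : lam * (exp v - 1 - v) <= lam * (v ^ 2 / 2 * (1 + / w))).
    { apply Rmult_le_compat_l; [lra|]. eapply Rle_trans; [exact H2|].
      apply Rmult_le_compat_l; [|lra]. assert (H := pow2_ge_0 v). lra. }
    assert (Hl2 : 0 <= lam * v ^ 2 * / w).
    { apply Rmult_le_pos; [|lra]. apply Rmult_le_pos; [lra|apply pow2_ge_0]. }
    unfold Rdiv at 3. lra.
  - apply Rmult_le_compat_r; [left; apply exp_pos|]. apply pow_incr.
    split; [apply Rmult_le_pos; [lra|left; apply exp_pos]|].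
    rewrite Hyw. apply Rmult_le_compat_l; lra.
Qed.

Lemma RInt_shift (g : R -> R) w a b : (forall x, continuous g x) ->
  RInt (fun y => g (y - w)) a b = RInt g (a - w) (b - w).
Proof.
  intros Hg.
  assert (H := RInt_comp_lin g 1 (- w) a b (ex_RInt_cont _ _ _ Hg)).
  replace (1 * a + - w) with (a - w) in H by ring.
  replace (1 * b + - w) with (b - w) in H by ring.
  rewrite <- H. apply RInt_ext. intros y _.
  transitivity (1 * g (1 * y + - w)); [|reflexivity].
  rewrite Rmult_1_l. f_equal. ring.
Qed.

Lemma laplace_continuous M y : continuous (laplace_integrand M) y.
Proof. unfold laplace_integrand. cont_auto. Qed.

Lemma exp_le_one_plus_2 x : 0 <= x <= / 2 -> exp x <= 1 + 2 * x.
Proof.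
  intros Hx. assert (H := exp_remainder_upper x).
  rewrite Rabs_pos_eq in H by lra. specialize (H ltac:(lra)). nra.
Qed.

Lemma peak_pos M w : 0 < w -> 0 < peak M w.
Proof. intros Hw. apply Rmult_lt_0_compat; [apply pow_lt, Hw|apply exp_pos]. Qed.

(** The Gaussian integral sqrt(2 pi/lam) with lam = pi exp w. *)
Definition gauss_width (w : R) : R := sqrt (2 * PI / (PI * exp w)).

Lemma gauss_width_pos w : 0 < gauss_width w.
Proof.
  apply sqrt_lt_R0. assert (H := PI_RGT_0). assert (He := exp_pos w).
  apply Rdiv_lt_0_compat; [lra|nra].
Qed.

Lemma gauss_width_rescale w k : 0 < k ->
  sqrt PI / sqrt (PI * exp w * k / 2) = gauss_width w / sqrt k.
Proof.
  intros Hk. assert (H := PI_RGT_0). assert (He := exp_pos w).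
  assert (Hl : 0 < PI * exp w) by nra. set (lam := PI * exp w) in *.
  unfold gauss_width. fold lam.
  rewrite <- !sqrt_div_alt by nra. f_equal. field. lra.
Qed.

(** Exponential size of lam against powers of w: the tails, of order
    w/lam, are below the accuracy 1/w relative to 1/sqrt lam. *)
Lemma tail_le_gauss_width w : 1 <= w -> 144 * w ^ 4 <= PI * exp w ->
  24 * w / (PI * exp w) <= gauss_width w * / w.
Proof.
  intros Hw Hbig. assert (HP := PI2_1). assert (He := exp_pos w).
  assert (Hl : 0 < PI * exp w) by nra. set (lam := PI * exp w) in *.
  unfold gauss_width. fold lam.
  assert (Hiw : 0 < / w) by (apply Rinv_0_lt_compat; lra).
  assert (Hil : 0 < / lam) by (apply Rinv_0_lt_compat; lra).
  apply Rmult_le_reg_r with w; [lra|].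
  rewrite (Rmult_assoc _ (/ w)), Rinv_l, Rmult_1_r by lra.
  rewrite <- (sqrt_pow2 (24 * w / lam * w)).
  - apply sqrt_le_1_alt.
    replace ((24 * w / lam * w) ^ 2) with (4 * (144 * w ^ 4 * / lam) * / lam) by (field; lra).
    replace (2 * PI / lam) with (2 * PI * / lam) by reflexivity.
    apply Rmult_le_compat_r; [lra|].
    assert (144 * w ^ 4 * / lam <= 1).
    { apply (Rmult_le_reg_r lam); [exact Hl|]. rewrite Rmult_assoc, Rinv_l by lra. lra. }
    lra.
  - apply Rmult_le_pos; [|lra]. apply Rdiv_le_0_compat; lra.
Qed.

(** Integrate [laplace_pointwise_upper]. *)
Lemma laplace_integral_upper w M (j k : R) : 8 <= w -> 144 * w ^ 4 <= PI * exp w ->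
  0 <= j <= 4 -> INR M + j = w * (PI * exp w) -> 0 <= k ->
  RInt (laplace_integrand M) 0 k <= peak M w * (gauss_width w * (1 + 6 * / w)).
Proof.
  intros Hw Hbig Hj HM Hk. assert (HP := PI2_1). assert (He := exp_pos w).
  assert (Hl : 0 < PI * exp w) by nra.
  assert (Htail := tail_le_gauss_width w ltac:(lra) Hbig).
  assert (HwG := gauss_width_rescale w (1 - / w)).
  assert (Hpt := laplace_pointwise_upper w M j).
  set (lam := PI * exp w) in *.
  assert (Hiw : 0 < / w) by (apply Rinv_0_lt_compat; lra).
  assert (Hiw8 : / w <= / 8) by (apply Rinv_le_contravar; lra).
  set (mu := lam / (6 * w) - 1) in *.
  assert (Hmu : lam / (12 * w) <= mu).
  { unfold mu. replace (lam / (6 * w)) with (lam / (12 * w) + lam / (12 * w)) by (field; lra).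
    assert (1 <= lam / (12 * w)); [|lra]. apply Rle_div_r; [lra|].
    assert (w <= w ^ 4) by (replace w with (w ^ 1) at 1 by ring; apply Rle_pow; [lra|lia]). lra. }
  assert (Hmu0 : 0 < mu) by (eapply Rlt_le_trans; [|exact Hmu]; apply Rdiv_lt_0_compat; lra).
  set (a := lam * (1 - / w) / 2) in *.
  assert (Ha : 0 < a) by (unfold a; apply Rdiv_lt_0_compat; [apply Rmult_lt_0_compat; lra|lra]).
  set (g1 := fun v => exp (- (a * v ^ 2))). set (g2 := fun v => exp (- (mu * Rabs v))).
  assert (C1 : forall v, continuous g1 v) by (intros; unfold g1; cont_auto).
  assert (C2 : forall v, continuous g2 v).
  { intros v. apply (continuous_comp (fun v => Rabs v) (fun u => exp (- (mu * u)))); [|cont_auto].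
    apply continuous_Rabs. }
  set (g := fun v => plus (scal (exp (/ w)) (g1 v)) (g2 v)).
  assert (Cg : forall v, continuous g v).
  { intros v. apply (continuous_plus (V := R_NormedModule)); [|apply C2].
    apply (continuous_scal_r (V := R_NormedModule)), C1. }
  apply Rle_trans with (RInt (fun y => scal (peak M w) (g (y - w))) 0 k).
  - apply RInt_le; [exact Hk|apply ex_RInt_cont, laplace_continuous| |].
    + apply ex_RInt_cont. intros y. apply (continuous_scal_r (V := R_NormedModule)).
      apply (continuous_comp (fun y => y - w) g); [cont_auto|apply Cg].
    + intros y Hy. apply Hpt; lra.
  - rewrite (RInt_scal (V := R_CompleteNormedModule)).
    2:{ apply ex_RInt_cont. intros y.
        apply (continuous_comp (fun y => y - w) g); [cont_auto|apply Cg]. }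
    rewrite RInt_shift by exact Cg.
    apply Rmult_le_compat_l; [left; apply peak_pos; lra|].
    unfold g. rewrite (RInt_plus (V := R_CompleteNormedModule)).
    2:{ apply ex_RInt_cont. intros v. apply (continuous_scal_r (V := R_NormedModule)), C1. }
    2:{ apply ex_RInt_cont, C2. }
    rewrite (RInt_scal (V := R_CompleteNormedModule)) by (apply ex_RInt_cont, C1).
    assert (G1 := gauss_upper a (0 - w) (k - w) Ha). fold g1 in G1.
    assert (G2 := exp_abs_upper mu (0 - w) (k - w) Hmu0 ltac:(lra)). fold g2 in G2.
    rewrite HwG in G1 by lra.
    assert (Hs := gauss_width_pos w).
    assert (Hk1 : gauss_width w / sqrt (1 - / w) <= gauss_width w * (1 + 2 * / w)).
    { apply Rmult_le_compat_l; [lra|].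
      assert (Hsq : 1 - / w <= sqrt (1 - / w)).
      { rewrite <- (sqrt_square (1 - / w)) at 1 by lra. apply sqrt_le_1_alt. nra. }
      apply Rle_trans with (/ (1 - / w)); [apply Rinv_le_contravar; lra|].
      apply Rmult_le_reg_r with (1 - / w); [lra|]. rewrite Rinv_l by lra. nra. }
    assert (Hk2 : 2 / mu <= gauss_width w * / w).
    { eapply Rle_trans; [|exact Htail].
      replace (24 * w / lam) with (2 / (lam / (12 * w))) by (field; lra).
      apply Rmult_le_compat_l; [lra|]. apply Rinv_le_contravar; [|exact Hmu].
      apply Rdiv_lt_0_compat; lra. }
    assert (Hex := exp_le_one_plus_2 (/ w) ltac:(lra)).
    assert (Hg0 : 0 <= RInt g1 (0 - w) (k - w)).
    { apply RInt_ge_0; [lra|apply ex_RInt_cont, C1|intros; left; apply exp_pos]. }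
    unfold plus, scal; simpl; unfold mult; simpl.
    apply Rle_trans with ((1 + 2 * / w) * (gauss_width w * (1 + 2 * / w)) + gauss_width w * / w).
    + apply Rplus_le_compat; [|lra].
      apply Rmult_le_compat; [left; apply exp_pos|exact Hg0|exact Hex|lra].
    + set (x := / w) in *. assert (0 <= gauss_width w * (x * (1 - 4 * x))) by (apply Rmult_le_pos; nra).
      nra.
Qed.

(** Laplace's method with relative error 8/w.  The lower bound keeps only the
    window |y - w| <= 1/w and the first term of psi; the upper bound adds the
    integrals for the powers M and M - 1, according to [psi_upper]. *)
Lemma moment_bounds w M (j : R) : 8 <= w -> 144 * w ^ 4 <= PI * exp w ->
  0 <= j <= 3 -> INR M + j = w * (PI * exp w) -> (1 <= M)%nat ->
  is_lim_seq (fun k => RInt (fun y => y ^ M * theta_density y) 0 (INR k)) (moment M) ->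
  peak M w * gauss_width w * (1 - 8 * / w) <= moment M <= peak M w * gauss_width w * (1 + 8 * / w).
Proof.
  intros Hw Hbig Hj HM HM1 Hlim.
  assert (HP := PI2_1). assert (He := exp_pos w).
  assert (Hl : 0 < PI * exp w) by nra.
  assert (Hiw : 0 < / w) by (apply Rinv_0_lt_compat; lra).
  assert (Hiw8 : / w <= / 8) by (apply Rinv_le_contravar; lra).
  assert (Hs := gauss_width_pos w). assert (Hpk := peak_pos M w ltac:(lra)).
  assert (Hps : 0 < peak M w * gauss_width w) by (apply Rmult_lt_0_compat; assumption).
  assert (Hinc : forall k, RInt (fun y => y ^ M * theta_density y) 0 (INR k) <=
                           RInt (fun y => y ^ M * theta_density y) 0 (INR (S k))).
  { intros k. assert (Hk := pos_INR k).
    apply RInt_mono_interval; try (rewrite ?S_INR; lra).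
    - apply pow_theta_density_continuous.
    - intros y Hy. apply Rmult_le_pos; [apply pow_le; lra|apply theta_density_nonneg]. }
  assert (Hle := is_lim_seq_incr_compare _ _ Hlim Hinc).
  split.
  - destruct (eventually_INR_ge (w + / w)) as [k Hk]. specialize (Hk k (Nat.le_refl k)).
    eapply Rle_trans; [|apply (Hle k)].
    apply Rle_trans with (RInt (fun y => y ^ M * theta_density y) (w - / w) (w + / w)).
    2:{ apply RInt_mono_interval; try lra.
        - apply pow_theta_density_continuous.
        - intros y Hy. apply Rmult_le_pos; [apply pow_le; lra|apply theta_density_nonneg]. }
    set (a := PI * exp w * (1 + 4 / w) / 2).
    assert (H4w : 4 / w = 4 * / w) by reflexivity.
    assert (Ha : PI * exp w / 2 <= a) by (unfold a; rewrite H4w; nra).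
    assert (Ha0 : 0 < a) by lra.
    set (g := fun v => exp (- (a * v ^ 2))).
    assert (Cg : forall v, continuous g v) by (intros; unfold g; cont_auto).
    apply Rle_trans with (RInt (fun y => scal (peak M w * exp (- / w)) (g (y - w))) (w - / w) (w + / w)).
    + rewrite (RInt_scal (V := R_CompleteNormedModule)).
      2:{ apply ex_RInt_cont. intros y.
          apply (continuous_comp (fun y => y - w) g); [cont_auto|apply Cg]. }
      rewrite RInt_shift by exact Cg.
      replace (w - / w - w) with (- / w) by ring. replace (w + / w - w) with (/ w) by ring.
      assert (Hap : 2 <= sqrt a * / w).
      { apply Rle_trans with (sqrt ((2 * w) ^ 2) * / w).
        - rewrite sqrt_pow2 by lra. right. field. lra.
        - apply Rmult_le_compat_r; [lra|]. apply sqrt_le_1_alt.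
          assert (w ^ 2 <= w ^ 4) by (apply Rle_pow; [lra|lia]). nra. }
      assert (G := gauss_lower a (/ w) Ha0 Hiw Hap). fold g in G.
      unfold a in G at 1. rewrite gauss_width_rescale in G by (rewrite H4w; lra).
      assert (Htail := tail_le_gauss_width w ltac:(lra) Hbig).
      assert (G1 : 2 / (a * / w) <= gauss_width w * / w).
      { eapply Rle_trans; [|exact Htail].
        replace (2 / (a * / w)) with (2 * w * / a) by (field; lra).
        apply Rle_trans with (2 * w * / (PI * exp w / 2)).
        - apply Rmult_le_compat_l; [lra|]. apply Rinv_le_contravar; lra.
        - replace (2 * w * / (PI * exp w / 2)) with (4 * w * / (PI * exp w)) by (field; lra).
          unfold Rdiv. apply Rmult_le_compat_r; [left; apply Rinv_0_lt_compat, Hl|lra]. }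
      assert (G2 : gauss_width w * (1 - 2 * / w) <= gauss_width w / sqrt (1 + 4 / w)).
      { apply Rmult_le_compat_l; [lra|]. rewrite H4w. set (x := / w) in *.
        assert (Hsq : 0 < sqrt (1 + 4 * x)) by (apply sqrt_lt_R0; lra).
        apply Rmult_le_reg_r with (sqrt (1 + 4 * x)); [exact Hsq|]. rewrite Rinv_l by lra.
        rewrite <- (sqrt_pow2 (1 - 2 * x)) by lra. rewrite <- sqrt_mult by nra.
        apply Rle_trans with (sqrt 1); [apply sqrt_le_1_alt; nra|rewrite sqrt_1; lra]. }
      assert (G3 : 1 - / w <= exp (- / w)) by (assert (H := exp_ineq1_le (- / w)); lra).
      change (peak M w * gauss_width w * (1 - 8 * / w) <= (peak M w * exp (- / w)) * RInt g (- / w) (/ w)).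
      rewrite !Rmult_assoc. apply Rmult_le_compat_l; [lra|].
      apply Rle_trans with ((1 - / w) * (gauss_width w * (1 - 3 * / w))).
      * set (x := / w) in *. nra.
      * apply Rmult_le_compat; try lra. apply Rmult_le_pos; lra.
    + apply RInt_le; [lra| |apply ex_RInt_cont, pow_theta_density_continuous|].
      * apply ex_RInt_cont. intros y. apply (continuous_scal_r (V := R_NormedModule)).
        apply (continuous_comp (fun y => y - w) g); [cont_auto|apply Cg].
      * intros y Hy. apply Rle_trans with (laplace_integrand M y).
        -- assert (H := laplace_pointwise_lower w M j y ltac:(lra) Hj
              ltac:(apply Rabs_le_between; lra) HM).
           unfold scal; simpl; unfold mult; simpl. rewrite Rmult_assoc. exact H.
        -- unfold laplace_integrand, theta_density. apply Rmult_le_compat_l; [apply pow_le; lra|].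
           unfold Rminus. rewrite exp_plus. apply Rmult_le_compat_l; [left; apply exp_pos|].
           apply psi_lower, exp_pos.
  - destruct M as [|M']; [lia|].
    assert (Hpk' : peak M' w = peak (S M') w * / w) by (unfold peak; simpl; field; lra).
    apply (is_lim_seq_le _ (fun _ => peak (S M') w * gauss_width w * (1 + 8 * / w)) _ _) with (2 := Hlim)
      (3 := is_lim_seq_const _).
    intros k. assert (Hk := pos_INR k).
    apply Rle_trans with (RInt (fun y => plus (laplace_integrand (S M') y) (laplace_integrand M' y)) 0 (INR k)).
    + apply RInt_le; [exact Hk|apply ex_RInt_cont, pow_theta_density_continuous| |].
      * apply ex_RInt_cont. intros y.
        apply (continuous_plus (V := R_NormedModule)); apply laplace_continuous.
      * intros y Hy. unfold laplace_integrand, theta_density, plus; simpl.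
        assert (H := psi_upper (exp y) y ltac:(assert (H := exp_ineq1_le y); lra)).
        unfold Rminus. rewrite !exp_plus.
        assert (Hy0 : 0 <= y * y ^ M' * exp (y / 4)).
        { apply Rmult_le_pos; [|left; apply exp_pos]. apply Rmult_le_pos; [lra|apply pow_le; lra]. }
        apply Rmult_le_compat_l with (r := y * y ^ M' * exp (y / 4)) in H; [|exact Hy0].
        eapply Rle_trans; [|eapply Rle_trans; [exact H|]]; right; [ring|field; lra].
    + rewrite (RInt_plus (V := R_CompleteNormedModule)) by (apply ex_RInt_cont, laplace_continuous).
      assert (U1 := laplace_integral_upper w (S M') j (INR k) Hw Hbig ltac:(lra) HM Hk).
      assert (U2 := laplace_integral_upper w M' (j + 1) (INR k) Hw Hbig ltac:(lra)
                      ltac:(rewrite S_INR in HM; lra) Hk).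
      rewrite Hpk' in U2. unfold plus; simpl.
      eapply Rle_trans; [apply Rplus_le_compat; [exact U1|exact U2]|].
      set (x := / w) in *.
      replace (peak (S M') w * (gauss_width w * (1 + 6 * x)) + peak (S M') w * x * (gauss_width w * (1 + 6 * x)))
        with (peak (S M') w * gauss_width w * ((1 + x) * (1 + 6 * x))) by ring.
      apply Rmult_le_compat_l; [lra|]. nra.
Qed.

(** * Identity theorem for entire power series *)

Lemma sum_n_fst (a : nat -> C) N :
  fst (sum_n (G := C_NormedModule) a N) = sum_n (fun n => fst (a n)) N.
Proof.
  induction N as [|N IH]; [rewrite !sum_O; reflexivity|].
  rewrite !sum_Sn, <- IH. reflexivity.
Qed.

Lemma sum_n_snd (a : nat -> C) N :
  snd (sum_n (G := C_NormedModule) a N) = sum_n (fun n => snd (a n)) N.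
Proof.
  induction N as [|N IH]; [rewrite !sum_O; reflexivity|].
  rewrite !sum_Sn, <- IH. reflexivity.
Qed.

Lemma is_series_C_components (a : nat -> C) (l : C) :
  is_series (V := C_NormedModule) a l ->
  is_series (fun n => fst (a n)) (fst l) /\ is_series (fun n => snd (a n)) (snd l).
Proof.
  intros H. split.
  - apply filterlim_ext with (fun N => fst (sum_n (G := C_NormedModule) a N)).
    + apply sum_n_fst.
    + apply (filterlim_comp _ _ _ _ _ _ _ _ H).
      intros P HP.
      destruct l as [x y].
      exact (continuous_fst (U := R_UniformSpace) (V := R_UniformSpace) x y P HP).
  - apply filterlim_ext with (fun N => snd (sum_n (G := C_NormedModule) a N)).
    + apply sum_n_snd.
    + apply (filterlim_comp _ _ _ _ _ _ _ _ H).
      intros P HP.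
      destruct l as [x y].
      exact (continuous_snd (U := R_UniformSpace) (V := R_UniformSpace) x y P HP).
Qed.

Lemma pow_n_RtoC (t : R) n : pow_n (K := C_AbsRing) (RtoC t) n = RtoC (t ^ n).
Proof.
  induction n as [|n IH]; [reflexivity|].
  change (Cmult (RtoC t) (pow_n (K := C_AbsRing) (RtoC t) n) = RtoC (t * t ^ n)).
  rewrite IH. symmetry. apply RtoC_mult.
Qed.

Lemma is_pseries_C_components (a : nat -> C) (t : R) (l : C) :
  is_pseries (V := C_NormedModule) a (RtoC t) l ->
  is_pseries (fun n => fst (a n)) t (fst l) /\ is_pseries (fun n => snd (a n)) t (snd l).
Proof.
  intros H. apply is_series_C_components in H. destruct H as [H1 H2].
  split; apply is_pseries_R.
  - apply is_series_ext with (2 := H1). intros n.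
    change (fst (Cmult (pow_n (K := C_AbsRing) (RtoC t) n) (a n)) = fst (a n) * t ^ n).
    rewrite pow_n_RtoC. simpl. ring.
  - apply is_series_ext with (2 := H2). intros n.
    change (snd (Cmult (pow_n (K := C_AbsRing) (RtoC t) n) (a n)) = snd (a n) * t ^ n).
    rewrite pow_n_RtoC. simpl. ring.
Qed.

(** A finite radius r would contradict convergence at r + 1. *)
Lemma CV_radius_entire (d : nat -> R) :
  (forall t, / 2 < t -> ex_pseries d t) -> CV_radius d = p_infty.
Proof.
  intros H. assert (Hge := CV_radius_ge_0 d).
  destruct (CV_radius d) as [r| |] eqn:E; [|reflexivity|contradiction].
  exfalso. simpl in Hge.
  apply (CV_disk_outside d (r + 1)).
  - rewrite E. simpl. rewrite Rabs_pos_eq by lra. lra.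
  - apply ex_series_lim_0. apply ex_pseries_R, H. lra.
Qed.

Lemma term_le_sum_f_R0 (u : nat -> R) k N :
  (forall i, 0 <= u i) -> (k <= N)%nat -> u k <= sum_f_R0 u N.
Proof.
  intros Hu HkN. rewrite <- sum_n_Reals. induction HkN as [|N HkN IH].
  - apply term_le_sum_n, Hu.
  - rewrite sum_Sn. unfold plus; simpl. specialize (Hu (S N)). lra.
Qed.

Lemma binomial_term_le (a b : R) k n : 0 <= a -> 0 <= b ->
  INR (fact (k + n)) / INR (fact k) / INR (fact n) * a ^ k * b ^ n <= (a + b) ^ (k + n).
Proof.
  intros Ha Hb. rewrite binomial.
  assert (Hpos : forall i, 0 <= Binomial.C (k + n) i * a ^ i * b ^ (k + n - i)).
  { intros i. apply Rmult_le_pos; [apply Rmult_le_pos|]; try (apply pow_le; assumption).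
    unfold Binomial.C. apply Rdiv_le_0_compat; [apply pos_INR|].
    apply Rmult_lt_0_compat; apply INR_fact_lt_0. }
  assert (Ht : Binomial.C (k + n) k * a ^ k * b ^ (k + n - k)
      <= sum_f_R0 (fun i => Binomial.C (k + n) i * a ^ i * b ^ (k + n - i)) (k + n)).
  { apply (term_le_sum_f_R0 (fun i => Binomial.C (k + n) i * a ^ i * b ^ (k + n - i)));
      [exact Hpos|lia]. }
  eapply Rle_trans; [|exact Ht]. right. unfold Binomial.C.
  replace (k + n - k)%nat with n by lia. field.
  split; apply INR_fact_neq_0.
Qed.

(** Taylor's formula at -1, where all derivatives vanish: the n-th Lagrange
    remainder at y is bounded, through the binomial theorem, by the tail after n
    of the series of |d_k| 3^k, where 3 = 1 + 2 bounds |zeta| + (y + 1). *)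
Lemma entire_vanish_interval (d : nat -> R) : (forall t, ex_pseries d t) ->
  (forall t, t < - / 2 -> PSeries d t = 0) ->
  forall y, -1 < y < 1 -> PSeries d y = 0.
Proof.
  intros Hd H0 y Hy. set (f := PSeries d).
  assert (HR := CV_radius_entire d (fun t _ => Hd t)).
  assert (Hcv : forall x : R, Rbar_lt (Rabs x) (CV_radius d)) by (intros; rewrite HR; exact I).
  set (b := fun n => Rabs (d n * 3 ^ n)).
  assert (Hb : ex_series b) by (apply CV_disk_inside, Hcv).
  assert (HD0 : forall m, Derive_n f m (-1) = 0).
  { intros m. rewrite (Derive_n_ext_loc f (fun _ => 0)).
    - destruct m; [reflexivity|]. apply Derive_n_const.
    - assert (He : 0 < / 2) by lra. exists (mkposreal _ He). intros x Hx.
      apply H0. unfold ball in Hx; simpl in Hx.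
      unfold AbsRing_ball, abs, minus, plus, opp in Hx; simpl in Hx.
      apply Rabs_def2 in Hx. lra. }
  apply Rabs_eq_0. apply Rle_antisym; [|apply Rabs_pos].
  apply Rnot_lt_le. intros Hpos. fold f in Hpos.
  destruct (series_remainder_small b (mkposreal _ Hpos) Hb) as [N HN].
  specialize (HN N (Nat.le_refl N)). simpl in HN.
  destruct (Taylor_Lagrange f N (-1) y) as [zeta [Hz Heq]]; [lra| |].
  { intros t _ k _. apply ex_derive_n_PSeries, Hcv. }
  rewrite sum_eq_R0 in Heq.
  2:{ intros n _. rewrite HD0. ring. }
  rewrite Rplus_0_l in Heq. unfold f in Heq at 2. rewrite Derive_n_PSeries in Heq by apply Hcv.
  apply (Rlt_irrefl (Rabs (f y))). eapply Rle_lt_trans; [|exact HN].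
  rewrite Heq. unfold PSeries. rewrite <- Series_scal_l.
  set (u := fun k => (y - -1) ^ S N / INR (fact (S N)) * (PS_derive_n (S N) d k * zeta ^ k)).
  assert (Hu : forall k, Rabs (u k) <= b (S N + k)%nat).
  { intros k. unfold u, PS_derive_n, b. rewrite (Nat.add_comm (S N) k).
    assert (F1 := INR_fact_lt_0 (S N)). assert (F2 := INR_fact_lt_0 k).
    assert (F3 := INR_fact_lt_0 (k + S N)).
    replace ((y - -1) ^ S N / INR (fact (S N)) *
       (INR (fact (k + S N)) / INR (fact k) * d (k + S N)%nat * zeta ^ k))
     with (d (k + S N)%nat *
       (INR (fact (k + S N)) / INR (fact k) / INR (fact (S N)) * zeta ^ k * (y - -1) ^ S N))
     by (field; lra).
    rewrite !Rabs_mult. apply Rmult_le_compat_l; [apply Rabs_pos|].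
    rewrite <- !RPow_abs.
    assert (Hc : 0 <= INR (fact (k + S N)) / INR (fact k) / INR (fact (S N)))
      by (apply Rdiv_le_0_compat; [apply Rdiv_le_0_compat; lra|lra]).
    rewrite (Rabs_pos_eq _ Hc), (Rabs_pos_eq (y - -1)), (Rabs_pos_eq 3) by lra.
    eapply Rle_trans; [apply binomial_term_le; [apply Rabs_pos|lra]|].
    assert (Hz1 : Rabs zeta <= 1) by (apply Rabs_le; lra).
    assert (Hz0 := Rabs_pos zeta).
    apply pow_incr. lra. }
  assert (Hbs : ex_series (fun k => b (S N + k)%nat)) by (apply (ex_series_incr_n b (S N)), Hb).
  assert (Hua : ex_series (fun k => Rabs (u k))).
  { apply (ex_series_le (V := R_CompleteNormedModule)) with (2 := Hbs).
    intros k. unfold norm; simpl; unfold abs; simpl. rewrite Rabs_Rabsolu. apply Hu. }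
  eapply Rle_trans; [apply Series_Rabs, Hua|].
  eapply Rle_trans; [apply Series_le; [|exact Hbs]; intros k; split; [apply Rabs_pos|apply Hu]|].
  rewrite (Series_incr_n b (S N)) by (try lia; exact Hb). cbn [pred].
  rewrite sum_n_Reals. lra.
Qed.

Lemma is_series_zero : is_series (fun _ : nat => 0) 0.
Proof.
  apply filterlim_ext with (fun _ => 0).
  - intros N. rewrite sum_n_const. ring.
  - apply filterlim_const.
Qed.

(** Reflect t -> -t to use [entire_vanish_interval], then apply uniqueness of
    coefficients near 0. *)
Lemma entire_identity (d : nat -> R) : (forall t, ex_pseries d t) ->
  (forall t, / 2 < t -> PSeries d t = 0) -> forall n, d n = 0.
Proof.
  intros Hd H0. set (d' := fun n => (-1) ^ n * d n).
  assert (Hps : forall t l, is_pseries d t l -> is_pseries d' (- t) l).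
  { intros t l H. apply is_pseries_R in H. apply is_pseries_R.
    eapply is_series_ext; [|exact H]. intros n. unfold d'. simpl.
    replace (- t) with (-1 * t) by ring. rewrite Rpow_mult_distr.
    replace ((-1) ^ n * d n * ((-1) ^ n * t ^ n)) with (((-1) ^ n * (-1) ^ n) * (d n * t ^ n)) by ring.
    rewrite <- Rpow_mult_distr. replace (-1 * -1) with 1 by ring. rewrite pow1. ring. }
  assert (Hd' : forall t, is_pseries d' t (PSeries d (- t))).
  { intros t. replace t with (- - t) at 1 by ring. apply Hps, PSeries_correct, Hd. }
  assert (Hex : forall t, ex_pseries d' t) by (intros t; eexists; apply Hd').
  assert (Hv : forall y, -1 < y < 1 -> PSeries d' y = 0).
  { apply entire_vanish_interval; [exact Hex|].
    intros t Ht. rewrite (is_pseries_unique _ _ _ (Hd' t)). apply H0. lra. }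
  intros n.
  assert (Hn : d' n = (fun _ : nat => 0) n).
  { assert (Hz : forall t, is_pseries (fun _ : nat => 0) t 0).
    { intros t. apply is_pseries_R. apply is_series_ext with (fun _ => 0); [intros; simpl; ring|].
      apply is_series_zero. }
    apply (PSeries_ext_recip d' (fun _ => 0) n).
    - rewrite CV_radius_entire by (intros; apply Hex). exact I.
    - rewrite CV_radius_entire; [exact I|]. intros t _; eexists; apply Hz.
    - assert (He : 0 < 1) by lra. exists (mkposreal _ He). intros y Hy.
      rewrite (is_pseries_unique _ _ _ (Hz y)). apply Hv.
      unfold ball in Hy; simpl in Hy. unfold AbsRing_ball, abs, minus, plus, opp in Hy; simpl in Hy.
      apply Rabs_def2 in Hy. lra. }
  unfold d' in Hn. simpl in Hn.
  assert (Hs : (-1) ^ n <> 0) by (apply pow_nonzero; lra).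
  apply Rmult_integral in Hn. tauto.
Qed.

(** * The xi function on a real half-line and its Taylor coefficients *)

Lemma rcpow_RtoC x r : rcpow x (RtoC r) = RtoC (exp (r * ln x)).
Proof.
  unfold rcpow. rewrite <- RtoC_mult. unfold cexp, RtoC; simpl.
  rewrite cos_0, sin_0. f_equal; ring.
Qed.

(** Specialize the two-sided limit of an improper integral on (0, oo) to the
    intervals [c exp(-k), c exp k], which correspond to [-k, k] in the
    logarithmic variable. *)
Lemma is_RInt_gen_geometric (F : R -> C) (l : C) (c : R) (eps : posreal) : 0 < c ->
  is_RInt_gen (V := C_R_NormedModule) F (at_right 0) (Rbar_locally p_infty) l ->
  eventually (fun k => exists y : C,
    is_RInt (V := C_R_NormedModule) F (c * exp (- INR k)) (c * exp (INR k)) y /\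
    Rabs (fst y - fst l) < eps /\ Rabs (snd y - snd l) < eps).
Proof.
  intros Hc H.
  destruct (H (ball (l : C_R_NormedModule) eps) (locally_ball _ eps)) as [Q R0 HQ HR HQR].
  destruct HQ as [del Hdel]. destruct HR as [M HM].
  assert (Ha : is_lim_seq (fun k => c * exp (- (1 * INR k))) (c * 0)).
  { apply is_lim_seq_mult'; [apply is_lim_seq_const|apply is_lim_seq_exp_opp; lra]. }
  apply is_lim_seq_eventually with (a := -1) (b := del) in Ha.
  2:{ assert (Hd := cond_pos del). lra. }
  destruct (eventually_and _ _ Ha (eventually_INR_ge (M / c))) as [k0 Hk0].
  exists k0. intros k Hk. destruct (Hk0 k Hk) as [H1 H2].
  rewrite Rmult_1_l in H1.
  destruct (HQR (c * exp (- INR k)) (c * exp (INR k))) as [y [Hy1 Hy2]].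
  - apply Hdel.
    + assert (He := exp_pos (- INR k)).
      unfold ball; simpl; unfold AbsRing_ball, abs, minus, plus, opp; simpl.
      apply Rabs_def1; nra.
    + apply Rmult_lt_0_compat; [exact Hc|apply exp_pos].
  - apply HM. assert (He := exp_ineq1_le (INR k)).
    apply Rle_lt_trans with (c * INR k).
    + replace M with (c * (M / c)) by (field; lra). apply Rmult_le_compat_l; lra.
    + apply Rmult_lt_compat_l; lra.
  - exists y. split; [exact Hy1|]. destruct Hy2 as [Hy2 Hy3]. split; [exact Hy2|exact Hy3].
Qed.

Lemma exp_substitution sigma c k : 0 < c ->
  RInt (fun y => exp (sigma * y - c * exp y)) (- INR k) (INR k)
  = exp (- sigma * ln c)
    * RInt (fun t => exp ((sigma - 1) * ln t - t)) (c * exp (- INR k)) (c * exp (INR k)).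
Proof.
  intros Hc.
  assert (Hpos : forall y, 0 < c * exp y) by (intros; apply Rmult_lt_0_compat; [lra|apply exp_pos]).
  assert (H : is_RInt (fun y => scal (c * exp y)
             ((fun t => exp ((sigma - 1) * ln t - t)) (c * exp y))) (- INR k) (INR k)
       (RInt (fun t => exp ((sigma - 1) * ln t - t)) (c * exp (- INR k)) (c * exp (INR k)))).
  { apply (is_RInt_comp (V := R_CompleteNormedModule) (fun t => exp ((sigma - 1) * ln t - t))
      (fun y => c * exp y) (fun y => c * exp y)).
    - intros y _. apply (ex_derive_continuous (V := R_NormedModule)). auto_derive.
      apply Hpos.
    - intros y _. split; [auto_derive; [trivial|ring]|cont_auto]. }
  apply (is_RInt_unique (V := R_CompleteNormedModule)) in H. rewrite <- H.
  assert (Hcont : ex_RInt (fun y => exp (sigma * y - c * exp y)) (- INR k) (INR k))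
    by (apply ex_RInt_cont; intros; cont_auto).
  rewrite (RInt_ext (fun y => scal (c * exp y) (exp ((sigma - 1) * ln (c * exp y) - c * exp y)))
     (fun y => scal (exp (sigma * ln c)) (exp (sigma * y - c * exp y)))).
  - rewrite (RInt_scal (V := R_CompleteNormedModule)) by exact Hcont.
    transitivity (exp (- sigma * ln c) * exp (sigma * ln c)
       * RInt (fun y => exp (sigma * y - c * exp y)) (- INR k) (INR k)).
    + rewrite <- exp_plus. replace (- sigma * ln c + sigma * ln c) with 0 by ring.
      rewrite exp_0. symmetry. apply Rmult_1_l.
    + apply Rmult_assoc.
  - intros y _. unfold scal; simpl; unfold mult; simpl.
    rewrite ln_mult, ln_exp by (try lra; apply exp_pos).
    rewrite <- (exp_ln c) at 1 by lra. rewrite <- !exp_plus. f_equal. ring.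
Qed.

(** The limit is Gamma(sigma) c^(-sigma), by the substitution t = c exp y. *)
Lemma Gamma_real Gamma sigma : is_Gamma Gamma -> 0 < sigma ->
  exists g, Gamma (RtoC sigma) = RtoC g /\
  forall c, 0 < c ->
     is_lim_seq (fun k => RInt (fun y => exp (sigma * y - c * exp y)) (- INR k) (INR k))
       (g * exp (- sigma * ln c)).
Proof.
  intros [_ HG] Hs. specialize (HG (RtoC sigma) Hs).
  set (F := fun t : R => (rcpow t (RtoC sigma - 1) * RtoC (exp (- t)))%C) in HG.
  set (f := fun t => exp ((sigma - 1) * ln t - t)).
  assert (HF : forall t, F t = RtoC (f t)).
  { intros t. unfold F, f. rewrite <- RtoC_minus, rcpow_RtoC, <- RtoC_mult, <- exp_plus.
    reflexivity. }
  assert (Hcomp : forall a b (y : C), is_RInt (V := C_R_NormedModule) F a b y ->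
     fst y = RInt f a b /\ snd y = 0).
  { intros a b y Hy. split.
    - symmetry. apply is_RInt_unique.
      apply (is_RInt_fct_extend_fst (U := R_NormedModule) (V := R_NormedModule)) in Hy.
      apply is_RInt_ext with (2 := Hy). intros t _. rewrite HF. reflexivity.
    - apply (is_RInt_fct_extend_snd (U := R_NormedModule) (V := R_NormedModule)) in Hy.
      apply (is_RInt_ext _ (fun _ => 0)) in Hy; [|intros t _; rewrite HF; reflexivity].
      apply (is_RInt_unique (V := R_CompleteNormedModule)) in Hy.
      transitivity (RInt (fun _ : R => 0) a b); [symmetry; exact Hy|].
      rewrite RInt_const. apply Rmult_0_r. }
  exists (fst (Gamma (RtoC sigma))). split.
  - assert (Hsnd : snd (Gamma (RtoC sigma)) = 0).
    { apply Rabs_eq_0. apply Rle_antisym; [|apply Rabs_pos].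
      apply Rnot_lt_le. intros Hpos.
      destruct (is_RInt_gen_geometric F _ 1 (mkposreal _ Hpos) Rlt_0_1 HG) as [k Hk].
      destruct (Hk k (Nat.le_refl k)) as [y [Hy1 [_ Hy2]]]. simpl in Hy2.
      destruct (Hcomp _ _ _ Hy1) as [_ Hy3]. rewrite Hy3, Rminus_0_l, Rabs_Ropp in Hy2. lra. }
    destruct (Gamma (RtoC sigma)) as [u v]. simpl in Hsnd. rewrite Hsnd. reflexivity.
  - intros c Hc.
    apply is_lim_seq_ext with (fun k => RInt f (c * exp (- INR k)) (c * exp (INR k))
                                        * exp (- sigma * ln c)).
    { intros k. rewrite exp_substitution by exact Hc. apply Rmult_comm. }
    apply is_lim_seq_mult'; [|apply is_lim_seq_const].
    apply is_lim_seq_spec. intros eps.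
    apply (eventually_imp (fun k => exists y : C,
      is_RInt (V := C_R_NormedModule) F (c * exp (- INR k)) (c * exp (INR k)) y /\
      Rabs (fst y - fst (Gamma (RtoC sigma))) < eps /\
      Rabs (snd y - snd (Gamma (RtoC sigma))) < eps)).
    + intros k [y [Hy1 [Hy2 _]]]. destruct (Hcomp _ _ _ Hy1) as [Hy3 _]. rewrite <- Hy3. exact Hy2.
    + apply is_RInt_gen_geometric; assumption.
Qed.

Lemma zeta_real zeta s : is_zeta zeta -> 1 < s ->
  exists zr, zeta (RtoC s) = RtoC zr /\
    is_series (fun n => exp (- s * ln (INR (S n)))) zr.
Proof.
  intros [_ Hz] Hs. specialize (Hz (RtoC s) Hs).
  apply is_series_C_components in Hz. destruct Hz as [H1 H2].
  assert (Ht : forall k, rcpow (INR (S k)) (- RtoC s)%C = RtoC (exp (- s * ln (INR (S k))))).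
  { intros k. rewrite <- RtoC_opp, rcpow_RtoC. reflexivity. }
  exists (fst (zeta (RtoC s))). split.
  - assert (Hsnd : snd (zeta (RtoC s)) = 0).
    { apply is_series_unique in H2. rewrite <- H2.
      rewrite (Series_ext _ (fun n => 0 * 0)).
      - rewrite Series_scal_l. ring.
      - intros n. rewrite Ht. simpl. ring. }
    destruct (zeta (RtoC s)) as [u v]. simpl in Hsnd. rewrite Hsnd. reflexivity.
  - apply is_series_ext with (2 := H1). intros n. rewrite Ht. reflexivity.
Qed.

(** With s = z + 1/2, the factor s (s-1)/2 is (z^2 - 1/4)/2, which turns the
    pole term of [mellin_split] into the constant 1/2. *)
Lemma xi_on_half_line Gamma zeta xi z :
  is_Gamma Gamma -> is_zeta zeta -> is_xi Gamma zeta xi -> / 2 < z ->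
  exists l : R,
    is_lim_seq (cosh_moment z) l /\
    xi (RtoC (z + / 2)) = RtoC (/ 2 + (z ^ 2 - / 4) / 2 * l).
Proof.
  intros HG Hzeta [_ Hxi] Hz. set (s := z + / 2).
  assert (Hs : 1 < s) by (unfold s; lra).
  destruct (Gamma_real Gamma (s / 2) HG) as [g [Hg1 Hg2]]; [lra|].
  destruct (zeta_real zeta s Hzeta Hs) as [zr [Hz1 Hz2]].
  set (J := exp (- (s / 2) * ln PI) * g * zr).
  assert (HJ : is_lim_seq (fun k => RInt (fun y => exp ((z / 2 + / 4) * y) * psi (exp y))
                    (- INR k) (INR k)) J).
  { replace (z / 2 + / 4) with (s / 2) by (unfold s; field).
    apply mellin_psi; [lra|exact Hg2|].
    apply is_series_ext with (2 := Hz2). intros n. f_equal. f_equal. field. }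
  exists (J - / (z ^ 2 - / 4)). split; [apply mellin_split; assumption|].
  assert (Hs2 : (RtoC s / 2)%C = RtoC (s / 2)) by (rewrite RtoC_div by lra; reflexivity).
  assert (Hsm : (- RtoC s / 2)%C = RtoC (- (s / 2))).
  { replace (- (s / 2)) with (- s / 2) by field. rewrite <- RtoC_opp.
    rewrite RtoC_div by lra. reflexivity. }
  rewrite Hxi.
  - rewrite Hs2, Hsm, rcpow_RtoC, Hg1, Hz1.
    replace (1 / 2)%C with (RtoC (1 / 2)) by (rewrite RtoC_div by lra; reflexivity).
    rewrite <- RtoC_minus, <- !RtoC_mult. f_equal.
    replace (/ 2 + (z ^ 2 - / 4) / 2 * (J - / (z ^ 2 - / 4))) with ((z ^ 2 - / 4) / 2 * J)
      by (field; nra).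
    unfold J, s. field.
  - intros H. apply RtoC_inj in H. lra.
  - intros [k Hk]. rewrite Hs2 in Hk. apply RtoC_inj in Hk. assert (H := pos_INR k). lra.
Qed.

(** Coefficients of the power series of [cosh_expansion], padded by
    zeros at odd indices. *)
Definition even_coeff (k : nat) : R :=
  if Nat.even k then 2 * ((/ 2) ^ k / INR (fact k)) * moment k else 0.

Lemma even_coeff_pseries z (l : R) : 0 < z -> is_lim_seq (cosh_moment z) l ->
  is_pseries even_coeff z l.
Proof.
  intros Hz Hl. destruct (cosh_expansion z l Hz Hl) as [_ H].
  replace l with (l + z * 0) by ring.
  apply is_pseries_odd_even.
  - apply is_pseries_R. apply is_series_ext with (2 := H). intros n.
    unfold even_coeff. rewrite Nat.even_mul. cbn [Nat.even orb].
    replace (z / 2) with (/ 2 * z) by field. rewrite Rpow_mult_distr, <- pow_mult.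
    match goal with |- @eq _ ?u ?v => change (@eq R u v) end.
    field. apply INR_fact_neq_0.
  - apply is_pseries_R. apply is_series_ext with (fun _ => 0).
    + intros n. unfold even_coeff. rewrite Nat.even_add, Nat.even_mul. simpl. ring.
    + apply is_series_zero.
Qed.

(** Coefficients of 1/2 + (z^2 - 1/4)/2 times the series of [even_coeff]. *)
Definition xi_coeff (k : nat) : R :=
  (if Nat.eqb k 0 then / 2 else 0) + / 2 * (PS_incr_n even_coeff 2 k - / 4 * even_coeff k).

Lemma xi_coeff_pseries z (l : R) : is_pseries even_coeff z l ->
  is_pseries xi_coeff z (/ 2 + (z ^ 2 - / 4) / 2 * l).
Proof.
  intros H.
  assert (H1 := is_pseries_incr_n even_coeff 2 z l H).
  assert (H0 : is_pseries (fun k => if Nat.eqb k 0 then / 2 else 0) z (/ 2)).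
  { apply is_pseries_R. apply is_series_decr_1.
    apply is_series_ext with (fun _ => 0); [intros n; simpl; ring|].
    replace (plus _ _) with 0 by (unfold plus, opp; simpl; ring).
    apply is_series_zero. }
  apply is_pseries_R in H. apply is_pseries_R in H1. apply is_pseries_R in H0.
  apply is_pseries_R.
  assert (H2 := is_series_minus _ _ _ _ H1 (is_series_scal_l (/ 4) _ _ H)).
  assert (H3 := is_series_plus _ _ _ _ H0 (is_series_scal_l (/ 2) _ _ H2)).
  replace (/ 2 + (z ^ 2 - / 4) / 2 * l) with
    (plus (/ 2) (scal (/ 2) (minus (scal (pow_n z 2) l) (scal (/ 4) l)))).
  - apply is_series_ext with (2 := H3). intros n. unfold xi_coeff.
    unfold plus, minus, scal, opp; simpl; unfold mult, plus, opp; simpl. ring.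
  - unfold plus, minus, scal, opp; simpl; unfold mult, plus, opp, one; simpl. field.
Qed.

(** Real and imaginary parts of the Taylor series are compared separately
    with the series of [xi_coeff] and of 0, on z > 1/2. *)
Lemma xi_taylor Gamma zeta xi (a : nat -> C) :
  is_Gamma Gamma -> is_zeta zeta -> is_xi Gamma zeta xi ->
  is_taylor_coeffs xi (1 / 2)%C a -> forall n, a n = RtoC (xi_coeff n).
Proof.
  intros HG Hz Hxi Ha.
  assert (Hhalf : (1 / 2)%C = RtoC (/ 2)).
  { replace (/ 2) with (1 / 2) by field.
    rewrite RtoC_div by lra. reflexivity. }
  assert (Hps : forall t : R, is_pseries (fun n => fst (a n)) t (fst (xi (RtoC (t + / 2)))) /\
                  is_pseries (fun n => snd (a n)) t (snd (xi (RtoC (t + / 2))))).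
  { intros t. apply is_pseries_C_components.
    replace (RtoC t) with (RtoC (t + / 2) - 1 / 2)%C; [apply Ha|].
    rewrite Hhalf, <- RtoC_minus. f_equal. ring. }
  assert (Hxr : forall t, / 2 < t -> exists v : R, is_pseries xi_coeff t v /\ xi (RtoC (t + / 2)) = RtoC v).
  { intros t Ht. destruct (xi_on_half_line Gamma zeta xi t HG Hz Hxi Ht) as [l [Hl1 Hl2]].
    eexists. split; [|exact Hl2]. apply xi_coeff_pseries, even_coeff_pseries; [lra|exact Hl1]. }
  assert (Hex : forall t, ex_pseries xi_coeff t).
  { intros t. apply ex_pseries_R, ex_series_Rabs, CV_disk_inside.
    rewrite CV_radius_entire; [exact I|].
    intros u Hu. destruct (Hxr u Hu) as [v [Hv _]]. eexists; exact Hv. }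
  assert (Hsnd : forall n, snd (a n) = 0).
  { apply entire_identity.
    - intros t. eexists. apply Hps.
    - intros t Ht. destruct (Hps t) as [_ H]. rewrite (is_pseries_unique _ _ _ H).
      destruct (Hxr t Ht) as [v [_ ->]]. reflexivity. }
  assert (Hdiff : forall t, is_pseries (fun n => fst (a n) - xi_coeff n) t
            (fst (xi (RtoC (t + / 2))) - PSeries xi_coeff t)).
  { intros t. destruct (Hps t) as [H _]. assert (H' := PSeries_correct _ _ (Hex t)).
    apply is_pseries_R. apply is_pseries_R in H. apply is_pseries_R in H'.
    apply is_series_ext with (2 := is_series_minus _ _ _ _ H H').
    intros n. unfold plus, opp; simpl. ring. }
  assert (Hfst : forall n, fst (a n) - xi_coeff n = 0).
  { apply entire_identity.
    - intros t. eexists. apply Hdiff.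
    - intros t Ht. rewrite (is_pseries_unique _ _ _ (Hdiff t)).
      destruct (Hxr t Ht) as [v [Hv ->]]. rewrite (is_pseries_unique _ _ _ Hv). simpl. ring. }
  intros n. specialize (Hsnd n). specialize (Hfst n).
  destruct (a n) as [u v]. simpl in *. unfold RtoC. f_equal; lra.
Qed.

Lemma xi_coeff_even m :
  xi_coeff (2 * S m) =
  / 2 ^ (2 * S m) / INR (fact (2 * S m))
  * (4 * ((2 * INR (S m)) * (2 * INR (S m) - 1)) * moment (2 * m) - moment (2 * S m) / 4).
Proof.
  unfold xi_coeff.
  assert (Hi : PS_incr_n even_coeff 2 (2 * S m) = even_coeff (2 * m)).
  { replace (2 * S m)%nat with (S (S (2 * m))) by lia. reflexivity. }
  rewrite Hi. unfold even_coeff. rewrite !Nat.even_mul. cbn [Nat.even orb].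
  replace (2 * S m =? 0)%nat with false by (symmetry; apply Nat.eqb_neq; lia).
  replace (fact (2 * S m)) with ((2 * S m) * ((2 * m + 1) * fact (2 * m)))%nat.
  2:{ replace (2 * S m)%nat with (S (S (2 * m))) by lia.
      replace (2 * m + 1)%nat with (S (2 * m)) by lia. simpl fact. ring. }
  assert (P1 : (/ 2) ^ (2 * S m) = / 4 * (/ 2) ^ (2 * m)).
  { replace (2 * S m)%nat with (2 * m + 2)%nat by lia. rewrite pow_add. field. }
  rewrite <- pow_inv, P1.
  rewrite !mult_INR, plus_INR, mult_INR, !(S_INR m). simpl (INR 2). simpl (INR 1).
  assert (H := INR_fact_lt_0 (2 * m)). assert (H0 := pos_INR m).
  field. split; lra.
Qed.

(** * The asymptotic formula *)

Lemma mul_exp_surjective x : 0 <= x -> exists u, 0 <= u /\ u * exp u = x.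
Proof.
  intros Hx.
  destruct (IVT_gen (fun u => u * exp u) 0 x x) as [u [Hu1 Hu2]].
  - intros u. apply continuity_pt_filterlim.
    change (continuous (fun u => u * exp u) u). cont_auto.
  - rewrite Rmult_0_l. assert (H := exp_ineq1_le x).
    rewrite Rmin_left, Rmax_right by nra. nra.
  - rewrite Rmin_left in Hu1 by lra. exists u. split; [lra|exact Hu2].
Qed.

Lemma LambertW_inverse W x : is_LambertW W -> 0 <= x -> W x * exp (W x) = x.
Proof.
  intros [_ [_ HW]] Hx. destruct (mul_exp_surjective x Hx) as [u [Hu1 Hu2]].
  rewrite <- Hu2, HW by exact Hu1. reflexivity.
Qed.

Lemma LambertW_large W A : is_LambertW W -> 0 <= A ->
  eventually (fun n => A <= W (2 * INR n / PI)).
Proof.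
  intros [_ [HW1 HW2]] HA. assert (HP := PI_RGT_0).
  destruct (eventually_INR_ge (PI * (A * exp A + 1))) as [n0 Hn0].
  exists n0. intros n Hn. specialize (Hn0 n Hn).
  assert (HAe : 0 <= A * exp A) by (apply Rmult_le_pos; [exact HA|left; apply exp_pos]).
  rewrite <- (HW2 A HA). left. apply HW1; [exact HAe|].
  apply Rmult_lt_reg_r with PI; [exact HP|].
  replace (2 * INR n / PI * PI) with (2 * INR n) by (field; lra). nra.
Qed.

(** From exp w = exp(w/5)^5 >= (w/5)^5, with 450000 = 144 * 5^5. *)
Lemma exp_beats_quartic w : 450000 <= w -> 144 * w ^ 4 <= PI * exp w.
Proof.
  intros Hw. assert (HP := PI2_1).
  assert (H : (w / 5) ^ 5 <= exp w).
  { replace (exp w) with (exp (w / 5) ^ 5).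
    - apply pow_incr. assert (H := exp_ineq1_le (w / 5)). lra.
    - rewrite exp_pow_INR. f_equal. simpl. field. }
  assert (H4 : 0 < w ^ 4) by (apply pow_lt; lra).
  replace ((w / 5) ^ 5) with (w ^ 4 * (w / 3125)) in H by field.
  assert (w ^ 4 * 144 <= w ^ 4 * (w / 3125)) by (apply Rmult_le_compat_l; lra).
  assert (1 * exp w <= PI * exp w) by (apply Rmult_le_compat_r; [left; apply exp_pos|lra]). lra.
Qed.

Lemma ln_le_compat x y : 0 < x -> x <= y -> ln x <= ln y.
Proof. intros Hx [H| ->]; [left; apply ln_increasing; assumption|lra]. Qed.

(** The elementary constants of the main term come from here: the left-hand
    side is 4 (2n/w)^2 times the Gaussian width, the right-hand side carries
    2^(5/2), pi^(1/4) and the power 7/4 of 2n/w; recall pi exp w = 2n/w. *)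
Lemma gauss_width_normalization w :
  4 * (PI * exp w) ^ 2 * gauss_width w
  = Rpower 2 (5 / 2) * Rpower PI (1 / 4) * Rpower (PI * exp w) (7 / 4) * exp (- (w / 4)).
Proof.
  assert (HP := PI_RGT_0). assert (He := exp_pos w).
  assert (Hl : 0 < PI * exp w) by nra.
  assert (Hln : ln (PI * exp w) = ln PI + w) by (rewrite ln_mult, ln_exp by lra; reflexivity).
  unfold gauss_width. rewrite <- Rpower_sqrt by (apply Rdiv_lt_0_compat; lra).
  replace (4 * (PI * exp w) ^ 2) with (exp (ln 2 + ln 2 + (ln (PI * exp w) + ln (PI * exp w))))
    by (rewrite !exp_plus, !exp_ln by lra; ring).
  assert (Hq : ln (2 * PI / (PI * exp w)) = ln 2 - w).
  { replace (2 * PI / (PI * exp w)) with (2 * exp (- w)) by (rewrite exp_Ropp; field; lra).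
    rewrite ln_mult, ln_exp by (try lra; apply exp_pos). ring. }
  unfold Rpower. rewrite Hq, Hln.
  rewrite <- !exp_plus. f_equal. field.
Qed.

Lemma Rpower_div_base x y z : 0 < x -> 0 < y -> Rpower (x / y) z = Rpower x z / Rpower y z.
Proof.
  intros Hx Hy. unfold Rpower, Rdiv. rewrite <- exp_Ropp, <- exp_plus. f_equal.
  rewrite ln_mult, ln_Rinv by (try lra; apply Rinv_0_lt_compat; lra). ring.
Qed.

Definition main_term (W : R -> R) (n : nat) : R :=
  (Rpower PI (1 / 4) / (Rpower 2 (2 * INR n - 5 / 2) * INR (fact (2 * n))))
  * Rpower (2 * INR n / ln (2 * INR n)) (7 / 4)
  * exp (2 * INR n * (ln (2 * INR n / PI) - W (2 * INR n / PI) - 1 / W (2 * INR n / PI))).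

Lemma main_term_pos W n : 0 < main_term W n.
Proof.
  unfold main_term. repeat apply Rmult_lt_0_compat; try apply exp_pos.
  apply Rinv_0_lt_compat, Rmult_lt_0_compat; [apply exp_pos|apply INR_fact_lt_0].
Qed.

(** Since ln(2n/pi) = ln w + w, the exponential factor is
    w^(2n) exp(-pi exp w), that is, peak (2n) w without exp(w/4). *)
Lemma main_term_eq W n (w : R) : is_LambertW W -> w = W (2 * INR n / PI) -> 1 <= w ->
  main_term W n = / 2 ^ (2 * n) / INR (fact (2 * n))
    * (4 * (PI * exp w) ^ 2 * gauss_width w * peak (2 * n) w / Rpower (ln (2 * INR n) / w) (7 / 4)).
Proof.
  intros HW Hw Hw1. assert (HP := PI_RGT_0). assert (He := exp_pos w). assert (Hn0 := pos_INR n).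
  assert (HwW : w * exp w = 2 * INR n / PI).
  { rewrite Hw. apply LambertW_inverse; [exact HW|]. apply Rdiv_le_0_compat; lra. }
  assert (Hlam : w * (PI * exp w) = 2 * INR n).
  { replace (w * (PI * exp w)) with (PI * (w * exp w)) by ring. rewrite HwW. field. lra. }
  assert (Hl : 0 < PI * exp w) by nra.
  assert (Hn : 0 < 2 * INR n) by nra.
  unfold main_term. rewrite <- Hw.
  assert (Hlnx : ln (2 * INR n / PI) = ln w + w) by (rewrite <- HwW, ln_mult, ln_exp by lra; reflexivity).
  assert (Hln2n : ln (2 * INR n) = ln w + ln PI + w).
  { rewrite <- Hlam, !ln_mult, ln_exp by (try lra). ring. }
  assert (Hlnw : 0 <= ln w) by (rewrite <- ln_1; apply ln_le_compat; lra).
  assert (HlnPI : 0 < ln PI) by (rewrite <- ln_1; apply ln_increasing; assert (H := PI2_1); lra).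
  assert (Hln : 0 < ln (2 * INR n)) by lra.
  assert (Hrho : 0 < ln (2 * INR n) / w) by (apply Rdiv_lt_0_compat; lra).
  replace (2 * INR n / ln (2 * INR n)) with (PI * exp w / (ln (2 * INR n) / w)).
  2:{ rewrite <- Hlam at 2. field. split; lra. }
  rewrite Rpower_div_base by assumption.
  replace (exp (2 * INR n * (ln (2 * INR n / PI) - w - 1 / w)))
    with (peak (2 * n) w * exp (- (w / 4))).
  2:{ unfold peak. rewrite <- Rpower_pow by lra. unfold Rpower. rewrite <- !exp_plus. f_equal.
      rewrite mult_INR. simpl (INR 2). rewrite Hlnx.
      replace (2 * INR n * (ln w + w - w - 1 / w)) with (2 * INR n * ln w - (2 * INR n) / w)
        by (field; lra).
      rewrite <- Hlam at 2. field. lra. }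
  rewrite gauss_width_normalization.
  replace (Rpower 2 (2 * INR n - 5 / 2)) with (2 ^ (2 * n) / Rpower 2 (5 / 2)).
  2:{ rewrite <- Rpower_pow by lra. rewrite mult_INR. simpl (INR 2).
      unfold Rminus, Rdiv at 1. rewrite Rpower_plus, <- Rpower_Ropp. f_equal. }
  assert (H1 := INR_fact_lt_0 (2 * n)).
  assert (H2 : 0 < Rpower 2 (5 / 2)) by apply exp_pos.
  assert (H3 : 0 < Rpower (ln (2 * INR n) / w) (7 / 4)) by apply exp_pos.
  assert (H4 : 0 < 2 ^ (2 * n)) by (apply pow_lt; lra).
  field. repeat split; lra.
Qed.

(** [moment] is defined by a total limit operator; the expansion at z = 1
    shows that the limit exists. *)
Lemma even_moment_limit Gamma zeta xi n :
  is_Gamma Gamma -> is_zeta zeta -> is_xi Gamma zeta xi ->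
  is_lim_seq (fun k => RInt (fun y => y ^ (2 * n) * theta_density y) 0 (INR k)) (moment (2 * n)).
Proof.
  intros HG Hz Hxi. destruct (xi_on_half_line Gamma zeta xi 1 HG Hz Hxi) as [l [Hl _]]; [lra|].
  destruct (cosh_expansion 1 l ltac:(lra) Hl) as [H _]. apply H.
Qed.

(** The quotient is (D/Base) * rho^(7/4), where D/Base collects the relative
    errors O(1/w) of the two moments and rho = ln(2n)/w = 1 + O(ln w/w). *)
Lemma coefficient_ratio_bound W m (w : R) :
  is_LambertW W -> w = W (2 * INR (S m) / PI) -> 450000 <= w ->
  (forall n, is_lim_seq (fun k => RInt (fun y => y ^ (2 * n) * theta_density y) 0 (INR k)) (moment (2 * n))) ->
  (1 <= m)%nat ->
  Rabs (xi_coeff (2 * S m) / main_term W (S m) - 1) <= 24 * (ln w / w).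
Proof.
  intros HW Hw Hwbig Hmom Hm.
  assert (HP := PI_RGT_0). assert (HP2 := PI2_1). assert (HP4 := PI_4). assert (He := exp_pos w).
  assert (Hbig := exp_beats_quartic w Hwbig).
  assert (HwW : w * exp w = 2 * INR (S m) / PI).
  { rewrite Hw. apply LambertW_inverse; [exact HW|]. apply Rdiv_le_0_compat; [|lra].
    assert (H := pos_INR (S m)). lra. }
  assert (Hlam : w * (PI * exp w) = 2 * INR (S m)).
  { replace (w * (PI * exp w)) with (PI * (w * exp w)) by ring. rewrite HwW. field. lra. }
  assert (Hl : 0 < PI * exp w) by nra.
  assert (Hmain := main_term_eq W (S m) w HW Hw ltac:(lra)).
  assert (H2Sm : INR (2 * S m) = 2 * INR (S m)) by (rewrite mult_INR; reflexivity).
  assert (HM1 := moment_bounds w (2 * S m) 0 ltac:(lra) Hbig ltac:(lra) ltac:(lra) ltac:(lia) (Hmom (S m))).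
  assert (HM0 := moment_bounds w (2 * m) 2 ltac:(lra) Hbig ltac:(lra)
     ltac:(rewrite Hlam, S_INR, mult_INR; simpl; ring) ltac:(lia) (Hmom m)).
  assert (Hpk : peak (2 * m) w = peak (2 * S m) w * / w ^ 2).
  { unfold peak. replace (2 * S m)%nat with (2 * m + 2)%nat by lia. rewrite pow_add. field. lra. }
  rewrite Hpk in HM0.
  assert (Hxi := xi_coeff_even m).
  assert (Hs := gauss_width_pos w). assert (HpP := peak_pos (2 * S m) w ltac:(lra)).
  assert (Hln2n : ln (2 * INR (S m)) = ln w + ln PI + w).
  { rewrite <- Hlam, !ln_mult, ln_exp by lra. ring. }
  set (lam := PI * exp w) in *. set (P := peak (2 * S m) w) in *. set (s := gauss_width w) in *.
  set (M0 := moment (2 * m)) in *. set (M1 := moment (2 * S m)) in *.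
  set (x := / w) in *.
  assert (Hx0 : 0 < x) by (apply Rinv_0_lt_compat; lra).
  assert (Hx1 : x <= / 450000) by (apply Rinv_le_contravar; lra).
  assert (Hwx : w * x = 1) by (apply Rinv_r; lra).
  set (rho := ln (2 * INR (S m)) / w) in *. set (r := Rpower rho (7 / 4)) in *.
  set (D := 4 * (2 * INR (S m) * (2 * INR (S m) - 1)) * M0 - M1 / 4) in *.
  set (Base := 4 * lam ^ 2 * s * P) in *.
  assert (HBase : 0 < Base).
  { assert (0 < lam ^ 2) by (apply pow_lt; exact Hl).
    unfold Base. apply Rmult_lt_0_compat; [|exact HpP]. apply Rmult_lt_0_compat; lra. }
  assert (Hr0 : 0 < r) by apply exp_pos.
  assert (HR : xi_coeff (2 * S m) / main_term W (S m) = D / Base * r).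
  { rewrite Hxi, Hmain. fold Base.
    assert (H1 := INR_fact_lt_0 (2 * S m)).
    assert (H4 : 0 < 2 ^ (2 * S m)) by (apply pow_lt; lra).
    field. repeat split; lra. }
  rewrite HR.
  (* The contribution q1 of the moment of order 2n carries 1/lam^2 and is below 1/w. *)
  assert (Hlamw : w ^ 4 <= lam) by (assert (0 < w ^ 4) by (apply pow_lt; lra); lra).
  assert (Hw4 : w <= w ^ 4) by (replace w with (w ^ 1) at 1 by ring; apply Rle_pow; [lra|lia]).
  assert (Hsp : 0 < P * s) by (apply Rmult_lt_0_compat; lra).
  set (q0 := M0 * w ^ 2 / (P * s)). set (q1 := M1 / (P * s)).
  assert (Hq0 : 1 - 8 * x <= q0 <= 1 + 8 * x).
  { unfold q0. destruct HM0 as [HM0a HM0b].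
    assert (Hw2 : 0 < w ^ 2) by (apply pow_lt; lra).
    split.
    - apply Rle_div_r; [exact Hsp|]. apply Rmult_le_compat_r with (r := w ^ 2) in HM0a; [|lra].
      replace (P * / w ^ 2 * s * (1 - 8 * x) * w ^ 2) with ((1 - 8 * x) * (P * s)) in HM0a
        by (field; lra). exact HM0a.
    - apply Rle_div_l; [exact Hsp|]. apply Rmult_le_compat_r with (r := w ^ 2) in HM0b; [|lra].
      replace (P * / w ^ 2 * s * (1 + 8 * x) * w ^ 2) with ((1 + 8 * x) * (P * s)) in HM0b
        by (field; lra). exact HM0b. }
  assert (Hq1 : 0 <= q1 <= 2).
  { unfold q1. destruct HM1 as [HM1a HM1b]. split.
    - apply Rle_div_r; [exact Hsp|]. rewrite Rmult_0_l.
      eapply Rle_trans; [|exact HM1a]. apply Rmult_le_pos; lra.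
    - apply Rle_div_l; [exact Hsp|]. eapply Rle_trans; [exact HM1b|].
      rewrite Rmult_comm. apply Rmult_le_compat_r; lra. }
  assert (HD : D / Base = q0 * (1 - / (w * lam)) - q1 / (16 * lam ^ 2)).
  { unfold D, Base, q0, q1. rewrite <- Hlam. field. repeat split; lra. }
  assert (Hwl : 0 <= / (w * lam) <= x).
  { split; [left; apply Rinv_0_lt_compat; nra|]. apply Rinv_le_contravar; nra. }
  assert (Hl2 : 0 <= q1 / (16 * lam ^ 2) <= x).
  { assert (0 < 16 * lam ^ 2) by nra. split; [apply Rdiv_le_0_compat; lra|].
    apply Rle_div_l; [assumption|].
    assert (w * 1 <= lam ^ 2) by (assert (1 <= lam) by lra; nra).
    assert (x * (w * 1) <= x * lam ^ 2) by (apply Rmult_le_compat_l; lra). lra. }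
  assert (HDb : 1 - 10 * x <= D / Base <= 1 + 8 * x).
  { rewrite HD. split; nra. }
  (* Here ln(2n) = w + ln w + ln pi and ln pi <= ln w. *)
  assert (Hlnw : 1 <= ln w).
  { rewrite <- (ln_exp 1). apply ln_le_compat; [apply exp_pos|]. assert (H := exp_le_3). lra. }
  assert (HlnPI : 0 <= ln PI <= ln w).
  { split; [rewrite <- ln_1|]; apply ln_le_compat; lra. }
  set (L := ln w / w).
  assert (HxL : x <= L) by (unfold L, Rdiv; fold x; nra).
  assert (HL1 : L <= / 2).
  { apply Rle_div_l; [lra|].
    assert (H := exp_ineq1_le (ln w / 2)).
    assert (Hsq : exp (ln w / 2) * exp (ln w / 2) = w).
    { rewrite <- exp_plus. replace (ln w / 2 + ln w / 2) with (ln w) by field. apply exp_ln. lra. }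
    nra. }
  assert (Hrho : 1 <= rho <= 1 + 2 * L).
  { unfold rho. rewrite Hln2n. split.
    - apply Rle_div_r; lra.
    - apply Rle_div_l; [lra|]. unfold L.
      replace ((1 + 2 * (ln w / w)) * w) with (w + 2 * ln w) by (field; lra). lra. }
  assert (Hr : 1 <= r <= 1 + 6 * L).
  { unfold r. split.
    - rewrite <- (Rpower_O rho) at 1 by lra. apply Rle_Rpower; lra.
    - apply Rle_trans with (Rpower rho 2); [apply Rle_Rpower; lra|].
      replace 2 with (INR 2) by (simpl; ring). rewrite Rpower_pow by lra. nra. }
  apply Rabs_le. split.
  - assert (1 - 10 * x <= D / Base * r) by nra. lra.
  - assert (D / Base * r <= (1 + 8 * x) * (1 + 6 * L)) by (apply Rmult_le_compat; lra).
    nra.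
Qed.

(** From ln n = w + ln w + ln(pi/2), both w <= ln n and ln n <= 2 w. *)
Lemma ln_ratio_bound W n (w : R) :
  is_LambertW W -> w = W (2 * INR n / PI) -> 450000 <= w ->
  0 <= ln w / w <= 2 * (ln (ln (INR n)) / ln (INR n)).
Proof.
  intros HW Hw Hwbig.
  assert (HP := PI_RGT_0). assert (HP2 := PI2_1). assert (HP4 := PI_4). assert (He := exp_pos w).
  assert (Hbig := exp_beats_quartic w Hwbig). assert (Hn0 := pos_INR n).
  assert (HwW : w * exp w = 2 * INR n / PI).
  { rewrite Hw. apply LambertW_inverse; [exact HW|]. apply Rdiv_le_0_compat; lra. }
  assert (Hn : INR n = PI / 2 * (w * exp w)) by (rewrite HwW; field; lra).
  assert (Hwe : 0 < w * exp w) by nra.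
  assert (Hln : ln (INR n) = ln (PI / 2) + ln w + w).
  { rewrite Hn, ln_mult, ln_mult, ln_exp by lra. ring. }
  assert (Hlnw : 0 <= ln w) by (rewrite <- ln_1; apply ln_le_compat; lra).
  assert (HlnPI : 0 <= ln (PI / 2)) by (rewrite <- ln_1; apply ln_le_compat; lra).
  assert (Hlow : w <= ln (INR n)) by lra.
  assert (Hup : ln (INR n) <= 2 * w).
  { assert (H : ln (PI / 2) + ln w <= w); [|lra].
    rewrite <- ln_mult by lra. rewrite <- (ln_exp w) at 2. apply ln_le_compat; [nra|].
    assert (w <= w ^ 4) by (replace w with (w ^ 1) at 1 by ring; apply Rle_pow; [lra|lia]). nra. }
  split; [apply Rdiv_le_0_compat; lra|].
  assert (Hll : ln w <= ln (ln (INR n))) by (apply ln_le_compat; lra).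
  apply Rle_trans with (ln (ln (INR n)) / w).
  - unfold Rdiv. apply Rmult_le_compat_r; [left; apply Rinv_0_lt_compat; lra|exact Hll].
  - replace (2 * (ln (ln (INR n)) / ln (INR n))) with (ln (ln (INR n)) * (2 / ln (INR n)))
      by (field; lra).
    apply Rmult_le_compat_l; [lra|].
    apply Rle_div_r; [lra|]. apply Rmult_le_reg_l with w; [lra|].
    replace (w * (/ w * ln (INR n))) with (ln (INR n)) by (field; lra). lra.
Qed.

Theorem theorem6p1 (Gamma zeta xi : C -> C) (a : nat -> C) (W : R -> R)
  (hGamma : is_Gamma Gamma) (hzeta : is_zeta zeta) (hxi : is_xi Gamma zeta xi)
  (ha : is_taylor_coeffs xi (1 / 2)%C a) (hW : is_LambertW W) :
  exists eps : nat -> R,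
    big_O eps (fun n => ln (ln (INR n)) / ln (INR n)) /\
    eventually (fun n =>
      a (2 * n)%nat =
      RtoC ((1 + eps n)
        * (Rpower PI (1 / 4)
           / (Rpower 2 (2 * INR n - 5 / 2) * INR (fact (2 * n))))
        * Rpower (2 * INR n / ln (2 * INR n)) (7 / 4)
        * exp (2 * INR n
               * (ln (2 * INR n / PI)
                  - W (2 * INR n / PI)
                  - 1 / W (2 * INR n / PI))))).
Proof.
  (* The relative error is taken as the definition of eps; only its size is at stake. *)
  exists (fun n => xi_coeff (2 * n) / main_term W n - 1). split.
  (* 48 = 24 * 2, from the two preceding bounds. *)
  - exists 48.
    destruct (LambertW_large W 450000 hW ltac:(lra)) as [n0 Hn0].
    exists (n0 + 2)%nat. intros n Hn. specialize (Hn0 n ltac:(lia)).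
    destruct n as [|m]; [lia|].
    assert (Hb := ln_ratio_bound W (S m) _ hW eq_refl Hn0).
    eapply Rle_trans.
    + apply (coefficient_ratio_bound W m _ hW eq_refl Hn0); [|lia].
      intros n. apply (even_moment_limit Gamma zeta xi); assumption.
    + rewrite Rabs_pos_eq by lra. lra.
  - exists 0%nat. intros n _. rewrite (xi_taylor Gamma zeta xi a hGamma hzeta hxi ha).
    f_equal. assert (H := main_term_pos W n).
    transitivity ((1 + (xi_coeff (2 * n) / main_term W n - 1)) * main_term W n).
    + field. lra.
    + unfold main_term at 2. rewrite !Rmult_assoc. reflexivity.
Qed.
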